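(* Let $(M^2,g)$ be a Riemannian surface with Gaussian curvature $K$ satisfying $(\operatorname{grad}K)(p)\neq0$ and $1-K(p)>0$ at any point $p\in M$. Let $X_1=\frac{\operatorname{grad}K}{|\operatorname{grad}K|}$ and let $X_2$ be a vector field on $M$ such that $\{X_1(p),X_2(p)\}$ is a positively oriented orthonormal basis at any point $p\in M$. Then $$X_2X_1K=0\quad\text{and}\quad \nabla_{X_2}X_2=-\frac{3X_1K}{8(1-K)}X_1$$ if and only if the Riemannian metric $g$ can be locally written as $g=e^{2\varphi(u)}(du^2+dv^2)$, where $u=u(\varphi)$ (the inverse function of $\varphi=\varphi(u)$) satisfies $$u=u(\varphi)=\pm\int_{\varphi_0}^{\varphi}\frac{d\tau}{\sqrt{\frac{b}{3}e^{-\frac23\tau}-e^{2\tau}+a}}+c,\qquad \varphi\in I,$$ where $a,b,c\in\mathbb{R}$ are constants, $a>0$, $b<0$, $\frac{b}{3}e^{-\frac23\varphi}-e^{2\varphi}+a>0$ for every $\varphi\in I$, and $I$ is some open interval (with $\varphi_0\in I$).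
   Context: $\nabla$ is the Levi-Civita connection of $g$, and $X_2X_1K=X_2(X_1(K))$. ''Locally written'' means that around each point of $M$ there are local coordinates $(u,v)$ in which $g$ has the stated form, with $\varphi$ a function of $u$ only. *)

(* Defs.v *)
From Stdlib Require Import Reals.
From Coquelicot Require Import Coquelicot.
Set Implicit Arguments.
Unset Strict Implicit.
Unset Printing Implicit Defensive.
Open Scope R_scope.

Inductive axis := e1 | e2.

Definition sum2 (F : axis -> R) : R := F e1 + F e2.

Definition open2 (D : R -> R -> Prop) : Prop :=
  forall x y, D x y -> locally_2d D x y.

(* For [D] open, this is C^infty on [D]: [ex_diff_n f n x y] says that every
   iterated partial derivative of order at most [n] exists (order < n) and is
   continuous at [(x, y)]. *)
Definition smooth_on (D : R -> R -> Prop) (f : R -> R -> R) : Prop :=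
  forall n x y, D x y -> ex_diff_n f n x y.

(* [coord] is meaningful on [dom] only, and [cinv] on the image of [dom]. *)
Record chart (T : Type) := Chart {
  dom : T -> Prop;
  coord : axis -> T -> R;
  cinv : R -> R -> T;
  cinvK : forall p, dom p -> cinv (coord e1 p) (coord e2 p) = p;
  cimg_open :
    open2 (fun x y => exists p, dom p /\ coord e1 p = x /\ coord e2 p = y)
}.

Definition cimg T (c : chart T) (x y : R) : Prop :=
  exists p, dom c p /\ coord c e1 p = x /\ coord c e2 p = y.

Definition overlap T (c d : chart T) (x y : R) : Prop :=
  cimg c x y /\ dom d (cinv c x y).

Definition compatible T (c d : chart T) : Prop :=
  open2 (overlap c d) /\
  forall k, smooth_on (overlap c d) (fun x y => coord d k (cinv c x y)).

(* The topology induced by an atlas. *)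
Definition atlas_open T (A : chart T -> Prop) (U : T -> Prop) : Prop :=
  forall c, A c -> open2 (fun x y => cimg c x y /\ U (cinv c x y)).

(* A smooth surface without boundary: a set with a maximal smooth atlas whose
   topology is Hausdorff and second countable.  [chart_at] only serves to write
   scalars that do not depend on the chart used to compute them. *)
Record surface := Surface {
  pts :> Type;
  atlas : chart pts -> Prop;
  chart_at : pts -> chart pts;
  chart_at_atlas : forall p, atlas (chart_at p);
  chart_at_dom : forall p, dom (chart_at p) p;
  atlas_compatible : forall c d, atlas c -> atlas d -> compatible c d;
  atlas_maximal : forall c,
    (forall d, atlas d -> compatible c d /\ compatible d c) -> atlas c;
  hausdorff : forall p q : pts, p <> q ->
    exists U V, atlas_open atlas U /\ atlas_open atlas V /\ U p /\ V q /\
      forall r, ~ (U r /\ V r);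
  second_countable : exists B : nat -> pts -> Prop,
    (forall n, atlas_open atlas (B n)) /\
    forall U p, atlas_open atlas U -> U p ->
      exists n, B n p /\ forall q, B n q -> U q
}.

Definition smooth_in T (c : chart T) (f : T -> R) : Prop :=
  smooth_on (cimg c) (fun x y => f (cinv c x y)).

(* Partial derivative of [f] with respect to the [i]-th coordinate of [c]. *)
Definition pd T (c : chart T) (i : axis) (f : T -> R) (p : T) : R :=
  match i with
  | e1 => Derive (fun t => f (cinv c t (coord c e2 p))) (coord c e1 p)
  | e2 => Derive (fun t => f (cinv c (coord c e1 p) t)) (coord c e2 p)
  end.

(* Tensor fields are given by their components in every chart, subject to the
   usual transformation laws. *)
Definition field (T : Type) := chart T -> axis -> T -> R.
Definition bifield (T : Type) := chart T -> axis -> axis -> T -> R.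

Definition is_vector_field (S : surface) (X : field S) : Prop :=
  (forall c d p k, atlas c -> atlas d -> dom c p -> dom d p ->
     X d k p = sum2 (fun i => pd c i (coord d k) p * X c i p)) /\
  (forall c k, atlas c -> smooth_in c (X c k)).

Definition is_metric (S : surface) (g : bifield S) : Prop :=
  (forall c d p i j, atlas c -> atlas d -> dom c p -> dom d p ->
     g c i j p = sum2 (fun k => sum2 (fun l =>
       pd c i (coord d k) p * pd c j (coord d l) p * g d k l p))) /\
  (forall c i j, atlas c -> smooth_in c (g c i j)) /\
  (forall c p i j, atlas c -> dom c p -> g c i j p = g c j i p) /\
  (forall c p (v : axis -> R), atlas c -> dom c p -> (exists i, v i <> 0) ->
     0 < sum2 (fun i => sum2 (fun j => g c i j p * v i * v j))).

(* An orientation, as an atlas with positive transition Jacobians. *)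
Definition is_orientation (S : surface) (O : chart S -> Prop) : Prop :=
  (forall c, O c -> atlas c) /\
  (forall p, exists c, O c /\ dom c p) /\
  (forall c d p, O c -> O d -> dom c p -> dom d p ->
     0 < pd c e1 (coord d e1) p * pd c e2 (coord d e2) p
         - pd c e1 (coord d e2) p * pd c e2 (coord d e1) p).

Section Riemannian.
Variable S : surface.
Implicit Types (O : chart S -> Prop) (g : bifield S) (X Y : field S).
Implicit Types (f : S -> R) (c : chart S) (p : S).

Definition inner g X Y p : R :=
  let c := chart_at p in
  sum2 (fun i => sum2 (fun j => g c i j p * X c i p * Y c j p)).

Definition vnorm g X p : R := sqrt (inner g X X p).

Definition vanishes_at X p : Prop := forall i, X (chart_at p) i p = 0.

Definition orthonormal_at g X Y p : Prop :=
  inner g X X p = 1 /\ inner g Y Y p = 1 /\ inner g X Y p = 0.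

Definition positively_oriented_at O X Y p : Prop :=
  forall c, O c -> dom c p ->
    0 < X c e1 p * Y c e2 p - X c e2 p * Y c e1 p.

(* The function [X f]. *)
Definition act X f p : R :=
  let c := chart_at p in sum2 (fun i => X c i p * pd c i f p).

Definition scale f X : field S := fun c i p => f p * X c i p.

Definition vf_eq X Y : Prop :=
  forall c p i, atlas c -> dom c p -> X c i p = Y c i p.

Definition gdet g c p : R :=
  g c e1 e1 p * g c e2 e2 p - g c e1 e2 p * g c e2 e1 p.

Definition ginv g c i j p : R :=
  match i, j with
  | e1, e1 => g c e2 e2 p / gdet g c p
  | e2, e2 => g c e1 e1 p / gdet g c p
  | e1, e2 => - g c e1 e2 p / gdet g c p
  | e2, e1 => - g c e2 e1 p / gdet g c p
  end.

Definition grad g f : field S :=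
  fun c i p => sum2 (fun j => ginv g c i j p * pd c j f p).

(* [christoffel g c k i j] is Gamma^k_{ij} in the chart [c]. *)
Definition christoffel g c k i j p : R :=
  / 2 * sum2 (fun l => ginv g c k l p *
    (pd c i (g c j l) p + pd c j (g c i l) p - pd c l (g c i j) p)).

(* Covariant derivative of [w] along [v], for fields on the domain of [c] given
   by their components in [c]. *)
Definition covd g c (v w : axis -> S -> R) (k : axis) p : R :=
  sum2 (fun i => v i p *
    (pd c i (w k) p + sum2 (fun j => christoffel g c k i j p * w j p))).

(* The Levi-Civita connection. *)
Definition nabla g X Y : field S := fun c => covd g c (X c) (Y c).

Definition coord_field (i k : axis) p : R :=
  match i, k with e1, e1 | e2, e2 => 1 | _, _ => 0 end.

(* [K = <R(d1,d2)d2, d1> / (g11 g22 - g12^2)], where the coordinate fields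
   [d1], [d2] commute, so that
   [R(d1,d2)d2 = nabla_d1 (nabla_d2 d2) - nabla_d2 (nabla_d1 d2)]. *)
Definition gaussian_curvature g p : R :=
  let c := chart_at p in
  let d1 := coord_field e1 in
  let d2 := coord_field e2 in
  sum2 (fun k => g c e1 k p *
    (covd g c d1 (covd g c d2 d2) k p - covd g c d2 (covd g c d1 d2) k p))
  / gdet g c p.

End Riemannian.

Definition open_interval (lo hi : Rbar) (t : R) : Prop :=
  Rbar_lt lo t /\ Rbar_lt t hi.

Definition radicand (a b t : R) : R :=
  b / 3 * exp (- (2 / 3) * t) - exp (2 * t) + a.

(* In the coordinates [(u, v)] of [c], [g = e^{2 phi(u)} (du^2 + dv^2)]. *)
Definition conformal_in_u (S : surface) (g : bifield S) (c : chart S)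
    (phi : R -> R) : Prop :=
  forall q, dom c q ->
    g c e1 e1 q = exp (2 * phi (coord c e1 q)) /\
    g c e1 e2 q = 0 /\ g c e2 e1 q = 0 /\
    g c e2 e2 q = exp (2 * phi (coord c e1 q)).

Definition inverse_functions (J I : R -> Prop) (phi psi : R -> R) : Prop :=
  (forall u, J u -> I (phi u) /\ psi (phi u) = u) /\
  (forall t, I t -> J (psi t) /\ phi (psi t) = t).

(* [phi] is a function on the range of the coordinate [u] of [c], with inverse
   [ufun], defined on the open interval I = (lo, hi). *)
Definition locally_written (S : surface) (g : bifield S) (p : S) : Prop :=
  exists (c : chart S) (phi ufun : R -> R) (lo hi : Rbar)
         (a b c0 phi0 eps : R),
    let I := open_interval lo hi in
    atlas c /\ dom c p /\
    conformal_in_u g c phi /\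
    inverse_functions (fun u => exists v, cimg c u v) I phi ufun /\
    0 < a /\ b < 0 /\ I phi0 /\ (eps = 1 \/ eps = -1) /\
    (forall t, I t -> 0 < radicand a b t) /\
    (forall t, I t ->
       ufun t = eps * RInt (fun tau => / sqrt (radicand a b tau)) phi0 t + c0).

(* Main.v *)
Require Import Defs.
From Stdlib Require Import Reals Ranalysis5 Lra Lia ClassicalEpsilon.
From Coquelicot Require Import Coquelicot.
Open Scope R_scope.

(** Suppose first that the two equations hold.  Put
    [phi = -(3/8) ln (1 - K)], so that [1 - K = exp (-(8/3) phi)], and consider
    the 1-forms dual to X1 and X2 divided by [exp phi]:
    [theta1 = dK / (|grad K| exp phi)] and [theta2 = X2^flat / exp phi].
    Both are closed.  For [theta1] this holds because X2 K = 0 and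
    X2 |grad K| = X2 X1 K = 0, hence the differentials of K, of |grad K| and of
    phi are proportional ([theta1_closed]).  For [theta2], the acceleration of
    the unit field X2 is the contraction of X2 with the exterior derivative of
    its dual form ([unit_field_curl]); the second equation makes it the multiple
    of dK that the differential of the factor [exp phi] cancels
    ([theta2_closed]).  Therefore locally [theta1 = du] and [theta2 = dv], and
    [g = exp (2 phi) (du^2 + dv^2)] with phi a function of u alone.  Gauss's
    equation [K = - exp (-2 phi) phi''] ([conformal_curvature]) becomes
    [phi'' = exp (-(2/3) phi) - exp (2 phi)].  Its energy is constant, which
    reads [phi'^2 = radicand a b phi] with [b = -9], and since [phi' > 0]
    separation of variables expresses u as the quadrature
    ([quadrature_of_ode]).

    Conversely, in such coordinates the quadrature says
    [phi'^2 = radicand a b phi]; one more derivative and Gauss's equation give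
    [1 - K = -(b/9) exp (-(8/3) phi)].  Thus K depends on u alone, X2 is
    [exp (-phi)] times plus or minus the coordinate field of v, and both equations
    are read off from the Christoffel symbols ([equations_of_normal_form]).

    The curvature, the gradient and the connection are defined through
    components in charts, so three general facts are established on the way:
    these objects do not depend on the chart ([christoffel_law], [covd_law],
    [curvatureE]); two functions with independent differentials form a chart of
    the maximal atlas ([coordinates_of_independent], by solving for one
    coordinate at a time with the implicit function theorem in one variable);
    and closed 1-forms have local primitives ([closed_form_primitive]). *)

(** * Germs of smooth functions of two variables *)


Definition dx (f : R -> R -> R) (x y : R) : R := Derive (fun z => f z y) x.
Definition dy (f : R -> R -> R) (x y : R) : R := Derive (fun z => f x z) y.

Definition Cnear (n : nat) (f : R -> R -> R) (x y : R) : Prop :=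
  locally_2d (fun u v => ex_diff_n f n u v) x y.

Definition partials_exist (f : R -> R -> R) (x y : R) : Prop :=
  continuity_2d_pt f x y /\
  ex_derive (fun z => f z y) x /\ ex_derive (fun z => f x z) y.

Lemma locally_2d_mono (P Q : R -> R -> Prop) x y :
  (forall u v, P u v -> Q u v) -> locally_2d P x y -> locally_2d Q x y.
Proof.
  intros H; apply locally_2d_impl, locally_2d_forall; exact H.
Qed.

Lemma locally_2d_nested (P : R -> R -> Prop) x y :
  locally_2d P x y -> locally_2d (locally_2d P) x y.
Proof.
  apply locally_2d_impl_strong, locally_2d_forall; auto.
Qed.

Lemma Cnear_S n f x y :
  Cnear (S n) f x y <->
  locally_2d (partials_exist f) x y /\ Cnear n (dx f) x y /\ Cnear n (dy f) x y.
Proof.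
  split.
  - intros H; repeat split; revert H; apply locally_2d_mono; simpl;
      unfold partials_exist; tauto.
  - intros (H1 & H2 & H3).
    generalize (locally_2d_and _ _ _ _ H1 (locally_2d_and _ _ _ _ H2 H3)).
    apply locally_2d_mono; simpl; unfold partials_exist; tauto.
Qed.

Lemma Cnear_0 f x y : Cnear 0 f x y <-> locally_2d (continuity_2d_pt f) x y.
Proof.
  split; apply locally_2d_mono; simpl; tauto.
Qed.

Lemma Cnear_ext n f h x y :
  locally_2d (fun u v => f u v = h u v) x y -> Cnear n f x y -> Cnear n h x y.
Proof.
  intros H1 H2. apply locally_2d_nested in H1.
  generalize (locally_2d_and _ _ _ _ H1 H2). apply locally_2d_mono.
  intros u v [H3 H4]; exact (ex_diff_n_ext_loc _ _ _ _ _ H3 H4).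
Qed.

Lemma Cnear_nested n f x y : Cnear n f x y -> locally_2d (Cnear n f) x y.
Proof. apply locally_2d_nested. Qed.

Lemma Cnear_le m n f x y : (m <= n)%nat -> Cnear n f x y -> Cnear m f x y.
Proof.
  intros H; apply locally_2d_mono; intros u v; apply ex_diff_n_m, H.
Qed.

Lemma Cnear_pred n f x y : Cnear (S n) f x y -> Cnear n f x y.
Proof. apply Cnear_le; lia. Qed.

Lemma Cnear_continuous n f x y : Cnear n f x y -> locally_2d (continuity_2d_pt f) x y.
Proof. intros H; apply Cnear_0; revert H; apply Cnear_le; lia. Qed.

Lemma Cnear_partials n f x y : Cnear (S n) f x y -> locally_2d (partials_exist f) x y.
Proof. intros H; apply Cnear_S in H; tauto. Qed.

Lemma Rabs_between x u t :
  Rmin x u <= t <= Rmax x u -> Rabs (t - x) <= Rabs (u - x).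
Proof.
  intros H; unfold Rabs; revert H; destruct (Rle_dec x u) as [H|H].
  - rewrite Rmin_left, Rmax_right by lra; intros.
    destruct (Rcase_abs (t - x)), (Rcase_abs (u - x)); lra.
  - rewrite Rmin_right, Rmax_left by lra; intros.
    destruct (Rcase_abs (t - x)), (Rcase_abs (u - x)); lra.
Qed.

(** Along the horizontal segment the increment is the first partial at an
    intermediate point, hence continuity of that one partial suffices; the
    vertical increment only uses the derivative at the base point. *)
Lemma differentiable_of_partials f x y :
  locally_2d (fun u v => ex_derive (fun z => f z v) u) x y ->
  ex_derive (fun z => f x z) y -> continuity_2d_pt (dx f) x y ->
  differentiable_pt_lim f x y (dx f x y) (dy f x y).
Proof.
  intros H1 Hy H2 eps.
  apply Derive_correct, is_derive_Reals in Hy.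
  destruct (H2 (pos_div_2 eps)) as [d2 Hd2].
  destruct (Hy (pos_div_2 eps) (cond_pos (pos_div_2 eps))) as [d3 Hd3].
  destruct H1 as [d1 Hd1]. simpl in *.
  assert (Hd : 0 < Rmin d1 (Rmin d2 d3)).
  { repeat apply Rmin_pos; apply cond_pos. }
  exists (mkposreal _ Hd); simpl; intros u v Hu Hv.
  assert (B1 := Rmin_l d1 (Rmin d2 d3)); assert (B2 := Rmin_r d1 (Rmin d2 d3)).
  assert (B3 := Rmin_l d2 d3); assert (B4 := Rmin_r d2 d3).
  assert (Hx : forall t, Rabs (t - x) < d1 -> is_derive (fun z => f z v) t (dx f t v)).
  { intros t Ht; exact (Derive_correct _ _ (Hd1 t v Ht ltac:(lra))). }
  destruct (MVT_gen (fun z => f z v) x u (fun z => dx f z v)) as (z & Hz & Ez).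
  { intros t Ht; apply Hx.
    assert (B := Rabs_between x u t ltac:(lra)); lra. }
  { intros t Ht; apply derivable_continuous_pt; exists (dx f t v).
    apply is_derive_Reals, Hx.
    assert (B := Rabs_between x u t Ht); lra. }
  assert (Hzx : Rabs (z - x) < d2).
  { assert (B := Rabs_between x u z Hz); lra. }
  assert (C1 : Rabs (dx f z v - dx f x y) < eps / 2) by (apply Hd2; lra).
  assert (C2 : Rabs (f x v - f x y - dy f x y * (v - y)) <= eps / 2 * Rabs (v - y)).
  { destruct (Req_dec v y) as [->|Hne].
    - unfold Rminus; rewrite !Rplus_opp_r, Rmult_0_r, Ropp_0, Rplus_0_r, Rabs_R0; lra.
    - assert (Hv' := Hd3 (v - y) ltac:(lra) ltac:(lra)).
      replace (y + (v - y)) with v in Hv' by ring.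
      replace (f x v - f x y - dy f x y * (v - y))
        with (((f x v - f x y) / (v - y) - dy f x y) * (v - y)) by (field; lra).
      rewrite Rabs_mult; apply Rmult_le_compat_r; [apply Rabs_pos|].
      left; exact Hv'. }
  replace (f u v - f x y - (dx f x y * (u - x) + dy f x y * (v - y)))
    with ((dx f z v - dx f x y) * (u - x) + (f x v - f x y - dy f x y * (v - y)))
    by (rewrite Rmult_minus_distr_r, <- Ez; ring).
  eapply Rle_trans; [apply Rabs_triang|]. rewrite Rabs_mult.
  assert (M1 := Rmax_l (Rabs (u - x)) (Rabs (v - y))).
  assert (M2 := Rmax_r (Rabs (u - x)) (Rabs (v - y))).
  assert (P1 := Rabs_pos (u - x)); assert (P2 := Rabs_pos (v - y)).
  assert (Pe := cond_pos eps).
  apply Rle_trans with (eps / 2 * Rabs (u - x) + eps / 2 * Rabs (v - y)).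
  - apply Rplus_le_compat; [|exact C2]. apply Rmult_le_compat_r; lra.
  - nra.
Qed.

Lemma Cnear_differentiable n f x y :
  Cnear (S n) f x y -> differentiable_pt_lim f x y (dx f x y) (dy f x y).
Proof.
  intros H; apply differentiable_of_partials.
  - generalize (Cnear_partials _ _ _ _ H); apply locally_2d_mono.
    unfold partials_exist; tauto.
  - apply (locally_2d_singleton _ _ _ (Cnear_partials _ _ _ _ H)).
  - apply Cnear_S in H; destruct H as (_ & H & _).
    exact (locally_2d_singleton _ _ _ (Cnear_continuous _ _ _ _ H)).
Qed.

Lemma Cnear_const n c x y : Cnear n (fun _ _ => c) x y.
Proof.
  revert c; induction n as [|n IH]; intros c.
  - apply Cnear_0, locally_2d_forall; intros; apply continuity_2d_pt_const.
  - apply Cnear_S; split; [|split].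
    + apply locally_2d_forall; intros u v; repeat split.
      * apply continuity_2d_pt_const.
      * apply ex_derive_const.
      * apply ex_derive_const.
    + apply Cnear_ext with (2 := IH 0), locally_2d_forall; intros u v.
      symmetry; exact (Derive_const _ _).
    + apply Cnear_ext with (2 := IH 0), locally_2d_forall; intros u v.
      symmetry; exact (Derive_const _ _).
Qed.

Lemma Cnear_fst n x y : Cnear n (fun u _ => u) x y.
Proof.
  destruct n as [|n].
  - apply Cnear_0, locally_2d_forall; intros; apply continuity_2d_pt_id1.
  - apply Cnear_S; split; [|split].
    + apply locally_2d_forall; intros u v; repeat split.
      * apply continuity_2d_pt_id1.
      * apply ex_derive_id.
      * apply ex_derive_const.
    + apply Cnear_ext with (2 := Cnear_const n 1 x y), locally_2d_forall; intros u v.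
      symmetry; exact (Derive_id _).
    + apply Cnear_ext with (2 := Cnear_const n 0 x y), locally_2d_forall; intros u v.
      symmetry; exact (Derive_const _ _).
Qed.

Lemma Cnear_snd n x y : Cnear n (fun _ v => v) x y.
Proof.
  destruct n as [|n].
  - apply Cnear_0, locally_2d_forall; intros; apply continuity_2d_pt_id2.
  - apply Cnear_S; split; [|split].
    + apply locally_2d_forall; intros u v; repeat split.
      * apply continuity_2d_pt_id2.
      * apply ex_derive_const.
      * apply ex_derive_id.
    + apply Cnear_ext with (2 := Cnear_const n 0 x y), locally_2d_forall; intros u v.
      symmetry; exact (Derive_const _ _).
    + apply Cnear_ext with (2 := Cnear_const n 1 x y), locally_2d_forall; intros u v.
      symmetry; exact (Derive_id _).
Qed.

Lemma Cnear_plus n f h x y :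
  Cnear n f x y -> Cnear n h x y -> Cnear n (fun u v => f u v + h u v) x y.
Proof.
  revert f h; induction n as [|n IH]; intros f h Hf Hh.
  - apply Cnear_0 in Hf; apply Cnear_0 in Hh; apply Cnear_0.
    generalize (locally_2d_and _ _ _ _ Hf Hh); apply locally_2d_mono.
    intros u v [H1 H2]; apply continuity_2d_pt_plus; assumption.
  - apply Cnear_S in Hf; apply Cnear_S in Hh; apply Cnear_S.
    destruct Hf as (F0 & F1 & F2), Hh as (H0 & H1 & H2).
    assert (E := locally_2d_and _ _ _ _ F0 H0).
    split; [|split].
    + revert E; apply locally_2d_mono.
      intros u v [(A & B & C) (A' & B' & C')]; repeat split.
      * apply continuity_2d_pt_plus; assumption.
      * apply (@ex_derive_plus R_AbsRing R_NormedModule); assumption.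
      * apply (@ex_derive_plus R_AbsRing R_NormedModule); assumption.
    + apply Cnear_ext with (2 := IH _ _ F1 H1); revert E; apply locally_2d_mono.
      intros u v [(A & B & C) (A' & B' & C')].
      symmetry; apply (Derive_plus (fun z => f z v) (fun z => h z v)); assumption.
    + apply Cnear_ext with (2 := IH _ _ F2 H2); revert E; apply locally_2d_mono.
      intros u v [(A & B & C) (A' & B' & C')].
      symmetry; apply (Derive_plus (fun z => f u z) (fun z => h u z)); assumption.
Qed.

Lemma Cnear_mult n f h x y :
  Cnear n f x y -> Cnear n h x y -> Cnear n (fun u v => f u v * h u v) x y.
Proof.
  revert f h; induction n as [|n IH]; intros f h Hf Hh.
  - apply Cnear_0 in Hf; apply Cnear_0 in Hh; apply Cnear_0.
    generalize (locally_2d_and _ _ _ _ Hf Hh); apply locally_2d_mono.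
    intros u v [H1 H2]; apply continuity_2d_pt_mult; assumption.
  - assert (Gf := Cnear_pred _ _ _ _ Hf); assert (Gh := Cnear_pred _ _ _ _ Hh).
    apply Cnear_S in Hf; apply Cnear_S in Hh; apply Cnear_S.
    destruct Hf as (F0 & F1 & F2), Hh as (H0 & H1 & H2).
    assert (E := locally_2d_and _ _ _ _ F0 H0).
    split; [|split].
    + revert E; apply locally_2d_mono.
      intros u v [(A & B & C) (A' & B' & C')]; repeat split.
      * apply continuity_2d_pt_mult; assumption.
      * apply ex_derive_mult; assumption.
      * apply ex_derive_mult; assumption.
    + apply Cnear_ext
        with (2 := Cnear_plus _ _ _ _ _ (IH _ _ F1 Gh) (IH _ _ Gf H1)).
      revert E; apply locally_2d_mono.
      intros u v [(A & B & C) (A' & B' & C')].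
      symmetry; apply (Derive_mult (fun z => f z v) (fun z => h z v)); assumption.
    + apply Cnear_ext
        with (2 := Cnear_plus _ _ _ _ _ (IH _ _ F2 Gh) (IH _ _ Gf H2)).
      revert E; apply locally_2d_mono.
      intros u v [(A & B & C) (A' & B' & C')].
      symmetry; apply (Derive_mult (fun z => f u z) (fun z => h u z)); assumption.
Qed.

Lemma continuity_2d_pt_comp f a b x y :
  continuity_2d_pt f (a x y) (b x y) ->
  continuity_2d_pt a x y -> continuity_2d_pt b x y ->
  continuity_2d_pt (fun u v => f (a u v) (b u v)) x y.
Proof.
  intros Hf Ha Hb eps. destruct (Hf eps) as [d Hd].
  generalize (locally_2d_and _ _ _ _ (Ha d) (Hb d)); apply locally_2d_mono.
  intros u v [H1 H2]; apply Hd; assumption.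
Qed.

Lemma locally_2d_comp (P : R -> R -> Prop) a b x y :
  continuity_2d_pt a x y -> continuity_2d_pt b x y ->
  locally_2d P (a x y) (b x y) ->
  locally_2d (fun u v => P (a u v) (b u v)) x y.
Proof.
  intros Ha Hb [d Hd].
  generalize (locally_2d_and _ _ _ _ (Ha d) (Hb d)); apply locally_2d_mono.
  intros u v [H1 H2]; apply Hd; assumption.
Qed.

Lemma is_derive_comp_2d f (a b : R -> R) t lx ly la lb :
  differentiable_pt_lim f (a t) (b t) lx ly ->
  is_derive a t la -> is_derive b t lb ->
  is_derive (fun z => f (a z) (b z)) t (lx * la + ly * lb).
Proof.
  intros Hf Ha Hb. apply is_derive_Reals in Ha; apply is_derive_Reals in Hb.
  apply is_derive_Reals, derivable_pt_lim_comp_2d; assumption.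
Qed.

(** The chain rule turns the partial derivatives of a composite into products of
    composites, so that induction on the order of differentiability applies. *)
Lemma Cnear_comp n f a b x y :
  Cnear n f (a x y) (b x y) -> Cnear n a x y -> Cnear n b x y ->
  Cnear n (fun u v => f (a u v) (b u v)) x y.
Proof.
  revert f; induction n as [|n IH]; intros f Hf Ha Hb.
  - apply Cnear_0 in Hf; apply Cnear_0 in Ha; apply Cnear_0 in Hb; apply Cnear_0.
    apply (locally_2d_comp _ a b) in Hf;
      [|exact (locally_2d_singleton _ _ _ Ha)|exact (locally_2d_singleton _ _ _ Hb)].
    generalize (locally_2d_and _ _ _ _ Hf (locally_2d_and _ _ _ _ Ha Hb)).
    apply locally_2d_mono; intros u v (A & B & C).
    apply continuity_2d_pt_comp; assumption.
  - assert (Ga := Cnear_pred _ _ _ _ Ha); assert (Gb := Cnear_pred _ _ _ _ Hb).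
    assert (Na := locally_2d_singleton _ _ _ (Cnear_continuous _ _ _ _ Ha)).
    assert (Nb := locally_2d_singleton _ _ _ (Cnear_continuous _ _ _ _ Hb)).
    assert (Hf' := Hf); apply Cnear_nested in Hf'.
    apply (locally_2d_comp _ a b) in Hf'; [|assumption|assumption].
    assert (Pa := Cnear_partials _ _ _ _ Ha); assert (Pb := Cnear_partials _ _ _ _ Hb).
    assert (E := locally_2d_and _ _ _ _ Hf' (locally_2d_and _ _ _ _ Pa Pb)).
    apply Cnear_S in Hf; apply Cnear_S in Ha; apply Cnear_S in Hb; apply Cnear_S.
    destruct Hf as (F0 & F1 & F2), Ha as (A0 & A1 & A2), Hb as (B0 & B1 & B2).
    assert (IH1 := IH _ F1 Ga Gb); assert (IH2 := IH _ F2 Ga Gb).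
    assert (X : locally_2d (fun u v =>
        is_derive (fun z => f (a z v) (b z v)) u
          (dx f (a u v) (b u v) * dx a u v + dy f (a u v) (b u v) * dx b u v) /\
        is_derive (fun z => f (a u z) (b u z)) v
          (dx f (a u v) (b u v) * dy a u v + dy f (a u v) (b u v) * dy b u v) /\
        continuity_2d_pt (fun u v => f (a u v) (b u v)) u v) x y).
    { revert E; apply locally_2d_mono.
      intros u v (D & (Ac & Ax & Ay) & (Bc & Bx & By)); split; [|split].
      - apply (is_derive_comp_2d f (fun z => a z v) (fun z => b z v)).
        + exact (Cnear_differentiable _ _ _ _ D).
        + exact (Derive_correct _ _ Ax).
        + exact (Derive_correct _ _ Bx).
      - apply (is_derive_comp_2d f (fun z => a u z) (fun z => b u z)).
        + exact (Cnear_differentiable _ _ _ _ D).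
        + exact (Derive_correct _ _ Ay).
        + exact (Derive_correct _ _ By).
      - apply continuity_2d_pt_comp; try assumption.
        exact (locally_2d_singleton _ _ _ (Cnear_continuous _ _ _ _ D)). }
    split; [|split].
    + revert X; apply locally_2d_mono; intros u v (D1 & D2 & D3); repeat split.
      * exact D3.
      * eexists; exact D1.
      * eexists; exact D2.
    + eapply Cnear_ext; [|exact (Cnear_plus _ _ _ _ _ (Cnear_mult _ _ _ _ _ IH1 A1)
                                (Cnear_mult _ _ _ _ _ IH2 B1))].
      revert X; apply locally_2d_mono; intros u v (D1 & D2 & D3).
      symmetry; exact (is_derive_unique _ _ _ D1).
    + eapply Cnear_ext; [|exact (Cnear_plus _ _ _ _ _ (Cnear_mult _ _ _ _ _ IH1 A2)
                                (Cnear_mult _ _ _ _ _ IH2 B2))].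
      revert X; apply locally_2d_mono; intros u v (D1 & D2 & D3).
      symmetry; exact (is_derive_unique _ _ _ D2).
Qed.

Lemma Cnear_S_1d n (h h' : R -> R) x y :
  locally x (fun t => is_derive h t (h' t)) ->
  Cnear n (fun u _ => h' u) x y -> Cnear (S n) (fun u _ => h u) x y.
Proof.
  intros H1 H2.
  assert (E : locally_2d (fun u v => is_derive h u (h' u)) x y).
  { destruct H1 as [d Hd]; exists d; intros u v Hu _; apply Hd, Hu. }
  apply Cnear_S; split; [|split].
  - revert E; apply locally_2d_mono; intros u v E; repeat split.
    + apply (continuity_1d_2d_pt_comp h (fun u _ => u)); [|apply continuity_2d_pt_id1].
      apply derivable_continuous_pt; exists (h' u); apply is_derive_Reals, E.
    + exists (h' u); exact E.
    + apply ex_derive_const.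
  - apply Cnear_ext with (2 := H2); revert E; apply locally_2d_mono; intros u v E.
    symmetry; exact (is_derive_unique _ _ _ E).
  - apply Cnear_ext with (2 := Cnear_const n 0 x y), locally_2d_forall; intros u v.
    symmetry; exact (Derive_const _ _).
Qed.

(** Functions of one variable are regarded as functions of the first of two
    coordinates, so that [Cnear_comp] applies to them.  The last hypothesis lets
    the derivative be built from the function itself, as for the inverse and the
    exponential. *)
Lemma Cnear_of_1d (P : R -> Prop) (h h' : R -> R) :
  (forall t, P t -> locally t P) -> (forall t, P t -> is_derive h t (h' t)) ->
  (forall n t y, P t -> Cnear n (fun u _ => h u) t y -> Cnear n (fun u _ => h' u) t y) ->
  forall n t y, P t -> Cnear n (fun u _ => h u) t y.
Proof.
  intros HP Hd Hn; induction n as [|n IH]; intros t y Ht.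
  - apply Cnear_0. destruct (HP t Ht) as [d Hd']; exists d; intros u v Hu _.
    apply (continuity_1d_2d_pt_comp h (fun u _ => u)); [|apply continuity_2d_pt_id1].
    apply derivable_continuous_pt; exists (h' u); apply is_derive_Reals, Hd, Hd', Hu.
  - apply Cnear_S_1d with h'.
    + destruct (HP t Ht) as [d Hd']; exists d; intros u Hu; apply Hd, Hd', Hu.
    + apply Hn; [exact Ht|apply IH, Ht].
Qed.

Lemma Cnear_comp_1d n (h : R -> R) f x y :
  (forall t, Cnear n (fun u _ => h u) (f x y) t) -> Cnear n f x y ->
  Cnear n (fun u v => h (f u v)) x y.
Proof.
  intros Hh Hf; exact (Cnear_comp n (fun u _ => h u) f f x y (Hh (f x y)) Hf Hf).
Qed.

Lemma Cnear_inv n f x y :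
  f x y <> 0 -> Cnear n f x y -> Cnear n (fun u v => / f u v) x y.
Proof.
  intros Hne; apply Cnear_comp_1d; intros y'.
  apply (Cnear_of_1d (fun t => t <> 0) Rinv (fun t => -1 * (/ t * / t))); [| | |exact Hne].
  - intros t Ht; apply (open_neq 0 t Ht).
  - intros t Ht; auto_derive; [exact Ht|field; exact Ht].
  - intros m t y0 _ H.
    exact (Cnear_mult _ _ _ _ _ (Cnear_const m (-1) t y0) (Cnear_mult _ _ _ _ _ H H)).
Qed.

Lemma Cnear_exp n f x y : Cnear n f x y -> Cnear n (fun u v => exp (f u v)) x y.
Proof.
  apply Cnear_comp_1d; intros y'.
  apply (Cnear_of_1d (fun _ => True) exp exp); auto.
  - intros t _; apply filter_forall; auto.
  - intros t _; auto_derive; [exact I|ring].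
Qed.

Lemma Cnear_ln n f x y :
  0 < f x y -> Cnear n f x y -> Cnear n (fun u v => ln (f u v)) x y.
Proof.
  intros Hp; apply Cnear_comp_1d; intros y'.
  apply (Cnear_of_1d (fun t => 0 < t) ln Rinv); [| | |exact Hp].
  - intros t Ht; apply (open_gt 0 t Ht).
  - intros t Ht; auto_derive; [exact Ht|field; lra].
  - intros m t y0 Ht _; apply (Cnear_inv m (fun u _ => u)); [lra|apply Cnear_fst].
Qed.

Lemma Cnear_sqrt n f x y :
  0 < f x y -> Cnear n f x y -> Cnear n (fun u v => sqrt (f u v)) x y.
Proof.
  intros Hp Hf.
  assert (E : locally_2d (fun u v => exp (/ 2 * ln (f u v)) = sqrt (f u v)) x y).
  { assert (C := locally_2d_singleton _ _ _ (Cnear_continuous _ _ _ _ Hf)).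
    destruct (C (mkposreal _ Hp)) as [d Hd]; exists d; intros u v Hu Hv.
    assert (B := Rabs_def2 _ _ (Hd u v Hu Hv)); simpl in B.
    fold (Rpower (f u v) (/ 2)); apply Rpower_sqrt; lra. }
  apply Cnear_ext with (1 := E), Cnear_exp, Cnear_mult.
  - apply Cnear_const.
  - apply Cnear_ln; assumption.
Qed.

(** The neighbourhood is common to all orders: such a germ is again smooth at
    all nearby points, which a neighbourhood for each order would not give. *)
Definition sm (f : R -> R -> R) (x y : R) : Prop :=
  locally_2d (fun u v => forall n, ex_diff_n f n u v) x y.

Lemma sm_Cnear f x y : sm f x y <-> locally_2d (fun u v => forall n, Cnear n f u v) x y.
Proof.
  split.
  - intros H; apply locally_2d_nested in H; revert H; apply locally_2d_mono.
    intros u v H n; revert H; apply locally_2d_mono; auto.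
  - apply locally_2d_mono; intros u v H n; exact (locally_2d_singleton _ _ _ (H n)).
Qed.

Lemma sm_nested f x y : sm f x y -> locally_2d (sm f) x y.
Proof. apply locally_2d_nested. Qed.

Lemma sm_at f x y : sm f x y -> forall n, Cnear n f x y.
Proof. intros H; apply sm_Cnear in H; exact (locally_2d_singleton _ _ _ H). Qed.

Lemma sm_ext f h x y : locally_2d (fun u v => f u v = h u v) x y -> sm f x y -> sm h x y.
Proof.
  intros H1 H2; apply locally_2d_nested in H1; apply sm_Cnear in H2; apply sm_Cnear.
  generalize (locally_2d_and _ _ _ _ H1 H2); apply locally_2d_mono.
  intros u v [A B] n; exact (Cnear_ext _ _ _ _ _ A (B n)).
Qed.

Lemma sm_lift1 f k x y :
  (forall n u v, Cnear n f u v -> Cnear n k u v) -> sm f x y -> sm k x y.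
Proof.
  intros H H1; apply sm_Cnear in H1; apply sm_Cnear; revert H1; apply locally_2d_mono; auto.
Qed.

Lemma sm_lift2 f h k x y :
  (forall n u v, Cnear n f u v -> Cnear n h u v -> Cnear n k u v) ->
  sm f x y -> sm h x y -> sm k x y.
Proof.
  intros H H1 H2; apply sm_Cnear in H1; apply sm_Cnear in H2; apply sm_Cnear.
  generalize (locally_2d_and _ _ _ _ H1 H2); apply locally_2d_mono.
  intros u v [A B] n; auto.
Qed.

Lemma sm_continuous f x y : sm f x y -> continuity_2d_pt f x y.
Proof. intros H; exact (proj1 (locally_2d_singleton _ _ _ (sm_at _ _ _ H 0%nat))). Qed.

Lemma sm_where (P : R -> Prop) f k x y :
  (forall t, P t -> locally t P) ->
  (forall n u v, P (f u v) -> Cnear n f u v -> Cnear n k u v) ->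
  P (f x y) -> sm f x y -> sm k x y.
Proof.
  intros HP Hk Hp Hf.
  assert (C : locally_2d (fun u v => P (f u v)) x y).
  { destruct (HP _ Hp) as [d Hd]; generalize (sm_continuous _ _ _ Hf d).
    apply locally_2d_mono; intros u v; apply Hd. }
  apply sm_Cnear in Hf; apply sm_Cnear.
  generalize (locally_2d_and _ _ _ _ C Hf); apply locally_2d_mono.
  intros u v [A B] n; auto.
Qed.

Lemma sm_const c x y : sm (fun _ _ => c) x y.
Proof. apply sm_Cnear, locally_2d_forall; intros; apply Cnear_const. Qed.

Lemma sm_fst x y : sm (fun u _ => u) x y.
Proof. apply sm_Cnear, locally_2d_forall; intros; apply Cnear_fst. Qed.

Lemma sm_snd x y : sm (fun _ v => v) x y.
Proof. apply sm_Cnear, locally_2d_forall; intros; apply Cnear_snd. Qed.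

Lemma sm_plus f h x y : sm f x y -> sm h x y -> sm (fun u v => f u v + h u v) x y.
Proof. apply sm_lift2; intros; apply Cnear_plus; assumption. Qed.

Lemma sm_mult f h x y : sm f x y -> sm h x y -> sm (fun u v => f u v * h u v) x y.
Proof. apply sm_lift2; intros; apply Cnear_mult; assumption. Qed.

Lemma sm_inv f x y : f x y <> 0 -> sm f x y -> sm (fun u v => / f u v) x y.
Proof.
  apply (sm_where (fun t => t <> 0) f); [intros t Ht; apply (open_neq 0 t Ht)|].
  intros; apply Cnear_inv; assumption.
Qed.

Lemma sm_exp f x y : sm f x y -> sm (fun u v => exp (f u v)) x y.
Proof. apply sm_lift1; intros; apply Cnear_exp; assumption. Qed.

Lemma sm_ln f x y : 0 < f x y -> sm f x y -> sm (fun u v => ln (f u v)) x y.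
Proof.
  apply (sm_where (fun t => 0 < t) f); [intros t Ht; apply (open_gt 0 t Ht)|].
  intros; apply Cnear_ln; assumption.
Qed.

Lemma sm_sqrt f x y : 0 < f x y -> sm f x y -> sm (fun u v => sqrt (f u v)) x y.
Proof.
  apply (sm_where (fun t => 0 < t) f); [intros t Ht; apply (open_gt 0 t Ht)|].
  intros; apply Cnear_sqrt; assumption.
Qed.

Lemma sm_comp f a b x y :
  sm f (a x y) (b x y) -> sm a x y -> sm b x y -> sm (fun u v => f (a u v) (b u v)) x y.
Proof.
  intros Hf Ha Hb; apply sm_Cnear in Hf.
  apply (locally_2d_comp _ a b) in Hf; [|exact (sm_continuous _ _ _ Ha)|exact (sm_continuous _ _ _ Hb)].
  apply sm_Cnear in Ha; apply sm_Cnear in Hb; apply sm_Cnear.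
  generalize (locally_2d_and _ _ _ _ Hf (locally_2d_and _ _ _ _ Ha Hb)).
  apply locally_2d_mono; intros u v (A & B & C) n; apply Cnear_comp; auto.
Qed.

Lemma sm_dx f x y : sm f x y -> sm (dx f) x y.
Proof.
  apply locally_2d_mono; intros u v H n; exact (ex_diff_n_deriv_aux1 _ _ _ _ (H (S n))).
Qed.

Lemma sm_dy f x y : sm f x y -> sm (dy f) x y.
Proof.
  apply locally_2d_mono; intros u v H n; exact (ex_diff_n_deriv_aux2 _ _ _ _ (H (S n))).
Qed.

Lemma sm_partials f x y : sm f x y -> partials_exist f x y.
Proof.
  intros H; destruct (locally_2d_singleton _ _ _ H 1%nat) as (A & B & C & _).
  repeat split; assumption.
Qed.

Lemma sm_differentiable f x y :
  sm f x y -> differentiable_pt_lim f x y (dx f x y) (dy f x y).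
Proof. intros H; exact (Cnear_differentiable 0 _ _ _ (sm_at _ _ _ H 1%nat)). Qed.

Lemma sm_Schwarz f x y : sm f x y -> dx (dy f) x y = dy (dx f) x y.
Proof.
  intros H; apply (Schwarz f x y).
  - apply sm_nested in H; revert H; apply locally_2d_mono; intros u v H.
    destruct (sm_partials _ _ _ H) as (_ & A & B).
    destruct (sm_partials _ _ _ (sm_dx _ _ _ H)) as (_ & _ & C).
    destruct (sm_partials _ _ _ (sm_dy _ _ _ H)) as (_ & D & _).
    repeat split; assumption.
  - exact (sm_continuous _ _ _ (sm_dx _ _ _ (sm_dy _ _ _ H))).
  - exact (sm_continuous _ _ _ (sm_dy _ _ _ (sm_dx _ _ _ H))).
Qed.

(** For functions that are only known through their derivatives, such as
    primitives. *)
Lemma sm_of_partials (f a b : R -> R -> R) (x y : R) :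
  locally_2d (fun u v => is_derive (fun z => f z v) u (a u v) /\ is_derive (fun z => f u z) v (b u v) /\
                         continuity_2d_pt f u v) x y ->
  sm a x y -> sm b x y -> sm f x y.
Proof.
  intros E Ha Hb; apply locally_2d_nested in E.
  apply sm_Cnear in Ha; apply sm_Cnear in Hb; apply sm_Cnear.
  generalize (locally_2d_and _ _ _ _ E (locally_2d_and _ _ _ _ Ha Hb)).
  apply locally_2d_mono; intros u v (A & B & C) n.
  apply Cnear_pred, Cnear_S; split; [|split].
  - revert A; apply locally_2d_mono; intros u' v' (A1 & A2 & A3); repeat split.
    + exact A3.
    + eexists; exact A1.
    + eexists; exact A2.
  - apply Cnear_ext with (2 := B n); revert A; apply locally_2d_mono.
    intros u' v' (A1 & _ & _); symmetry; exact (is_derive_unique _ _ _ A1).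
  - apply Cnear_ext with (2 := C n); revert A; apply locally_2d_mono.
    intros u' v' (_ & A2 & _); symmetry; exact (is_derive_unique _ _ _ A2).
Qed.

Lemma smooth_on_sm D f : open2 D -> smooth_on D f -> forall x y, D x y -> sm f x y.
Proof.
  intros HD Hf x y Hxy; generalize (HD x y Hxy); apply locally_2d_mono.
  intros u v H n; apply Hf, H.
Qed.

Lemma smooth_on_of_sm (D : R -> R -> Prop) f :
  (forall x y, D x y -> sm f x y) -> smooth_on D f.
Proof. intros H n x y Hxy; exact (locally_2d_singleton _ _ _ (H x y Hxy) n). Qed.


(** * Calculus on a surface, independently of charts *)

Section Calculus.
Context {S : surface}.
Implicit Types (c d : chart S) (f h : S -> R) (p q : S) (P Q : S -> Prop) (i j k : axis).

Definition pull c f (x y : R) : R := f (cinv c x y).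

Lemma cimg_coord c p : dom c p -> cimg c (coord c e1 p) (coord c e2 p).
Proof. intros H; exists p; auto. Qed.

Lemma cinv_dom c x y : cimg c x y ->
  dom c (cinv c x y) /\ coord c e1 (cinv c x y) = x /\ coord c e2 (cinv c x y) = y.
Proof.
  intros (p & Hp & <- & <-); rewrite (cinvK Hp); auto.
Qed.

Lemma cimg_near c p : dom c p -> locally_2d (cimg c) (coord c e1 p) (coord c e2 p).
Proof. intros H; exact (cimg_open (c := c) (cimg_coord c p H)). Qed.

(** Transition functions are handled as germs at the coordinates of a point. *)
Lemma transition c d p : atlas c -> atlas d -> dom c p -> dom d p ->
  locally_2d (overlap d c) (coord d e1 p) (coord d e2 p) /\
  forall k, sm (pull d (coord c k)) (coord d e1 p) (coord d e2 p).
Proof.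
  intros Ac Ad Hc Hd; destruct (atlas_compatible Ad Ac) as [HO HS].
  assert (V : overlap d c (coord d e1 p) (coord d e2 p)).
  { split; [exact (cimg_coord d p Hd)|rewrite (cinvK Hd); exact Hc]. }
  split; [exact (HO _ _ V)|intros k].
  exact (smooth_on_sm _ _ HO (HS k) _ _ V).
Qed.

(** All charts are quantified over, which makes the notion local and free of
    coordinates; by [near_intro] one chart suffices, since transition functions are
    continuous. *)
Definition near p P : Prop := forall c, atlas c -> dom c p ->
  locally_2d (fun x y => cimg c x y /\ P (cinv c x y)) (coord c e1 p) (coord c e2 p).

Lemma near_intro c p P : atlas c -> dom c p ->
  locally_2d (fun x y => cimg c x y -> P (cinv c x y)) (coord c e1 p) (coord c e2 p) ->
  near p P.
Proof.
  intros Ac Hc H d Ad Hd; destruct (transition c d p Ac Ad Hc Hd) as [V HS].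
  assert (H' : locally_2d (fun x y =>
    cimg c (pull d (coord c e1) x y) (pull d (coord c e2) x y) ->
    P (cinv c (pull d (coord c e1) x y) (pull d (coord c e2) x y)))
      (coord d e1 p) (coord d e2 p)).
  { apply (locally_2d_comp (fun x y => cimg c x y -> P (cinv c x y)));
      try apply sm_continuous, HS.
    unfold pull; rewrite (cinvK Hd); exact H. }
  generalize (locally_2d_and _ _ _ _ H' V); apply locally_2d_mono.
  unfold pull, overlap; intros x y (A & B & C); split; [exact B|].
  rewrite <- (cinvK C); apply A, cimg_coord, C.
Qed.

Lemma near_in c p P : atlas c -> dom c p -> near p P ->
  locally_2d (fun x y => P (cinv c x y)) (coord c e1 p) (coord c e2 p).
Proof. intros Ac Hc H; generalize (H c Ac Hc); apply locally_2d_mono; tauto. Qed.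

Lemma near_here p P : near p P -> P p.
Proof.
  intros H; assert (A := chart_at_atlas p); assert (D := chart_at_dom p).
  generalize (locally_2d_singleton _ _ _ (near_in _ _ _ A D H)); rewrite (cinvK D); auto.
Qed.

Lemma near_mono p P Q : (forall q, P q -> Q q) -> near p P -> near p Q.
Proof.
  intros HPQ H c Ac Hc; generalize (H c Ac Hc); apply locally_2d_mono; intuition.
Qed.

Lemma near_all p P : (forall q, P q) -> near p P.
Proof.
  intros H; apply (near_intro (chart_at p)).
  - apply chart_at_atlas.
  - apply chart_at_dom.
  - apply locally_2d_forall; auto.
Qed.

Lemma near_and p P Q : near p P -> near p Q -> near p (fun q => P q /\ Q q).
Proof.
  intros HP HQ c Ac Hc; generalize (locally_2d_and _ _ _ _ (HP c Ac Hc) (HQ c Ac Hc)).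
  apply locally_2d_mono; intuition.
Qed.

Lemma near_nested p P : near p P -> near p (fun q => near q P).
Proof.
  intros H; assert (A := chart_at_atlas p); assert (D := chart_at_dom p).
  apply (near_intro (chart_at p) p _ A D).
  generalize (locally_2d_nested _ _ _ (H _ A D)); apply locally_2d_mono; intros x y H' Hxy.
  destruct (cinv_dom _ _ _ Hxy) as (B & E1 & E2).
  apply (near_intro (chart_at p) _ _ A B); rewrite E1, E2.
  revert H'; apply locally_2d_mono; tauto.
Qed.

Lemma near_dom c p : atlas c -> dom c p -> near p (dom c).
Proof.
  intros Ac Hc; apply (near_intro c p _ Ac Hc), locally_2d_forall.
  intros x y Hxy; exact (proj1 (cinv_dom _ _ _ Hxy)).
Qed.

(** One chart suffices here as well, by [smooth_intro]. *)
Definition smooth p f : Prop := forall c, atlas c -> dom c p ->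
  sm (pull c f) (coord c e1 p) (coord c e2 p).

Lemma smooth_intro c p f : atlas c -> dom c p ->
  sm (pull c f) (coord c e1 p) (coord c e2 p) -> smooth p f.
Proof.
  intros Ac Hc H d Ad Hd; destruct (transition c d p Ac Ad Hc Hd) as [V HS].
  apply sm_ext with (fun x y => pull c f (pull d (coord c e1) x y) (pull d (coord c e2) x y)).
  - revert V; apply locally_2d_mono; unfold pull, overlap; intros x y (A & B).
    rewrite (cinvK B); reflexivity.
  - apply (sm_comp (pull c f)); try apply HS.
    unfold pull at 2 3; rewrite (cinvK Hd); exact H.
Qed.

Lemma smooth_of_smooth_in c f p : atlas c -> dom c p -> smooth_in c f -> smooth p f.
Proof.
  intros Ac Hc H; apply (smooth_intro c p f Ac Hc).
  exact (smooth_on_sm _ _ (cimg_open (c := c)) H _ _ (cimg_coord c p Hc)).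
Qed.

Lemma smooth_ext p f h : near p (fun q => f q = h q) -> smooth p f -> smooth p h.
Proof.
  intros E H c Ac Hc; apply sm_ext with (pull c f); [|exact (H c Ac Hc)].
  exact (near_in _ _ _ Ac Hc E).
Qed.

Lemma smooth_nested p f : smooth p f -> near p (fun q => smooth q f).
Proof.
  intros H; assert (A := chart_at_atlas p); assert (D := chart_at_dom p).
  apply (near_intro (chart_at p) p _ A D).
  generalize (sm_nested _ _ _ (H _ A D)); apply locally_2d_mono; intros x y H' Hxy.
  destruct (cinv_dom _ _ _ Hxy) as (B & E1 & E2).
  apply (smooth_intro (chart_at p) _ _ A B); rewrite E1, E2; exact H'.
Qed.

Lemma smooth_const p r : smooth p (fun _ => r).
Proof. intros c _ _; exact (sm_const r _ _). Qed.

Lemma smooth_coord c k p : atlas c -> dom c p -> smooth p (coord c k).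
Proof. intros Ac Hc d Ad Hd; exact (proj2 (transition c d p Ac Ad Hc Hd) k). Qed.

Lemma smooth_plus p f h : smooth p f -> smooth p h -> smooth p (fun q => f q + h q).
Proof. intros H1 H2 c Ac Hc; exact (sm_plus _ _ _ _ (H1 c Ac Hc) (H2 c Ac Hc)). Qed.

Lemma smooth_mult p f h : smooth p f -> smooth p h -> smooth p (fun q => f q * h q).
Proof. intros H1 H2 c Ac Hc; exact (sm_mult _ _ _ _ (H1 c Ac Hc) (H2 c Ac Hc)). Qed.

Lemma smooth_opp p f : smooth p f -> smooth p (fun q => - f q).
Proof.
  intros H; apply (smooth_ext p (fun q => -1 * f q)).
  - apply near_all; intros q; ring.
  - apply smooth_mult; [apply smooth_const|exact H].
Qed.

Lemma smooth_minus p f h : smooth p f -> smooth p h -> smooth p (fun q => f q - h q).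
Proof. intros H1 H2; apply (smooth_plus p f (fun q => - h q) H1), smooth_opp, H2. Qed.

Lemma smooth_inv p f : f p <> 0 -> smooth p f -> smooth p (fun q => / f q).
Proof.
  intros Hp H c Ac Hc; apply (sm_inv (pull c f)); [|exact (H c Ac Hc)].
  unfold pull; rewrite (cinvK Hc); exact Hp.
Qed.

Lemma smooth_div p f h : h p <> 0 -> smooth p f -> smooth p h -> smooth p (fun q => f q / h q).
Proof. intros Hp H1 H2; apply (smooth_mult p f (fun q => / h q) H1), smooth_inv; assumption. Qed.

Lemma smooth_exp p f : smooth p f -> smooth p (fun q => exp (f q)).
Proof. intros H c Ac Hc; exact (sm_exp _ _ _ (H c Ac Hc)). Qed.

Lemma smooth_ln p f : 0 < f p -> smooth p f -> smooth p (fun q => ln (f q)).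
Proof.
  intros Hp H c Ac Hc; apply (sm_ln (pull c f)); [|exact (H c Ac Hc)].
  unfold pull; rewrite (cinvK Hc); exact Hp.
Qed.

Lemma smooth_sqrt p f : 0 < f p -> smooth p f -> smooth p (fun q => sqrt (f q)).
Proof.
  intros Hp H c Ac Hc; apply (sm_sqrt (pull c f)); [|exact (H c Ac Hc)].
  unfold pull; rewrite (cinvK Hc); exact Hp.
Qed.

Lemma smooth_sum2 p (F : axis -> S -> R) :
  (forall k, smooth p (F k)) -> smooth p (fun q => sum2 (fun k => F k q)).
Proof. intros H; exact (smooth_plus p (F e1) (F e2) (H e1) (H e2)). Qed.

Definition partial i : (R -> R -> R) -> R -> R -> R :=
  match i with e1 => dx | e2 => dy end.

Lemma pdE c i f p : pd c i f p = partial i (pull c f) (coord c e1 p) (coord c e2 p).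
Proof. destruct i; reflexivity. Qed.

Lemma pull_pd c i f x y : cimg c x y -> pull c (pd c i f) x y = partial i (pull c f) x y.
Proof.
  intros H; destruct (cinv_dom _ _ _ H) as (_ & E1 & E2).
  unfold pull at 1; rewrite pdE, E1, E2; reflexivity.
Qed.

Lemma smooth_pd c i f p : atlas c -> dom c p -> smooth p f -> smooth p (pd c i f).
Proof.
  intros Ac Hc H; apply (smooth_intro c p _ Ac Hc).
  apply sm_ext with (partial i (pull c f)).
  - generalize (cimg_near c p Hc); apply locally_2d_mono; intros x y Hxy.
    symmetry; apply pull_pd, Hxy.
  - destruct i; [apply sm_dx|apply sm_dy]; exact (H c Ac Hc).
Qed.

Lemma pd_ext c i f h p : atlas c -> dom c p ->
  near p (fun q => f q = h q) -> pd c i f p = pd c i h p.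
Proof.
  intros Ac Hc E; apply (near_in c p _ Ac Hc) in E; destruct i; simpl.
  - apply Derive_ext_loc.
    exact (locally_2d_1d_const_y (fun x y => f (cinv c x y) = h (cinv c x y)) _ _ E).
  - apply Derive_ext_loc.
    exact (locally_2d_1d_const_x (fun x y => f (cinv c x y) = h (cinv c x y)) _ _ E).
Qed.

Lemma pd_is_derive c f p : atlas c -> dom c p -> smooth p f ->
  is_derive (fun t => f (cinv c t (coord c e2 p))) (coord c e1 p) (pd c e1 f p) /\
  is_derive (fun t => f (cinv c (coord c e1 p) t)) (coord c e2 p) (pd c e2 f p).
Proof.
  intros Ac Hc H; destruct (sm_partials _ _ _ (H c Ac Hc)) as (_ & E1 & E2).
  split; [exact (Derive_correct _ _ E1)|exact (Derive_correct _ _ E2)].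
Qed.

Lemma pd_const c i r p : pd c i (fun _ => r) p = 0.
Proof. destruct i; exact (Derive_const _ _). Qed.

Lemma pd_plus c i f h p : atlas c -> dom c p -> smooth p f -> smooth p h ->
  pd c i (fun q => f q + h q) p = pd c i f p + pd c i h p.
Proof.
  intros Ac Hc Hf Hh; destruct (sm_partials _ _ _ (Hf c Ac Hc)) as (_ & F1 & F2).
  destruct (sm_partials _ _ _ (Hh c Ac Hc)) as (_ & G1 & G2).
  destruct i; simpl; unfold pull in *.
  - exact (Derive_plus _ _ _ F1 G1).
  - exact (Derive_plus _ _ _ F2 G2).
Qed.

Lemma pd_mult c i f h p : atlas c -> dom c p -> smooth p f -> smooth p h ->
  pd c i (fun q => f q * h q) p = pd c i f p * h p + f p * pd c i h p.
Proof.
  intros Ac Hc Hf Hh; destruct (sm_partials _ _ _ (Hf c Ac Hc)) as (_ & F1 & F2).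
  destruct (sm_partials _ _ _ (Hh c Ac Hc)) as (_ & G1 & G2).
  destruct i; simpl; unfold pull in *.
  - rewrite (Derive_mult (fun t => f (cinv c t (coord c e2 p)))
               (fun t => h (cinv c t (coord c e2 p))) _ F1 G1), (cinvK Hc); reflexivity.
  - rewrite (Derive_mult (fun t => f (cinv c (coord c e1 p) t))
               (fun t => h (cinv c (coord c e1 p) t)) _ F2 G2), (cinvK Hc); reflexivity.
Qed.

Lemma pd_comp1 c i (u : R -> R) l f p : atlas c -> dom c p -> smooth p f ->
  is_derive u (f p) l -> pd c i (fun q => u (f q)) p = l * pd c i f p.
Proof.
  intros Ac Hc Hf Hu; destruct (pd_is_derive c f p Ac Hc Hf) as [F1 F2].
  assert (X : forall (w : R -> R) t m, is_derive w t m -> w t = f p ->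
            Derive (fun z => u (w z)) t = l * m).
  { intros w t m Hw Ew; apply is_derive_unique.
    replace (l * m) with (m * l) by ring.
    apply (is_derive_comp u w t l m); [rewrite Ew; exact Hu|exact Hw]. }
  destruct i; simpl.
  - apply (X (fun t => f (cinv c t (coord c e2 p)))); [exact F1|rewrite (cinvK Hc); auto].
  - apply (X (fun t => f (cinv c (coord c e1 p) t))); [exact F2|rewrite (cinvK Hc); auto].
Qed.

Lemma pd_opp c i f p : atlas c -> dom c p -> smooth p f ->
  pd c i (fun q => - f q) p = - pd c i f p.
Proof.
  intros Ac Hc Hf.
  rewrite (pd_comp1 c i (fun t => - t) (-1) f p Ac Hc Hf); [ring|].
  auto_derive; [exact I|ring].
Qed.

Lemma pd_minus c i f h p : atlas c -> dom c p -> smooth p f -> smooth p h ->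
  pd c i (fun q => f q - h q) p = pd c i f p - pd c i h p.
Proof.
  intros Ac Hc Hf Hh; unfold Rminus.
  rewrite (pd_plus c i f (fun q => - h q)), pd_opp; auto using smooth_opp.
Qed.

Lemma pd_inv c i f p : atlas c -> dom c p -> f p <> 0 -> smooth p f ->
  pd c i (fun q => / f q) p = - pd c i f p / (f p * f p).
Proof.
  intros Ac Hc Hp Hf.
  rewrite (pd_comp1 c i Rinv (- / (f p * f p)) f p Ac Hc Hf).
  - field; exact Hp.
  - auto_derive; [exact Hp|field; exact Hp].
Qed.

Lemma pd_sum2 c i (F : axis -> S -> R) p : atlas c -> dom c p ->
  (forall k, smooth p (F k)) ->
  pd c i (fun q => sum2 (fun k => F k q)) p = sum2 (fun k => pd c i (F k) p).
Proof. intros Ac Hc H; exact (pd_plus c i (F e1) (F e2) p Ac Hc (H e1) (H e2)). Qed.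

Lemma pd_chain c d i f p : atlas c -> atlas d -> dom c p -> dom d p -> smooth p f ->
  pd c i f p = sum2 (fun k => pd d k f p * pd c i (coord d k) p).
Proof.
  intros Ac Ad Hc Hd H; destruct (transition d c p Ad Ac Hd Hc) as [V HS].
  assert (Df := sm_differentiable _ _ _ (H d Ad Hd)).
  destruct (sm_partials _ _ _ (HS e1)) as (_ & A1 & A2).
  destruct (sm_partials _ _ _ (HS e2)) as (_ & B1 & B2).
  unfold sum2; destruct i; simpl.
  - apply is_derive_unique.
    apply is_derive_ext_loc with
      (fun t => pull d f (pull c (coord d e1) t (coord c e2 p))
                         (pull c (coord d e2) t (coord c e2 p))).
    + generalize (locally_2d_1d_const_y _ _ _ V); apply filter_imp; intros t [_ B].
      unfold pull; rewrite (cinvK B); reflexivity.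
    + apply (is_derive_comp_2d (pull d f) (fun t => pull c (coord d e1) t (coord c e2 p))
               (fun t => pull c (coord d e2) t (coord c e2 p))).
      * unfold pull at 2 3; rewrite (cinvK Hc); exact Df.
      * exact (Derive_correct _ _ A1).
      * exact (Derive_correct _ _ B1).
  - apply is_derive_unique.
    apply is_derive_ext_loc with
      (fun t => pull d f (pull c (coord d e1) (coord c e1 p) t)
                         (pull c (coord d e2) (coord c e1 p) t)).
    + generalize (locally_2d_1d_const_x _ _ _ V); apply filter_imp; intros t [_ B].
      unfold pull; rewrite (cinvK B); reflexivity.
    + apply (is_derive_comp_2d (pull d f) (fun t => pull c (coord d e1) (coord c e1 p) t)
               (fun t => pull c (coord d e2) (coord c e1 p) t)).
      * unfold pull at 2 3; rewrite (cinvK Hc); exact Df.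
      * exact (Derive_correct _ _ A2).
      * exact (Derive_correct _ _ B2).
Qed.

Lemma partial_ext i (F G : R -> R -> R) x y :
  locally_2d (fun u v => F u v = G u v) x y -> partial i F x y = partial i G x y.
Proof.
  intros E; destruct i; apply Derive_ext_loc.
  - exact (locally_2d_1d_const_y _ _ _ E).
  - exact (locally_2d_1d_const_x _ _ _ E).
Qed.

Lemma pd_comm c i j f p : atlas c -> dom c p -> smooth p f ->
  pd c i (pd c j f) p = pd c j (pd c i f) p.
Proof.
  intros Ac Hc H.
  assert (X : forall i j, pd c i (pd c j f) p =
    partial i (partial j (pull c f)) (coord c e1 p) (coord c e2 p)).
  { clear i j; intros i j; rewrite pdE; apply partial_ext.
    generalize (cimg_near c p Hc); apply locally_2d_mono; intros; apply pull_pd; auto. }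
  rewrite !X; assert (Z := sm_Schwarz _ _ _ (H c Ac Hc)).
  destruct i, j; simpl; auto.
Qed.

Lemma pd_coord c i j p : dom c p -> pd c i (coord c j) p = @coord_field S i j p.
Proof.
  intros Hc; generalize (cimg_near c p Hc); intros V.
  assert (E : locally_2d (fun x y => pull c (coord c j) x y = match j with e1 => x | e2 => y end)
                (coord c e1 p) (coord c e2 p)).
  { revert V; apply locally_2d_mono; intros x y Hxy.
    destruct (cinv_dom _ _ _ Hxy) as (_ & E1 & E2); destruct j; assumption. }
  rewrite pdE, (partial_ext i _ _ _ _ E).
  destruct i, j; unfold partial, dx, dy, coord_field;
    solve [exact (Derive_const _ _) | exact (Derive_id _)].
Qed.

End Calculus.

(** Goals that a denominator does not vanish are left to the user, unless they
    are hypotheses. *)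
Ltac smooth_tac :=
  lazymatch goal with
  | |- smooth ?p (fun _ => ?r) => apply smooth_const
  | |- smooth ?p (fun q => @?f q + @?h q) => apply (smooth_plus p f h); smooth_tac
  | |- smooth ?p (fun q => @?f q - @?h q) => apply (smooth_minus p f h); smooth_tac
  | |- smooth ?p (fun q => @?f q * @?h q) => apply (smooth_mult p f h); smooth_tac
  | |- smooth ?p (fun q => @?f q / @?h q) =>
      apply (smooth_div p f h); [try assumption|smooth_tac|smooth_tac]
  | |- smooth ?p (fun q => - @?f q) => apply (smooth_opp p f); smooth_tac
  | |- smooth ?p (fun q => / @?f q) => apply (smooth_inv p f); [try assumption|smooth_tac]
  | |- smooth ?p (fun q => exp (@?f q)) => apply (smooth_exp p f); smooth_tac
  | |- smooth ?p (fun q => sum2 (fun k => @?F k q)) =>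
      apply (smooth_sum2 p F); intros ?; smooth_tac
  | |- smooth ?p (fun q => pd ?c ?i ?f q) =>
      apply (smooth_pd c i f p); [assumption|assumption|smooth_tac]
  | |- smooth ?p (pd ?c ?i ?f) =>
      apply (smooth_pd c i f p); [assumption|assumption|smooth_tac]
  | |- smooth ?p (fun q => coord ?c ?k q) => apply (smooth_coord c k p); assumption
  | |- smooth ?p (coord ?c ?k) => apply (smooth_coord c k p); assumption
  | |- smooth ?p (fun q => ?f q) => change (smooth p f); smooth_tac
  | |- _ => first [solve [auto with smooth] | idtac]
  end.

Ltac pd_step :=
  match goal with
  | |- context [pd ?c ?i (fun _ => ?r) ?p] => rewrite (pd_const c i r p)
  | |- context [pd ?c ?i (fun q => @?f q + @?h q) ?p] =>
      rewrite (pd_plus c i f h p); [cbv beta|assumption|assumption|smooth_tac|smooth_tac]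
  | |- context [pd ?c ?i (fun q => @?f q - @?h q) ?p] =>
      rewrite (pd_minus c i f h p); [cbv beta|assumption|assumption|smooth_tac|smooth_tac]
  | |- context [pd ?c ?i (fun q => @?f q * @?h q) ?p] =>
      rewrite (pd_mult c i f h p); [cbv beta|assumption|assumption|smooth_tac|smooth_tac]
  | |- context [pd ?c ?i (fun q => - @?f q) ?p] =>
      rewrite (pd_opp c i f p); [cbv beta|assumption|assumption|smooth_tac]
  | |- context [pd ?c ?i (fun q => sum2 (fun k => @?F k q)) ?p] =>
      rewrite (pd_sum2 c i F p); [cbv beta|assumption|assumption|intros ?; smooth_tac]
  | |- context [pd ?c ?i (fun q => ?f q) ?p] =>
      progress change (pd c i (fun q => f q) p) with (pd c i f p)
  end.
Ltac pd_simpl := cbv beta; repeat pd_step.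
Create HintDb smooth.


(** * The Christoffel symbols in two charts *)

Lemma kernel2 a b c d x y :
  a * d - b * c <> 0 -> a * x + b * y = 0 -> c * x + d * y = 0 -> x = 0 /\ y = 0.
Proof.
  intros N E1 E2; split; apply Rmult_eq_reg_l with (2 := N).
  - transitivity (d * (a * x + b * y) - b * (c * x + d * y)); [ring|rewrite E1, E2; ring].
  - transitivity (a * (c * x + d * y) - c * (a * x + b * y)); [ring|rewrite E1, E2; ring].
Qed.

(** The algebra of [christoffel_law], free of points and charts: J is the Jacobian
    of the coordinate change and H its derivatives, [gc], [dgc], [Gc] are the
    metric, its derivatives and the Christoffel symbols in the first chart, and
    [gd], [dgd], [Gd] those in the second. *)
Lemma christoffel_law_algebra
    (J : axis -> axis -> R) (H : axis -> axis -> axis -> R)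
    (gc gd : axis -> axis -> R) (dgc dgd Gc Gd : axis -> axis -> axis -> R) :
  (forall i j m, H i j m = H j i m) -> (forall k m, gd k m = gd m k) ->
  (forall j l, gc j l = sum2 (fun k => sum2 (fun m => J j k * J l m * gd k m))) ->
  (forall i j l, dgc i j l = sum2 (fun k => sum2 (fun m =>
     (H i j k * J l m + J j k * H i l m) * gd k m
     + J j k * J l m * sum2 (fun a => dgd a k m * J i a)))) ->
  (forall i j l, sum2 (fun k => gc l k * Gc k i j) = / 2 * (dgc i j l + dgc j i l - dgc l i j)) ->
  (forall i j l, sum2 (fun k => gd l k * Gd k i j) = / 2 * (dgd i j l + dgd j i l - dgd l i j)) ->
  (forall a k m, dgd a k m = dgd a m k) ->
  forall i j l, sum2 (fun n => J l n * sum2 (fun m => gd n m *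
    (sum2 (fun k => Gc k i j * J k m) - H i j m -
     sum2 (fun a => sum2 (fun b => J i a * J j b * Gd m a b))))) = 0.
Proof.
  intros HH Hgd Hgc Hdgc Lc Ld Hdgd i j l.
  set (T := fun a b n => sum2 (fun m => gd n m * Gd m a b)).
  assert (ET : forall a b n, T a b n = / 2 * (dgd a b n + dgd b a n - dgd n a b))
    by (intros; apply Ld).
  transitivity (sum2 (fun k => gc l k * Gc k i j)
    - sum2 (fun m => sum2 (fun n => H i j m * gd n m * J l n))
    - sum2 (fun a => sum2 (fun b => sum2 (fun n => J i a * J j b * J l n * T a b n)))).
  { unfold T, sum2; rewrite !Hgc; unfold sum2; rewrite (Hgd e2 e1); ring. }
  clearbody T; rewrite Lc; unfold sum2; rewrite !ET, !Hdgc; unfold sum2.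
  rewrite (Hgd e2 e1), !(Hdgd _ e2 e1).
  destruct i, j, l; rewrite ?(HH e2 e1); field.
Qed.

Section Geometry.
Context {S : surface} {g : bifield S} (Hg : is_metric g).
Implicit Types (c d : chart S) (f h : S -> R) (p q : S) (P Q : S -> Prop) (i j k : axis).

Lemma metric_smooth c i j p : atlas c -> dom c p -> smooth p (g c i j).
Proof.
  intros Ac Hc; exact (smooth_of_smooth_in c _ p Ac Hc (proj1 (proj2 Hg) c i j Ac)).
Qed.
Hint Resolve metric_smooth : smooth.

Lemma metric_sym c i j p : atlas c -> dom c p -> g c i j p = g c j i p.
Proof. destruct Hg as (_ & _ & H & _); apply H. Qed.

Lemma metric_pull c d i j p : atlas c -> atlas d -> dom c p -> dom d p ->
  g c i j p = sum2 (fun k => sum2 (fun l =>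
    pd c i (coord d k) p * pd c j (coord d l) p * g d k l p)).
Proof. destruct Hg as (H & _); apply H. Qed.

Lemma metric_pos c p (v : axis -> R) : atlas c -> dom c p -> (exists i, v i <> 0) ->
  0 < sum2 (fun i => sum2 (fun j => g c i j p * v i * v j)).
Proof. destruct Hg as (_ & _ & _ & H); apply H. Qed.

Lemma metric_11_pos c p : atlas c -> dom c p -> 0 < g c e1 e1 p.
Proof.
  intros Ac Hc.
  assert (X := metric_pos c p (fun i => match i with e1 => 1 | e2 => 0 end) Ac Hc).
  unfold sum2 in X; enough (0 < g c e1 e1 p * 1 * 1 + g c e1 e2 p * 1 * 0
    + (g c e2 e1 p * 0 * 1 + g c e2 e2 p * 0 * 0)) by lra.
  apply X; exists e1; lra.
Qed.

Lemma gdet_pos c p : atlas c -> dom c p -> 0 < gdet g c p.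
Proof.
  intros Ac Hc; assert (P1 := metric_11_pos c p Ac Hc).
  assert (X := metric_pos c p
    (fun i => match i with e1 => - g c e1 e2 p | e2 => g c e1 e1 p end) Ac Hc).
  assert (X' : 0 < g c e1 e1 p * gdet g c p).
  { eapply Rlt_le_trans; [apply X; exists e2; lra|].
    unfold gdet, sum2; rewrite (metric_sym c e2 e1 p Ac Hc); right; ring. }
  apply Rmult_lt_reg_l with (g c e1 e1 p); lra.
Qed.

Lemma gdet_neq0 c p : atlas c -> dom c p -> gdet g c p <> 0.
Proof. intros Ac Hc; assert (X := gdet_pos c p Ac Hc); lra. Qed.

Lemma pd_metric_sym c a i j p : atlas c -> dom c p -> pd c a (g c i j) p = pd c a (g c j i) p.
Proof.
  intros Ac Hc; apply (pd_ext c a _ _ p Ac Hc).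
  generalize (near_dom c p Ac Hc); apply near_mono; intros q Hq.
  apply metric_sym; assumption.
Qed.

Lemma smooth_gdet c p : atlas c -> dom c p -> smooth p (gdet g c).
Proof. intros Ac Hc; unfold gdet; smooth_tac. Qed.
Hint Resolve smooth_gdet : smooth.

Lemma smooth_ginv c i j p : atlas c -> dom c p -> smooth p (ginv g c i j).
Proof.
  intros Ac Hc; assert (N := gdet_neq0 c p Ac Hc).
  destruct i, j; unfold ginv; smooth_tac.
Qed.
Hint Resolve smooth_ginv : smooth.

Lemma smooth_christoffel c k i j p : atlas c -> dom c p -> smooth p (christoffel g c k i j).
Proof. intros Ac Hc; unfold christoffel; smooth_tac. Qed.
Hint Resolve smooth_christoffel : smooth.

Lemma christoffel_lower c i j l p : atlas c -> dom c p ->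
  sum2 (fun k => g c l k p * christoffel g c k i j p) =
  / 2 * (pd c i (g c j l) p + pd c j (g c i l) p - pd c l (g c i j) p).
Proof.
  intros Ac Hc; assert (N := gdet_neq0 c p Ac Hc).
  unfold christoffel, sum2, ginv; unfold gdet in *.
  rewrite (metric_sym c e2 e1 p Ac Hc) in *.
  destruct l; rewrite ?(metric_sym c e2 e1 p Ac Hc); field; exact N.
Qed.

Lemma metric_compatible c a m n p : atlas c -> dom c p ->
  pd c a (g c m n) p =
  sum2 (fun k => g c m k p * christoffel g c k a n p) +
  sum2 (fun k => g c n k p * christoffel g c k a m p).
Proof.
  intros Ac Hc; rewrite !christoffel_lower by assumption.
  rewrite (pd_metric_sym c a n m), (pd_metric_sym c n a m), (pd_metric_sym c m a n) by assumption.
  field.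
Qed.

Lemma jacobian_sym c d i j m p : atlas c -> atlas d -> dom c p -> dom d p ->
  pd c i (pd c j (coord d m)) p = pd c j (pd c i (coord d m)) p.
Proof. intros Ac Ad Hc Hd; apply pd_comm; auto; smooth_tac. Qed.

Definition jac c d p : R :=
  pd c e1 (coord d e1) p * pd c e2 (coord d e2) p
  - pd c e1 (coord d e2) p * pd c e2 (coord d e1) p.

Lemma gdet_pull c d p : atlas c -> atlas d -> dom c p -> dom d p ->
  gdet g c p = jac c d p * jac c d p * gdet g d p.
Proof.
  intros Ac Ad Hc Hd; unfold gdet; rewrite !(metric_pull c d) by assumption.
  unfold sum2, jac; ring.
Qed.

Lemma jac_neq0 c d p : atlas c -> atlas d -> dom c p -> dom d p -> jac c d p <> 0.
Proof.
  intros Ac Ad Hc Hd E; apply (gdet_neq0 c p Ac Hc).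
  rewrite (gdet_pull c d p) by assumption; rewrite E; ring.
Qed.

Lemma pd_metric_pull c d i j l p : atlas c -> atlas d -> dom c p -> dom d p ->
  pd c i (g c j l) p = sum2 (fun k => sum2 (fun m =>
     (pd c i (pd c j (coord d k)) p * pd c l (coord d m) p
      + pd c j (coord d k) p * pd c i (pd c l (coord d m)) p) * g d k m p
     + pd c j (coord d k) p * pd c l (coord d m) p *
       sum2 (fun a => pd d a (g d k m) p * pd c i (coord d a) p))).
Proof.
  intros Ac Ad Hc Hd.
  transitivity (pd c i (fun q => sum2 (fun k => sum2 (fun m =>
    pd c j (coord d k) q * pd c l (coord d m) q * g d k m q))) p).
  { apply pd_ext; [assumption|assumption|].
    generalize (near_and _ _ _ (near_dom c p Ac Hc) (near_dom d p Ad Hd)).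
    apply near_mono; intros q [Hq Hq']; apply metric_pull; assumption. }
  unfold sum2; pd_simpl.
  rewrite !(fun k m => pd_chain c d i (g d k m) p Ac Ad Hc Hd ltac:(smooth_tac)).
  unfold sum2; ring.
Qed.

(** Both sides have the same inner product with each coordinate vector: pairing
    turns the symbols into first derivatives of the metric. *)
Lemma christoffel_law c d i j m p : atlas c -> atlas d -> dom c p -> dom d p ->
  sum2 (fun k => christoffel g c k i j p * pd c k (coord d m) p) =
  pd c i (pd c j (coord d m)) p +
  sum2 (fun a => sum2 (fun b =>
    pd c i (coord d a) p * pd c j (coord d b) p * christoffel g d m a b p)).
Proof.
  intros Ac Ad Hc Hd.
  assert (X := christoffel_law_algebra (fun k m => pd c k (coord d m) p)
    (fun i j m => pd c i (pd c j (coord d m)) p)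
    (fun i j => g c i j p) (fun i j => g d i j p)
    (fun a i j => pd c a (g c i j) p) (fun a i j => pd d a (g d i j) p)
    (fun k i j => christoffel g c k i j p) (fun k i j => christoffel g d k i j p)).
  cbv beta in X.
  specialize (X (fun i j m => jacobian_sym c d i j m p Ac Ad Hc Hd)
                (fun k m => metric_sym d k m p Ad Hd)
                (fun j l => metric_pull c d j l p Ac Ad Hc Hd)
                (fun i j l => pd_metric_pull c d i j l p Ac Ad Hc Hd)
                (fun i j l => christoffel_lower c i j l p Ac Hc)
                (fun i j l => christoffel_lower d i j l p Ad Hd)
                (fun a k m => pd_metric_sym d a k m p Ad Hd) i j).
  set (V := fun m => sum2 (fun k => christoffel g c k i j p * pd c k (coord d m) p)
     - pd c i (pd c j (coord d m)) p
     - sum2 (fun a => sum2 (fun b =>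
    pd c i (coord d a) p * pd c j (coord d b) p * christoffel g d m a b p))).
  enough (V m = 0) by (unfold V in *; lra).
  assert (X' : forall l, pd c l (coord d e1) p * (g d e1 e1 p * V e1 + g d e1 e2 p * V e2)
    + pd c l (coord d e2) p * (g d e2 e1 p * V e1 + g d e2 e2 p * V e2) = 0) by exact X.
  assert (X1 := X' e1); assert (X2 := X' e2); clear X X'; clearbody V.
  assert (NJ := jac_neq0 c d p Ac Ad Hc Hd); assert (Nd := gdet_neq0 d p Ad Hd).
  unfold jac, gdet in *.
  set (w1 := g d e1 e1 p * V e1 + g d e1 e2 p * V e2) in *.
  set (w2 := g d e2 e1 p * V e1 + g d e2 e2 p * V e2) in *.
  destruct (kernel2 _ _ _ _ w1 w2 ltac:(exact NJ) X1 X2) as [W1 W2].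
  destruct (kernel2 _ _ _ _ (V e1) (V e2) ltac:(exact Nd) W1 W2); destruct m; assumption.
Qed.

End Geometry.
#[export] Hint Resolve metric_smooth smooth_gdet smooth_ginv smooth_christoffel : smooth.


(** * The connection and the curvature in two charts *)

Section Curvature.
Context {S : surface} {g : bifield S} (Hg : is_metric g).
Implicit Types (c d : chart S) (f h : S -> R) (p q : S) (P Q : S -> Prop) (i j k : axis).

(** The connection of the chart [d], pulled back to the chart [c]: it
    differentiates along the coordinates of [c] a field with components in [d]. *)
Definition jcov c d i (W : axis -> S -> R) (m : axis) q : R :=
  pd c i (W m) q + sum2 (fun a => sum2 (fun b =>
    pd c i (coord d a) q * christoffel g d m a b q * W b q)).

(** The components in [d] of the field with components [w] in [c]. *)
Definition push c d (w : axis -> S -> R) (m : axis) q : R :=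
  sum2 (fun k => w k q * pd c k (coord d m) q).

Lemma covd_coord c i (w : axis -> S -> R) k q :
  covd g c (coord_field i) w k q =
  pd c i (w k) q + sum2 (fun j => christoffel g c k i j q * w j q).
Proof. unfold covd, sum2; destruct i; simpl; ring. Qed.

(** This is [christoffel_law] applied to each component of the field. *)
Lemma covd_push c d i (w : axis -> S -> R) m q :
  atlas c -> atlas d -> dom c q -> dom d q -> (forall k, smooth q (w k)) ->
  push c d (covd g c (coord_field i) w) m q = jcov c d i (push c d w) m q.
Proof.
  intros Ac Ad Hc Hd Hw; unfold jcov, push.
  unfold sum2; pd_simpl; rewrite !covd_coord.
  assert (L1 := christoffel_law Hg c d i e1 m q Ac Ad Hc Hd).
  assert (L2 := christoffel_law Hg c d i e2 m q Ac Ad Hc Hd).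
  unfold sum2 in *.
  match goal with |- ?l = ?r => enough (l - r = 0) by lra end.
  match type of L1 with ?l1 = ?r1 => match type of L2 with ?l2 = ?r2 =>
    transitivity (w e1 q * (l1 - r1) + w e2 q * (l2 - r2)) end end.
  - ring.
  - rewrite L1, L2; ring.
Qed.

Lemma covd_dir c (v w : axis -> S -> R) k q :
  covd g c v w k q = sum2 (fun i => v i q * covd g c (coord_field i) w k q).
Proof. unfold sum2; rewrite !covd_coord; reflexivity. Qed.

(** The direction of differentiation enters linearly, so this reduces to
    [covd_push] by the chain rule. *)
Lemma covd_law c d (v w v' w' : axis -> S -> R) m p :
  atlas c -> atlas d -> dom c p -> dom d p -> (forall k, smooth p (w k)) ->
  (forall a, v' a p = push c d v a p) ->
  (forall a, near p (fun q => w' a q = push c d w a q)) ->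
  covd g d v' w' m p = push c d (covd g c v w) m p.
Proof.
  intros Ac Ad Hc Hd Hw Ev Ew.
  assert (Sw : forall a, smooth p (push c d w a)).
  { intros a; unfold push; smooth_tac; apply Hw. }
  assert (Sw' : forall a, smooth p (w' a)).
  { intros a; apply smooth_ext with (2 := Sw a); generalize (Ew a); apply near_mono; auto. }
  transitivity (sum2 (fun i => v i p * jcov c d i (push c d w) m p)).
  - unfold covd, sum2 at 1; rewrite !Ev.
    unfold sum2; unfold jcov.
    rewrite <- !(fun i => pd_ext c i _ _ p Ac Hc (Ew m)).
    rewrite !(fun i => pd_chain c d i (w' m) p Ac Ad Hc Hd (Sw' m)).
    rewrite (near_here _ _ (Ew e1)), (near_here _ _ (Ew e2)).
    unfold push, sum2; ring.
  - unfold sum2; rewrite <- !covd_push by assumption.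
    unfold push, sum2; rewrite !(covd_dir c v); unfold sum2; ring.
Qed.

(** The components R^m_(12n) of the curvature tensor. *)
Definition riemann d (m n : axis) q : R :=
  pd d e1 (christoffel g d m e2 n) q - pd d e2 (christoffel g d m e1 n) q
  + sum2 (fun b => christoffel g d m e1 b q * christoffel g d b e2 n q
                   - christoffel g d m e2 b q * christoffel g d b e1 n q).

(** Second derivatives of the field and of the coordinate change cancel by
    symmetry; what is left is bilinear and alternating in the rows of the
    Jacobian, hence a multiple of the determinant. *)
Lemma jcov_comm c d (W : axis -> S -> R) m p :
  atlas c -> atlas d -> dom c p -> dom d p -> (forall k, smooth p (W k)) ->
  jcov c d e1 (jcov c d e2 W) m p - jcov c d e2 (jcov c d e1 W) m p =
  jac c d p * sum2 (fun n => riemann d m n p * W n p).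
Proof.
  intros Ac Ad Hc Hd HW; unfold jcov at 1 3, sum2.
  unfold jcov, sum2, riemann, jac; pd_simpl.
  rewrite (pd_comm c e1 e2 (W m)) by auto.
  rewrite !(fun k => jacobian_sym c d e1 e2 k p) by assumption.
  rewrite !(fun i k l a => pd_chain c d i (christoffel g d k l a) p Ac Ad Hc Hd ltac:(smooth_tac)).
  unfold sum2; ring.
Qed.

Lemma smooth_covd c (v w : axis -> S -> R) m p :
  atlas c -> dom c p -> (forall k, smooth p (v k)) -> (forall k, smooth p (w k)) ->
  smooth p (covd g c v w m).
Proof. intros Ac Hc Hv HW; unfold covd; smooth_tac; auto. Qed.

Lemma smooth_coord_field i k p : smooth p (coord_field i k).
Proof. destruct i, k; unfold coord_field; apply smooth_const. Qed.

(** The numerator vector of the curvature formula, computed in [c] and pushed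
    to [d]: mixed second derivatives cancel, which leaves the Riemann tensor of
    [d] times the Jacobian. *)
Lemma curvature_vector_push c d m p : atlas c -> atlas d -> dom c p -> dom d p ->
  push c d (fun k q =>
    covd g c (coord_field e1) (covd g c (coord_field e2) (coord_field e2)) k q
    - covd g c (coord_field e2) (covd g c (coord_field e1) (coord_field e2)) k q) m p =
  jac c d p * sum2 (fun n => riemann d m n p * pd c e2 (coord d n) p).
Proof.
  intros Ac Ad Hc Hd.
  assert (N := near_and _ _ _ (near_dom c p Ac Hc) (near_dom d p Ad Hd)).
  assert (F := smooth_coord_field).
  assert (SF : forall q, dom c q -> dom d q -> forall k, smooth q (push c d (coord_field e2) k)).
  { intros q Hq Hq' k; unfold push; smooth_tac; apply F. }
  assert (X : forall i j, push c d (covd g c (coord_field i)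
        (covd g c (coord_field j) (coord_field e2))) m p =
      jcov c d i (jcov c d j (push c d (coord_field e2))) m p).
  { intros i j; rewrite covd_push; try assumption.
    2:{ intros k; apply smooth_covd; auto. }
    assert (E : forall a, near p (fun q => push c d (covd g c (coord_field j) (coord_field e2)) a q =
        jcov c d j (push c d (coord_field e2)) a q)).
    { intros a; revert N; apply near_mono; intros q [Hq Hq'].
      apply covd_push; auto. }
    unfold jcov at 1 2.
    rewrite (pd_ext c i _ _ p Ac Hc (E m)); unfold sum2.
    rewrite (near_here _ _ (E e1)), (near_here _ _ (E e2)); reflexivity. }
  transitivity (jcov c d e1 (jcov c d e2 (push c d (coord_field e2))) m p
    - jcov c d e2 (jcov c d e1 (push c d (coord_field e2))) m p).
  { rewrite <- !X; unfold push, sum2; ring. }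
  rewrite jcov_comm by auto.
  unfold push, sum2, coord_field; ring.
Qed.

Definition riemann_low d (n b : axis) p : R := sum2 (fun m => g d n m p * riemann d m b p).

(** Metric compatibility turns this into the symmetry of second derivatives of
    the metric. *)
Lemma riemann_antisym d m n p : atlas d -> dom d p ->
  riemann_low d m n p = - riemann_low d n m p.
Proof.
  intros Ad Hd.
  assert (E := pd_comm d e1 e2 (g d m n) p Ad Hd (metric_smooth Hg d m n p Ad Hd)).
  assert (X : forall i j, pd d i (pd d j (g d m n)) p =
    pd d i (fun q => sum2 (fun k => g d m k q * christoffel g d k j n q) +
                     sum2 (fun k => g d n k q * christoffel g d k j m q)) p).
  { intros i j; apply pd_ext; [assumption|assumption|].
    generalize (near_dom d p Ad Hd); apply near_mono; intros q Hq.
    apply metric_compatible; assumption. }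
  rewrite !X in E; unfold sum2 in E; clear X.
  revert E; pd_simpl; rewrite !(fun a i j => metric_compatible Hg d a i j p Ad Hd).
  unfold riemann_low, riemann, sum2.
  rewrite !(metric_sym Hg d e2 e1 p Ad Hd).
  intros E; match type of E with ?l = ?r =>
    match goal with |- ?a = ?b => enough (a - b = l - r) by lra end end.
  destruct m, n; rewrite ?(metric_sym Hg d e2 e1 p Ad Hd); ring.
Qed.

Definition chart_curvature c p : R :=
  sum2 (fun k => g c e1 k p *
    (covd g c (coord_field e1) (covd g c (coord_field e2) (coord_field e2)) k p
     - covd g c (coord_field e2) (covd g c (coord_field e1) (coord_field e2)) k p))
  / gdet g c p.

(** By antisymmetry of [riemann_low], pushing the numerator from [c] to [d]
    multiplies it by the square of the Jacobian, as does the denominator. *)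
Lemma chart_curvatureE c d p : atlas c -> atlas d -> dom c p -> dom d p ->
  chart_curvature c p = riemann_low d e1 e2 p / gdet g d p.
Proof.
  intros Ac Ad Hc Hd.
  set (Rc := fun k q =>
    covd g c (coord_field e1) (covd g c (coord_field e2) (coord_field e2)) k q
     - covd g c (coord_field e2) (covd g c (coord_field e1) (coord_field e2)) k q).
  assert (Y : forall m, push c d Rc m p =
      jac c d p * sum2 (fun n => riemann d m n p * pd c e2 (coord d n) p))
    by (intros m; apply curvature_vector_push; assumption).
  assert (A11 := riemann_antisym d e1 e1 p Ad Hd).
  assert (A22 := riemann_antisym d e2 e2 p Ad Hd).
  assert (A12 := riemann_antisym d e2 e1 p Ad Hd).
  assert (N : sum2 (fun k => g c e1 k p * Rc k p) = jac c d p * jac c d p * riemann_low d e1 e2 p).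
  { transitivity (sum2 (fun m => sum2 (fun n => pd c e1 (coord d n) p * g d n m p * push c d Rc m p))).
    { unfold sum2; rewrite !(metric_pull Hg c d) by assumption; unfold push, sum2; ring. }
    transitivity (jac c d p * sum2 (fun n => sum2 (fun b =>
      pd c e1 (coord d n) p * pd c e2 (coord d b) p * riemann_low d n b p))).
    { unfold sum2; rewrite !Y; unfold riemann_low, sum2; ring. }
    unfold sum2; rewrite A12.
    replace (riemann_low d e1 e1 p) with 0 by lra.
    replace (riemann_low d e2 e2 p) with 0 by lra.
    unfold jac; ring. }
  unfold chart_curvature; fold (Rc e1 p) (Rc e2 p).
  change (sum2 (fun k => g c e1 k p * Rc k p) / gdet g c p = riemann_low d e1 e2 p / gdet g d p).
  rewrite N, (gdet_pull Hg c d p) by assumption.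
  assert (N1 := jac_neq0 Hg c d p Ac Ad Hc Hd); assert (N2 := gdet_neq0 Hg d p Ad Hd).
  field; auto.
Qed.

Lemma curvatureE d p : atlas d -> dom d p ->
  gaussian_curvature g p = riemann_low d e1 e2 p / gdet g d p.
Proof.
  intros Ad Hd; apply (chart_curvatureE (chart_at p) d p).
  - apply chart_at_atlas.
  - exact Ad.
  - apply chart_at_dom.
  - exact Hd.
Qed.

(** The definition of the curvature uses a chart chosen at each point, with no
    continuity in the point; near p the single chart chosen at p may be used. *)
Lemma smooth_curvature p : smooth p (gaussian_curvature g).
Proof.
  assert (A := chart_at_atlas p); assert (D := chart_at_dom p).
  assert (N := gdet_neq0 Hg _ p A D).
  apply smooth_ext with (fun q => riemann_low (chart_at p) e1 e2 q / gdet g (chart_at p) q).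
  - generalize (near_dom _ p A D); apply near_mono; intros q Hq; symmetry.
    apply curvatureE; assumption.
  - unfold riemann_low, riemann; smooth_tac.
Qed.

Definition conformal_at d (phi : S -> R) q : Prop :=
  forall i j, g d i j q = exp (2 * phi q) * coord_field i j q.

Lemma conformal_christoffel d (phi : S -> R) k i j p : atlas d -> dom d p -> smooth p phi ->
  near p (conformal_at d phi) ->
  christoffel g d k i j p =
    pd d i phi p * coord_field j k p + pd d j phi p * coord_field i k p
    - pd d k phi p * coord_field i j p.
Proof.
  intros Ad Hd Sp N.
  assert (D : forall a m n, pd d a (g d m n) p =
      2 * pd d a phi p * exp (2 * phi p) * coord_field m n p).
  { intros a m n.
    rewrite (pd_ext d a _ (fun q => exp (2 * phi q) * coord_field m n q) p Ad Hd).
    2:{ revert N; apply near_mono; intros r H; apply H. }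
    assert (Sc := smooth_coord_field m n p).
    rewrite (pd_mult d a (fun r => exp (2 * phi r))) by (auto; smooth_tac).
    rewrite (pd_comp1 d a (fun t => exp (2 * t)) (2 * exp (2 * phi p)) phi p) by
      (first [assumption | auto_derive; [exact I|ring]]).
    replace (pd d a (coord_field m n) p) with 0 by
      (destruct m, n; symmetry; apply (pd_const d a)).
    ring. }
  assert (E := near_here _ _ N); unfold conformal_at in E.
  assert (Pe := exp_pos (2 * phi p)).
  unfold christoffel, sum2; rewrite !D.
  destruct k; unfold ginv, gdet; rewrite !E; destruct i, j; unfold coord_field;
    field; nra.
Qed.

(** Gauss's equation: the only term of the curvature tensor that survives is the
    derivative of Gamma^1_22 = - phi_u. *)
Lemma conformal_curvature d (phi : S -> R) p : atlas d -> dom d p -> smooth p phi ->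
  near p (conformal_at d phi) -> near p (fun q => pd d e2 phi q = 0) ->
  gaussian_curvature g p = - exp (- (2 * phi p)) * pd d e1 (pd d e1 phi) p.
Proof.
  intros Ad Hd Sp Ng N0.
  assert (G : near p (fun q => forall k i j, christoffel g d k i j q =
     pd d i phi q * coord_field j k q + pd d j phi q * coord_field i k q
     - pd d k phi q * coord_field i j q)).
  { generalize (near_and _ _ _ (near_dom d p Ad Hd)
      (near_and _ _ _ (near_nested _ _ Ng) (smooth_nested p phi Sp))).
    apply near_mono; intros q (Hq & Nq & Sq) k i j.
    apply conformal_christoffel; assumption. }
  assert (Pe := exp_pos (2 * phi p)).
  assert (E := near_here _ _ Ng); unfold conformal_at in E.
  rewrite (curvatureE d p Ad Hd); unfold riemann_low, riemann, gdet, sum2.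
  rewrite !E.
  assert (GG : forall k i j, christoffel g d k i j p =
     pd d i phi p * coord_field j k p + pd d j phi p * coord_field i k p
     - pd d k phi p * coord_field i j p) by exact (near_here _ _ G).
  assert (E0 : pd d e2 phi p = 0) by exact (near_here _ _ N0).
  rewrite (pd_ext d e1 (christoffel g d e1 e2 e2) (fun q => -1 * pd d e1 phi q) p Ad Hd).
  2:{ revert G; apply near_mono; intros q H; rewrite H; unfold coord_field; ring. }
  rewrite (pd_ext d e2 (christoffel g d e1 e1 e2) (fun _ => 0) p Ad Hd).
  2:{ generalize (near_and _ _ _ G N0); apply near_mono; intros q (H & H0).
      rewrite H, H0; unfold coord_field; ring. }
  rewrite (pd_mult d e1 (fun _ => -1)) by (auto; smooth_tac; auto).
  rewrite !pd_const, !GG, E0, exp_Ropp; unfold coord_field; field; nra.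
Qed.

End Curvature.
#[export] Hint Resolve smooth_curvature : smooth.


(** * The implicit function theorem in one variable *)

Lemma is_derive_cst (r t : R) : is_derive (fun _ : R => r) t 0.
Proof. exact (is_derive_const r t). Qed.

(** Caratheodory's form of differentiability, used together with
    [slope_derive]: it turns limits of difference quotients into continuity. *)
Lemma derive_slope (w : R -> R) t l : is_derive w t l ->
  exists omega, continuity_pt omega t /\ omega t = l /\
    forall u, w u - w t = omega u * (u - t).
Proof.
  intros H; exists (fun u => if Req_EM_T u t then l else (w u - w t) / (u - t)).
  split; [|split].
  - apply is_derive_Reals in H; intros e He; destruct (H e He) as [d Hd].
    exists d; split; [apply cond_pos|]; intros u [[_ Hu] Hut].
    simpl in *; unfold R_dist in *.
    destruct (Req_EM_T t t) as [_|]; [|congruence].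
    destruct (Req_EM_T u t) as [|_]; [congruence|].
    assert (X := Hd (u - t) ltac:(lra) Hut).
    replace (t + (u - t)) with u in X by ring; exact X.
  - destruct (Req_EM_T t t) as [_|]; congruence.
  - intros u; destruct (Req_EM_T u t) as [->|N]; [ring|field; lra].
Qed.

Lemma slope_derive (w omega : R -> R) t : continuity_pt omega t ->
  locally t (fun u => w u - w t = omega u * (u - t)) -> is_derive w t (omega t).
Proof.
  intros H [d Hd]; apply is_derive_Reals; intros e He; destruct (H e He) as (a & Ha & Hd').
  assert (Hm : 0 < Rmin a d) by (apply Rmin_pos; [exact Ha|apply cond_pos]).
  exists (mkposreal _ Hm); simpl; intros h Nh Hh.
  assert (B1 := Rmin_l a d); assert (B2 := Rmin_r a d).
  assert (E : w (t + h) - w t = omega (t + h) * (t + h - t)).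
  { apply Hd; change (Rabs (t + h - t) < d); replace (t + h - t) with h by ring; lra. }
  rewrite E; replace (omega (t + h) * (t + h - t) / h) with (omega (t + h)) by (field; exact Nh).
  apply (Hd' (t + h)); split; [split; [exact I|lra]|].
  simpl; unfold R_dist; replace (t + h - t) with h by ring; lra.
Qed.

Lemma MVT_horizontal f x1 x2 y :
  (forall x, Rmin x1 x2 <= x <= Rmax x1 x2 -> ex_derive (fun z => f z y) x) ->
  exists z, Rmin x1 x2 <= z <= Rmax x1 x2 /\ f x2 y - f x1 y = dx f z y * (x2 - x1).
Proof.
  intros H; destruct (MVT_gen (fun z => f z y) x1 x2 (fun z => dx f z y)) as (z & Hz & E).
  - intros x Hx; apply (Derive_correct (fun z => f z y)), H; lra.
  - intros x Hx; apply derivable_continuous_pt; exists (dx f x y).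
    apply is_derive_Reals, (Derive_correct (fun z => f z y)), H, Hx.
  - exists z; auto.
Qed.

(** Differentiating an equation solved by a continuous function [w]: the
    increment of [f] splits into a horizontal part, which is a difference
    quotient times the increment of [w], and a vertical part. *)
Lemma implicit_derive f (w b : R -> R) (t lb ls : R) :
  locally_2d (partials_exist f) (w t) (b t) -> continuity_2d_pt (dx f) (w t) (b t) ->
  dx f (w t) (b t) <> 0 -> continuity_pt w t -> is_derive b t lb ->
  is_derive (fun u => f (w u) (b u)) t ls ->
  is_derive w t ((ls - dy f (w t) (b t) * lb) / dx f (w t) (b t)).
Proof.
  intros HP HC HN Hw Hb Hs.
  assert (Cb : continuity_pt b t).
  { apply derivable_continuous_pt; exists lb; apply is_derive_Reals, Hb. }
  destruct (locally_2d_singleton _ _ _ HP) as (_ & _ & Py).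
  assert (Hv : is_derive (fun u => f (w t) (b u)) t (dy f (w t) (b t) * lb)).
  { replace (dy f (w t) (b t) * lb) with (lb * dy f (w t) (b t)) by ring.
    apply (is_derive_comp (fun z => f (w t) z) b); [exact (Derive_correct _ _ Py)|exact Hb]. }
  destruct (derive_slope _ _ _ Hs) as (sg & Csg & Esg & Hsg).
  destruct (derive_slope _ _ _ Hv) as (be & Cbe & Ebe & Hbe).
  set (den := fun u => if Req_EM_T (w u) (w t) then dx f (w t) (b t)
                       else (f (w u) (b u) - f (w t) (b u)) / (w u - w t)).
  assert (Eden : den t = dx f (w t) (b t)).
  { unfold den; destruct (Req_EM_T (w t) (w t)); congruence. }
  assert (Cden : continuity_pt den t).
  { intros e He; destruct (HC (mkposreal e He)) as [d1 H1]; destruct HP as [d2 H2].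
    assert (Hm : 0 < Rmin d1 d2) by (apply Rmin_pos; apply cond_pos).
    assert (B1 := Rmin_l d1 d2); assert (B2 := Rmin_r d1 d2).
    destruct (Hw _ Hm) as (a & Ha & Ka); destruct (Cb _ Hm) as (a' & Ha' & Ka').
    exists (Rmin a a'); split; [apply Rmin_pos; assumption|].
    assert (B3 := Rmin_l a a'); assert (B4 := Rmin_r a a').
    intros u [Du Hu]; simpl in *; unfold R_dist in *; rewrite Eden.
    assert (Wu : Rabs (w u - w t) < Rmin d1 d2) by (apply Ka; split; [exact Du|lra]).
    assert (Bu : Rabs (b u - b t) < Rmin d1 d2) by (apply Ka'; split; [exact Du|lra]).
    unfold den; destruct (Req_EM_T (w u) (w t)) as [_|N].
    - unfold Rminus; rewrite Rplus_opp_r, Rabs_R0; exact He.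
    - destruct (MVT_horizontal f (w t) (w u) (b u)) as (z & Hz & Ez).
      { intros x Hx; assert (X := Rabs_between _ _ _ Hx).
        destruct (H2 x (b u) ltac:(lra) ltac:(lra)) as (_ & D & _); exact D. }
      assert (X := Rabs_between _ _ _ Hz).
      rewrite Ez; replace (dx f z (b u) * (w u - w t) / (w u - w t)) with (dx f z (b u))
        by (field; lra).
      apply H1; lra. }
  assert (Nden : locally t (fun u => den u <> 0)).
  { assert (C := continuity_pt_locally den t); destruct C as [C _].
    generalize (C Cden (mkposreal _ (Rabs_pos_lt _ HN))); apply filter_imp.
    intros u; rewrite Eden; simpl; intros Hu E; rewrite E in Hu.
    replace (0 - dx f (w t) (b t)) with (- dx f (w t) (b t)) in Hu by ring.
    rewrite Rabs_Ropp in Hu; lra. }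
  replace ((ls - dy f (w t) (b t) * lb) / dx f (w t) (b t))
    with ((fun u => (sg u - be u) / den u) t) by (cbv beta; rewrite Esg, Ebe, Eden; reflexivity).
  apply (slope_derive w (fun u => (sg u - be u) / den u) t).
  - apply (continuity_pt_div (fun u => sg u - be u) den);
      [exact (continuity_pt_minus _ _ _ Csg Cbe)|exact Cden|].
    rewrite Eden; exact HN.
  - revert Nden; apply filter_imp; intros u Hu.
    assert (E : den u * (w u - w t) = f (w u) (b u) - f (w t) (b u)).
    { unfold den; destruct (Req_EM_T (w u) (w t)) as [->|N]; [ring|field; lra]. }
    apply Rmult_eq_reg_l with (2 := Hu); rewrite E.
    transitivity ((sg u - be u) * (u - t)); [|field; exact Hu].
    rewrite Rmult_minus_distr_r, <- Hsg, <- Hbe; ring.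
Qed.

Lemma strictly_increasing_of_dx f x1 x2 y : x1 < x2 ->
  (forall x, x1 <= x <= x2 -> ex_derive (fun z => f z y) x /\ 0 < dx f x y) ->
  f x1 y < f x2 y.
Proof.
  intros Hlt H; destruct (MVT_horizontal f x1 x2 y) as (z & Hz & Ez).
  - rewrite Rmin_left, Rmax_right by lra; intros x Hx; apply H, Hx.
  - rewrite Rmin_left, Rmax_right in Hz by lra.
    assert (X := proj2 (H z Hz)); nra.
Qed.

Lemma intermediate_value (h : R -> R) a b s : a < b ->
  (forall x, a <= x <= b -> continuity_pt h x) -> h a < s < h b ->
  exists x, a < x < b /\ h x = s.
Proof.
  intros Hab Hc Hs.
  destruct (IVT_interv (fun x => h x - s) a b) as (x & Hx & E); try lra.
  - intros x Hx; apply continuity_pt_minus; [apply Hc, Hx|].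
    apply continuity_pt_const; intros ? ?; reflexivity.
  - exists x; split; [|lra].
    assert (x <> a) by (intros ->; lra); assert (x <> b) by (intros ->; lra); lra.
Qed.

Section Implicit.
Variables (f : R -> R -> R) (x0 y0 delta epsilon : R) (xi : R -> R -> R).
Let s0 := f x0 y0.
Hypothesis Hf : forall x y, Rabs (x - x0) <= delta -> Rabs (y - y0) < epsilon ->
  sm f x y /\ 0 < dx f x y.
Hypothesis Hxi : forall s y, Rabs (s - s0) < epsilon -> Rabs (y - y0) < epsilon ->
  Rabs (xi s y - x0) < delta /\ f (xi s y) y = s.

Lemma implicit_increasing x1 x2 y : Rabs (x1 - x0) <= delta -> Rabs (x2 - x0) <= delta ->
  Rabs (y - y0) < epsilon -> x1 < x2 -> f x1 y < f x2 y.
Proof.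
  intros H1 H2 Hy Hlt; apply strictly_increasing_of_dx; [exact Hlt|]; intros x Hx.
  destruct (Hf x y) as [A B]; [|exact Hy|split; [|exact B]].
  - apply Rabs_le_between in H1; apply Rabs_le_between in H2; apply Rabs_le_between; lra.
  - destruct (sm_partials _ _ _ A) as (_ & D & _); exact D.
Qed.

Lemma implicit_unique x y : Rabs (x - x0) < delta -> Rabs (y - y0) < epsilon ->
  Rabs (f x y - s0) < epsilon -> xi (f x y) y = x.
Proof.
  intros Hx Hy Hs; destruct (Hxi (f x y) y Hs Hy) as [A B].
  destruct (Rtotal_order (xi (f x y) y) x) as [L|[E|L]]; [|exact E|].
  - assert (X := implicit_increasing (xi (f x y) y) x y ltac:(lra) ltac:(lra) Hy L); lra.
  - assert (X := implicit_increasing x (xi (f x y) y) y ltac:(lra) ltac:(lra) Hy L); lra.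
Qed.

Lemma implicit_box s y : Rabs (s - s0) < epsilon -> Rabs (y - y0) < epsilon ->
  locally_2d (fun s y => Rabs (s - s0) < epsilon /\ Rabs (y - y0) < epsilon) s y.
Proof.
  intros Hs Hy.
  assert (P : 0 < Rmin (epsilon - Rabs (s - s0)) (epsilon - Rabs (y - y0)))
    by (apply Rmin_pos; lra).
  exists (mkposreal _ P); simpl; intros u v Hu Hv.
  assert (B1 := Rmin_l (epsilon - Rabs (s - s0)) (epsilon - Rabs (y - y0))).
  assert (B2 := Rmin_r (epsilon - Rabs (s - s0)) (epsilon - Rabs (y - y0))).
  split.
  - replace (u - s0) with ((u - s) + (s - s0)) by ring.
    eapply Rle_lt_trans; [apply Rabs_triang|lra].
  - replace (v - y0) with ((v - y) + (y - y0)) by ring.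
    eapply Rle_lt_trans; [apply Rabs_triang|lra].
Qed.

(** Monotonicity in the first variable traps the solution between x - e' and
    x + e' as long as f - s keeps its strict sign at these two points. *)
Lemma implicit_continuous s y : Rabs (s - s0) < epsilon -> Rabs (y - y0) < epsilon ->
  continuity_2d_pt xi s y.
Proof.
  intros Hs Hy e; destruct (Hxi s y Hs Hy) as [A B]; set (x := xi s y) in *.
  set (e' := Rmin e (delta - Rabs (x - x0)) / 2).
  assert (B1 := Rmin_l e (delta - Rabs (x - x0))).
  assert (B2 := Rmin_r e (delta - Rabs (x - x0))).
  assert (Pe : 0 < e') by
    (apply Rdiv_lt_0_compat; [apply Rmin_pos; [apply cond_pos|lra]|lra]).
  assert (L1 : Rabs (x - e' - x0) <= delta).
  { apply Rabs_def2 in A; assert (Z := Rle_abs (x - x0)).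
    assert (Z' := Rle_abs (- (x - x0))); rewrite Rabs_Ropp in Z'.
    apply Rabs_le_between; unfold e' in *; lra. }
  assert (L2 : Rabs (x + e' - x0) <= delta).
  { apply Rabs_def2 in A; assert (Z := Rle_abs (x - x0)).
    assert (Z' := Rle_abs (- (x - x0))); rewrite Rabs_Ropp in Z'.
    apply Rabs_le_between; unfold e' in *; lra. }
  assert (I1 := implicit_increasing (x - e') x y L1 ltac:(lra) Hy ltac:(lra)).
  assert (I2 := implicit_increasing x (x + e') y ltac:(lra) L2 Hy ltac:(lra)).
  set (m := Rmin (s - f (x - e') y) (f (x + e') y - s) / 2).
  assert (M1 := Rmin_l (s - f (x - e') y) (f (x + e') y - s)).
  assert (M2 := Rmin_r (s - f (x - e') y) (f (x + e') y - s)).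
  assert (Pm : 0 < m) by (apply Rdiv_lt_0_compat; [apply Rmin_pos; lra|lra]).
  assert (C1 := sm_continuous _ _ _ (proj1 (Hf _ y L1 Hy)) (mkposreal _ Pm)).
  assert (C2 := sm_continuous _ _ _ (proj1 (Hf _ y L2 Hy)) (mkposreal _ Pm)).
  destruct C1 as [d1 C1], C2 as [d2 C2].
  destruct (implicit_box s y Hs Hy) as [d3 C3]; simpl in *.
  set (r := Rmin (Rmin d1 d2) (Rmin d3 m)).
  assert (R1 := Rmin_l (Rmin d1 d2) (Rmin d3 m)); fold r in R1.
  assert (R2 := Rmin_r (Rmin d1 d2) (Rmin d3 m)); fold r in R2.
  assert (R3 := Rmin_l d1 d2); assert (R4 := Rmin_r d1 d2).
  assert (R5 := Rmin_l d3 m); assert (R6 := Rmin_r d3 m).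
  assert (Pr : 0 < r) by (repeat apply Rmin_pos; try apply cond_pos; exact Pm).
  exists (mkposreal _ Pr); simpl; intros u v Hu Hv.
  destruct (C3 u v ltac:(lra) ltac:(lra)) as [Hu' Hv'].
  assert (Z1 : Rabs (f (x - e') v - f (x - e') y) < m).
  { apply C1; [|lra]. unfold Rminus at 1; rewrite Rplus_opp_r, Rabs_R0; apply cond_pos. }
  assert (Z2 : Rabs (f (x + e') v - f (x + e') y) < m).
  { apply C2; [|lra]. unfold Rminus at 1; rewrite Rplus_opp_r, Rabs_R0; apply cond_pos. }
  apply Rabs_def2 in Z1; apply Rabs_def2 in Z2.
  assert (Zu : Rabs (u - s) < m) by lra; apply Rabs_def2 in Zu.
  destruct (Hxi u v Hu' Hv') as [A' B'].
  assert (K1 : f (x - e') v < f (xi u v) v) by (unfold m in *; lra).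
  assert (K2 : f (xi u v) v < f (x + e') v) by (unfold m in *; lra).
  assert (J1 : x - e' < xi u v).
  { destruct (Rlt_or_le (x - e') (xi u v)) as [L|[L|E]]; [exact L| |rewrite E in K1; lra].
    assert (X := implicit_increasing (xi u v) (x - e') v ltac:(lra) L1 Hv' L); lra. }
  assert (J2 : xi u v < x + e').
  { destruct (Rlt_or_le (xi u v) (x + e')) as [L|[L|E]]; [exact L| |rewrite E in K2; lra].
    assert (X := implicit_increasing (x + e') (xi u v) v L2 ltac:(lra) Hv' L); lra. }
  apply Rabs_def1; unfold e' in *; lra.
Qed.

Lemma implicit_partials s y : Rabs (s - s0) < epsilon -> Rabs (y - y0) < epsilon ->
  is_derive (fun z => xi z y) s (/ dx f (xi s y) y) /\
  is_derive (fun z => xi s z) y (-1 * (dy f (xi s y) y * / dx f (xi s y) y)).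
Proof.
  intros Hs Hy; destruct (Hxi s y Hs Hy) as [A B].
  destruct (Hf (xi s y) y ltac:(lra) Hy) as [Sf Pf].
  assert (HP : locally_2d (partials_exist f) (xi s y) y).
  { generalize (sm_nested _ _ _ Sf); apply locally_2d_mono; intros u v; apply sm_partials. }
  assert (HC := sm_continuous _ _ _ (sm_dx _ _ _ Sf)).
  assert (C := implicit_continuous s y Hs Hy).
  assert (L := implicit_box s y Hs Hy).
  assert (N : dx f (xi s y) y <> 0) by lra.
  assert (H1d : forall h t, (forall e : posreal, locally t (fun u => Rabs (h u - h t) < e)) ->
            continuity_pt h t) by (intros h t X; apply continuity_pt_locally; exact X).
  split.
  - replace (/ dx f (xi s y) y) with ((1 - dy f (xi s y) y * 0) / dx f (xi s y) y)
      by (field; exact N).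
    apply (implicit_derive f (fun z => xi z y) (fun _ => y)); try assumption.
    + apply H1d; intros e; exact (locally_2d_1d_const_y _ _ _ (C e)).
    + apply is_derive_cst.
    + apply is_derive_ext_loc with (fun t => t); [|exact (is_derive_id s)].
      generalize (locally_2d_1d_const_y _ _ _ L); apply filter_imp; intros t [T1 T2].
      symmetry; apply Hxi; assumption.
  - replace (-1 * (dy f (xi s y) y * / dx f (xi s y) y))
      with ((0 - dy f (xi s y) y * 1) / dx f (xi s y) y) by (field; exact N).
    apply (implicit_derive f (fun z => xi s z) (fun z => z)); try assumption.
    + apply H1d; intros e; exact (locally_2d_1d_const_x _ _ _ (C e)).
    + exact (is_derive_id y).
    + apply is_derive_ext_loc with (fun t => s); [|apply is_derive_cst].
      generalize (locally_2d_1d_const_x _ _ _ L); apply filter_imp; intros t [T1 T2].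
      symmetry; apply Hxi; assumption.
Qed.

(** The partial derivatives of the implicit function are smooth functions of the
    implicit function itself, so each order of differentiability yields the next. *)
Lemma implicit_smooth s y : Rabs (s - s0) < epsilon -> Rabs (y - y0) < epsilon -> sm xi s y.
Proof.
  intros Hs Hy.
  assert (X : forall n s y, Rabs (s - s0) < epsilon -> Rabs (y - y0) < epsilon ->
                            Cnear n xi s y).
  { clear s y Hs Hy; induction n as [|n IH]; intros s y Hs Hy; assert (L := implicit_box s y Hs Hy).
    - apply Cnear_0; revert L; apply locally_2d_mono; intros u v [A B].
      apply implicit_continuous; assumption.
    - destruct (Hxi s y Hs Hy) as [A B]; destruct (Hf (xi s y) y ltac:(lra) Hy) as [Sf Pf].
      assert (Ix := Cnear_comp n (dx f) xi (fun _ v => v) s y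
                      (sm_at _ _ _ (sm_dx _ _ _ Sf) n) (IH s y Hs Hy) (Cnear_snd n s y)).
      assert (Iy := Cnear_comp n (dy f) xi (fun _ v => v) s y
                      (sm_at _ _ _ (sm_dy _ _ _ Sf) n) (IH s y Hs Hy) (Cnear_snd n s y)).
      apply Cnear_inv in Ix; [|lra].
      apply Cnear_S; split; [|split].
      + revert L; apply locally_2d_mono; intros u v [U V].
        destruct (implicit_partials u v U V) as [D1 D2]; repeat split.
        * apply implicit_continuous; assumption.
        * eexists; exact D1.
        * eexists; exact D2.
      + apply Cnear_ext with (2 := Ix); revert L; apply locally_2d_mono; intros u v [U V].
        symmetry; exact (is_derive_unique _ _ _ (proj1 (implicit_partials u v U V))).
      + apply Cnear_ext
          with (2 := Cnear_mult _ _ _ _ _ (Cnear_const n (-1) s y) (Cnear_mult _ _ _ _ _ Iy Ix)).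
        revert L; apply locally_2d_mono; intros u v [U V].
        symmetry; exact (is_derive_unique _ _ _ (proj2 (implicit_partials u v U V))). }
  apply sm_Cnear; generalize (implicit_box s y Hs Hy); apply locally_2d_mono.
  intros u v [A B] n; apply X; assumption.
Qed.

End Implicit.

Lemma implicit_function_pos f x0 y0 (U : R -> R -> Prop) :
  sm f x0 y0 -> 0 < dx f x0 y0 -> locally_2d U x0 y0 ->
  exists delta epsilon xi, 0 < delta /\ 0 < epsilon /\
    (forall x y, Rabs (x - x0) < delta -> Rabs (y - y0) < epsilon -> U x y) /\
    (forall s y, Rabs (s - f x0 y0) < epsilon -> Rabs (y - y0) < epsilon ->
       Rabs (xi s y - x0) < delta /\ f (xi s y) y = s /\ sm xi s y) /\
    (forall x y, Rabs (x - x0) < delta -> Rabs (y - y0) < epsilon ->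
       Rabs (f x y - f x0 y0) < epsilon -> xi (f x y) y = x).
Proof.
  intros Sf Pf HU.
  destruct (sm_continuous _ _ _ (sm_dx _ _ _ Sf) (mkposreal _ Pf)) as [d1 H1].
  destruct (sm_nested _ _ _ Sf) as [d2 H2]; destruct HU as [d3 H3]; simpl in *.
  set (D := Rmin d1 (Rmin d2 d3)).
  assert (PD : 0 < D) by (repeat apply Rmin_pos; apply cond_pos).
  assert (B1 := Rmin_l d1 (Rmin d2 d3)); assert (B2 := Rmin_r d1 (Rmin d2 d3)).
  assert (B3 := Rmin_l d2 d3); assert (B4 := Rmin_r d2 d3); fold D in B1, B2.
  assert (HD : forall x y, Rabs (x - x0) < D -> Rabs (y - y0) < D ->
             U x y /\ sm f x y /\ 0 < dx f x y).
  { intros x y Hx Hy; split; [apply H3; lra|split; [apply H2; lra|]].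
    assert (X := Rabs_def2 _ _ (H1 x y ltac:(lra) ltac:(lra))); lra. }
  (* half of D, so that the closed interval of radius delta stays in the domain *)
  set (delta := D / 2).
  assert (Inc : forall x1 x2 y, Rabs (x1 - x0) <= delta -> Rabs (x2 - x0) <= delta ->
              Rabs (y - y0) < D -> x1 < x2 -> f x1 y < f x2 y).
  { intros x1 x2 y K1 K2 Ky; apply (implicit_increasing f x0 y0 delta D); try assumption.
    intros x y' Kx Ky'; apply HD; [unfold delta in *; lra|exact Ky']. }
  assert (L1 : Rabs (x0 - delta - x0) <= delta).
  { apply Rabs_le_between; unfold delta; lra. }
  assert (L2 : Rabs (x0 + delta - x0) <= delta).
  { apply Rabs_le_between; unfold delta; lra. }
  assert (L0 : Rabs (x0 - x0) <= delta).
  { apply Rabs_le_between; unfold delta; lra. }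
  assert (Ly : Rabs (y0 - y0) < D) by (apply Rabs_def1; lra).
  assert (I1 := Inc _ _ y0 L1 L0 Ly ltac:(unfold delta; lra)).
  assert (I2 := Inc _ _ y0 L0 L2 Ly ltac:(unfold delta; lra)).
  set (m := Rmin (f x0 y0 - f (x0 - delta) y0) (f (x0 + delta) y0 - f x0 y0) / 2).
  assert (M1 := Rmin_l (f x0 y0 - f (x0 - delta) y0) (f (x0 + delta) y0 - f x0 y0)).
  assert (M2 := Rmin_r (f x0 y0 - f (x0 - delta) y0) (f (x0 + delta) y0 - f x0 y0)).
  assert (Pm : 0 < m) by (apply Rdiv_lt_0_compat; [apply Rmin_pos; lra|lra]).
  destruct (HD (x0 - delta) y0 ltac:(unfold delta in *; lra) Ly) as (_ & S1 & _).
  destruct (HD (x0 + delta) y0 ltac:(unfold delta in *; lra) Ly) as (_ & S2 & _).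
  destruct (sm_continuous _ _ _ S1 (mkposreal _ Pm)) as [r1 C1].
  destruct (sm_continuous _ _ _ S2 (mkposreal _ Pm)) as [r2 C2]; simpl in *.
  set (epsilon := Rmin (Rmin r1 r2) (Rmin D m)).
  assert (R1 := Rmin_l (Rmin r1 r2) (Rmin D m)); fold epsilon in R1.
  assert (R2 := Rmin_r (Rmin r1 r2) (Rmin D m)); fold epsilon in R2.
  assert (R3 := Rmin_l r1 r2); assert (R4 := Rmin_r r1 r2).
  assert (R5 := Rmin_l D m); assert (R6 := Rmin_r D m).
  assert (Pe : 0 < epsilon) by (repeat apply Rmin_pos; try apply cond_pos; assumption).
  set (xi := fun s y => ClassicalEpsilon.epsilon (inhabits 0)
    (fun x => Rabs (x - x0) < delta /\ f x y = s)).
  assert (Hxi : forall s y, Rabs (s - f x0 y0) < epsilon -> Rabs (y - y0) < epsilon ->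
       Rabs (xi s y - x0) < delta /\ f (xi s y) y = s).
  { intros s y Hs Hy; unfold xi; apply epsilon_spec.
    assert (Z1 : Rabs (f (x0 - delta) y - f (x0 - delta) y0) < m).
    { apply C1; [|lra]. unfold Rminus at 1; rewrite Rplus_opp_r, Rabs_R0; apply cond_pos. }
    assert (Z2 : Rabs (f (x0 + delta) y - f (x0 + delta) y0) < m).
    { apply C2; [|lra]. unfold Rminus at 1; rewrite Rplus_opp_r, Rabs_R0; apply cond_pos. }
    apply Rabs_def2 in Z1; apply Rabs_def2 in Z2; apply Rabs_def2 in Hs.
    destruct (intermediate_value (fun x => f x y) (x0 - delta) (x0 + delta) s) as (x & Hx & E).
    - unfold delta; lra.
    - intros x Hx.
      assert (Kx : Rabs (x - x0) < D) by (apply Rabs_def1; unfold delta in *; lra).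
      destruct (HD x y Kx ltac:(lra)) as (_ & S & _).
      apply continuity_pt_locally; intros e.
      exact (locally_2d_1d_const_y _ _ _ (sm_continuous _ _ _ S e)).
    - unfold m in *; lra.
    - exists x; split; [apply Rabs_def1; lra|exact E]. }
  assert (Hf : forall x y, Rabs (x - x0) <= delta -> Rabs (y - y0) < epsilon ->
             sm f x y /\ 0 < dx f x y).
  { intros x y Hx Hy; apply HD; unfold delta in *; lra. }
  exists delta, epsilon, xi; split; [unfold delta; lra|split; [exact Pe|split; [|split]]].
  - intros x y Hx Hy; apply HD; unfold delta in *; lra.
  - intros s y Hs Hy; destruct (Hxi s y Hs Hy) as [A B]; repeat split; try assumption.
    exact (implicit_smooth f x0 y0 delta epsilon xi Hf Hxi s y Hs Hy).
  - exact (implicit_unique f x0 y0 delta epsilon xi Hf Hxi).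
Qed.

(** The sign of the derivative is normalised by passing to - f. *)
Lemma implicit_function f x0 y0 (U : R -> R -> Prop) :
  sm f x0 y0 -> dx f x0 y0 <> 0 -> locally_2d U x0 y0 ->
  exists delta epsilon xi, 0 < delta /\ 0 < epsilon /\
    (forall x y, Rabs (x - x0) < delta -> Rabs (y - y0) < epsilon -> U x y) /\
    (forall s y, Rabs (s - f x0 y0) < epsilon -> Rabs (y - y0) < epsilon ->
       Rabs (xi s y - x0) < delta /\ f (xi s y) y = s /\ sm xi s y) /\
    (forall x y, Rabs (x - x0) < delta -> Rabs (y - y0) < epsilon ->
       Rabs (f x y - f x0 y0) < epsilon -> xi (f x y) y = x).
Proof.
  intros Sf Nf HU; destruct (Rdichotomy _ _ Nf) as [L|G].
  - assert (Sf' := sm_mult _ _ _ _ (sm_const (-1) x0 y0) Sf).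
    assert (D : dx (fun u v => -1 * f u v) x0 y0 = -1 * dx f x0 y0) by exact (Derive_scal _ _ _).
    destruct (implicit_function_pos _ x0 y0 U Sf' ltac:(lra) HU)
      as (delta & epsilon & xi & H1 & H2 & H3 & H4 & H5).
    assert (Opp : forall a b, Rabs (-1 * a - -1 * b) = Rabs (a - b)).
    { intros a b; replace (-1 * a - -1 * b) with (- (a - b)) by ring; apply Rabs_Ropp. }
    exists delta, epsilon, (fun s y => xi (-1 * s) y); repeat (split; [assumption|]); split.
    + intros s y Hs Hy; destruct (H4 (-1 * s) y) as (A & B & C); [|exact Hy|].
      * rewrite Opp; exact Hs.
      * split; [exact A|split; [lra|]].
        apply (sm_comp xi (fun s _ => -1 * s) (fun _ y => y)); [exact C| |apply sm_snd].
        apply sm_mult; [apply sm_const|apply sm_fst].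
    + intros x y Hx Hy Hs; apply H5; try assumption; rewrite Opp; exact Hs.
  - apply implicit_function_pos; assumption.
Qed.


(** * Charts of the maximal atlas with prescribed coordinates *)

Section Charts.
Context {S : surface}.
Implicit Types (c d : chart S) (f h : S -> R) (p q : S) (P Q : S -> Prop) (i j k : axis).

(** Maximality of the atlas makes this a criterion for new charts: smooth
    transition functions to and from one chart of the atlas compose with those
    of every other chart. *)
Lemma atlas_criterion c c' : atlas c ->
  (forall q, dom c' q -> dom c q /\ near q (dom c') /\ (forall k, smooth q (coord c' k)) /\
     forall k, sm (pull c' (coord c k)) (coord c' e1 q) (coord c' e2 q)) ->
  atlas c'.
Proof.
  intros Ac H; apply atlas_maximal; intros d Ad.
  assert (T : forall x y, overlap c' d x y ->
    locally_2d (overlap c' d) x y /\ forall k, sm (pull c' (coord d k)) x y).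
  { intros x y [Hxy Hd]; destruct (cinv_dom _ _ _ Hxy) as (D & E1 & E2).
    set (q := cinv c' x y) in *.
    destruct (H q D) as (Dc & _ & _ & Sc); rewrite E1, E2 in Sc.
    assert (I := cimg_near c' q D); rewrite E1, E2 in I.
    assert (B : locally_2d (fun x' y' => cinv c' x' y' =
        cinv c (pull c' (coord c e1) x' y') (pull c' (coord c e2) x' y')) x y).
    { revert I; apply locally_2d_mono; intros u v Huv; unfold pull.
      rewrite cinvK; [reflexivity|].
      exact (proj1 (H _ (proj1 (cinv_dom _ _ _ Huv)))). }
    assert (ND := near_in c q _ Ac Dc (near_dom d q Ad Hd)).
    assert (ND' : locally_2d (fun x' y' =>
        dom d (cinv c (pull c' (coord c e1) x' y') (pull c' (coord c e2) x' y'))) x y).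
    { apply (locally_2d_comp (fun a b => dom d (cinv c a b)));
        [apply sm_continuous, Sc|apply sm_continuous, Sc|exact ND]. }
    split.
    - generalize (locally_2d_and _ _ _ _ I (locally_2d_and _ _ _ _ B ND')).
      apply locally_2d_mono; intros u v (A1 & A2 & A3); split; [exact A1|].
      rewrite A2; exact A3.
    - intros k.
      apply sm_ext with (fun x' y' =>
        pull c (coord d k) (pull c' (coord c e1) x' y') (pull c' (coord c e2) x' y')).
      + revert B; apply locally_2d_mono; intros u v B; unfold pull in *; rewrite <- B; reflexivity.
      + apply (sm_comp (pull c (coord d k))); [|apply Sc|apply Sc].
        exact (smooth_coord d k q Ad Hd c Ac Dc). }
  split; split.
  - intros x y V; apply T, V.
  - intros k; apply smooth_on_of_sm; intros x y V; apply T, V.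
  - intros x y [Hxy D]; destruct (cinv_dom _ _ _ Hxy) as (Dd & E1 & E2).
    destruct (H _ D) as (_ & N & _ & _); generalize (N d Ad Dd); rewrite E1, E2.
    apply locally_2d_mono; intros u v [A B]; split; assumption.
  - intros k; apply smooth_on_of_sm; intros x y [Hxy D].
    destruct (cinv_dom _ _ _ Hxy) as (Dd & E1 & E2).
    destruct (H _ D) as (_ & _ & Sm & _); generalize (Sm k d Ad Dd); rewrite E1, E2; auto.
Qed.

Definition other (k : axis) : axis := match k with e1 => e2 | e2 => e1 end.

Lemma swap_chart c : atlas c ->
  exists c', atlas c' /\ (forall q, dom c' q <-> dom c q) /\
    (forall k q, coord c' k q = coord c (other k) q) /\
    (forall x y, cimg c' x y <-> cimg c y x).
Proof.
  intros Ac.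
  assert (K : forall p, dom c p -> cinv c (coord c e1 p) (coord c e2 p) = p)
    by (intros p; apply cinvK).
  assert (O : open2 (fun x y => exists p, dom c p /\ coord c e2 p = x /\ coord c e1 p = y)).
  { intros x y (p & Hp & E2 & E1).
    destruct (cimg_open (c := c) (ex_intro _ p (conj Hp (conj E1 E2)))) as [r Hr].
    exists r; intros u v Hu Hv; destruct (Hr v u Hv Hu) as (q & Hq & <- & <-).
    exists q; auto. }
  set (c' := @Chart S (dom c) (fun k => coord c (other k)) (fun x y => cinv c y x) K O).
  exists c'; split; [|split; [|split]].
  - apply (atlas_criterion c c' Ac); simpl; intros q Hq.
    split; [exact Hq|split; [exact (near_dom c q Ac Hq)|split]].
    + intros k; apply smooth_coord; assumption.
    + intros k.
      apply sm_ext with (fun x y => match k with e1 => y | e2 => x end).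
      * generalize (cimg_near c q Hq); intros [r Hr]; exists r; intros u v Hu Hv.
        destruct (cinv_dom _ _ _ (Hr v u Hv Hu)) as (_ & E1 & E2).
        unfold pull; simpl; destruct k; auto.
      * destruct k; [apply sm_snd|apply sm_fst].
  - intros q; reflexivity.
  - intros k q; reflexivity.
  - intros x y; split; intros (p & Hp & E1 & E2); exists p; auto.
Qed.

(** A function with nonzero first partial derivative can replace the first
    coordinate; the inverse of the new chart is the implicit function. *)
Lemma replace_coordinate c p f P : atlas c -> dom c p -> smooth p f ->
  pd c e1 f p <> 0 -> near p P ->
  exists c', atlas c' /\ dom c' p /\
    (forall q, dom c' q -> dom c q /\ P q /\ coord c' e1 q = f q /\
                           coord c' e2 q = coord c e2 q) /\
    exists eps, 0 < eps /\ forall x y, cimg c' x y <->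
      Rabs (x - f p) < eps /\ Rabs (y - coord c e2 p) < eps.
Proof.
  intros Ac Hc Sf Nf HP.
  set (x0 := coord c e1 p); set (y0 := coord c e2 p).
  assert (E0 : pull c f x0 y0 = f p) by (unfold pull, x0, y0; rewrite (cinvK Hc); reflexivity).
  assert (HU := near_and _ _ _ HP (smooth_nested p f Sf) c Ac Hc).
  destruct (implicit_function (pull c f) x0 y0 _ (Sf c Ac Hc) Nf HU)
    as (delta & eps & xi & Pd & Pe & H3 & H4 & H5); rewrite E0 in *.
  set (dom' := fun q => dom c q /\ Rabs (coord c e1 q - x0) < delta /\
      Rabs (coord c e2 q - y0) < eps /\ Rabs (f q - f p) < eps).
  set (coord' := fun k q => match k with e1 => f q | e2 => coord c e2 q end).
  set (cinv' := fun s y => cinv c (xi s y) y).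
  assert (K : forall q, dom' q -> cinv' (coord' e1 q) (coord' e2 q) = q).
  { intros q (D & B1 & B2 & B3); unfold cinv', coord'.
    assert (E : pull c f (coord c e1 q) (coord c e2 q) = f q)
      by (unfold pull; rewrite (cinvK D); reflexivity).
    rewrite <- E, H5; [apply cinvK, D|exact B1|exact B2|rewrite E; exact B3]. }
  assert (I : forall x y, (exists q, dom' q /\ coord' e1 q = x /\ coord' e2 q = y) <->
            Rabs (x - f p) < eps /\ Rabs (y - y0) < eps).
  { intros x y; split.
    - intros (q & (D & B1 & B2 & B3) & <- & <-); split; assumption.
    - intros [B1 B2]; destruct (H4 x y B1 B2) as (A1 & A2 & A3).
      destruct (H3 _ _ A1 B2) as [G _]; destruct (cinv_dom _ _ _ G) as (D & C1 & C2).
      exists (cinv c (xi x y) y); unfold dom', coord'; rewrite C1, C2.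
      unfold pull in A2; rewrite A2; auto. }
  assert (O : open2 (fun x y => exists q, dom' q /\ coord' e1 q = x /\ coord' e2 q = y)).
  { intros x y Hxy; apply I in Hxy; destruct Hxy as [B1 B2].
    generalize (implicit_box (fun _ _ => f p) 0 y0 eps x y B1 B2); apply locally_2d_mono.
    intros u v B; apply I, B. }
  set (c' := @Chart S dom' coord' cinv' K O).
  assert (Dp : dom' p).
  { unfold dom', x0, y0; unfold Rminus; rewrite !Rplus_opp_r, Rabs_R0; auto. }
  exists c'; split; [|split; [exact Dp|split]].
  - apply (atlas_criterion c c' Ac); simpl; intros q Dq.
    assert (Dq' := Dq); destruct Dq' as (D & B1 & B2 & B3).
    destruct (H3 _ _ B1 B2) as [_ [_ Sq]]; rewrite (cinvK D) in Sq.
    split; [exact D|split; [|split]].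
    + apply (near_intro c q _ Ac D).
      assert (L : forall F a r x y, sm F x y -> Rabs (F x y - a) < r ->
                locally_2d (fun u v => Rabs (F u v - a) < r) x y).
      { intros F a r x y HF Hr.
        assert (Pr : 0 < r - Rabs (F x y - a)) by lra.
        generalize (sm_continuous _ _ _ HF (mkposreal _ Pr)); apply locally_2d_mono; simpl.
        intros u v Huv; replace (F u v - a) with (F u v - F x y + (F x y - a)) by ring.
        eapply Rle_lt_trans; [apply Rabs_triang|lra]. }
      assert (L3 := L (pull c f) (f p) eps _ _ (Sq c Ac D)).
      unfold pull at 1 in L3; rewrite (cinvK D) in L3.
      generalize (locally_2d_and _ _ _ _ (L _ _ _ _ _ (sm_fst _ _) B1)
        (locally_2d_and _ _ _ _ (L _ _ _ _ _ (sm_snd _ _) B2) (L3 B3))).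
      apply locally_2d_mono; intros u v (A1 & A2 & A3) Huv.
      destruct (cinv_dom _ _ _ Huv) as (D' & C1 & C2).
      unfold dom'; rewrite C1, C2; auto.
    + intros [|]; [exact Sq|apply smooth_coord; assumption].
    + assert (G := implicit_box (fun _ _ => f p) 0 y0 eps (f q) (coord c e2 q) B3 B2).
      assert (G' : locally_2d (fun s y => coord c e1 (cinv' s y) = xi s y /\
                     coord c e2 (cinv' s y) = y) (f q) (coord c e2 q)).
      { revert G; apply locally_2d_mono; intros s y [A1 A2].
        destruct (H4 s y A1 A2) as (A3 & _ & _); destruct (H3 _ _ A3 A2) as [G _].
        exact (proj2 (cinv_dom _ _ _ G)). }
      intros [|].
      * apply sm_ext with xi; [|apply H4; assumption].
        revert G'; apply locally_2d_mono; intros s y [A _]; symmetry; exact A.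
      * apply sm_ext with (fun _ y => y); [|apply sm_snd].
        revert G'; apply locally_2d_mono; intros s y [_ A]; symmetry; exact A.
  - simpl; intros q (D & B1 & B2 & B3).
    destruct (H3 _ _ B1 B2) as [_ [Pq _]]; rewrite (cinvK D) in Pq; auto.
  - exists eps; split; [exact Pe|exact I].
Qed.

(** Replace the first coordinate by U, exchange the coordinates, replace the first
    one by V and exchange them again. *)
Lemma coordinates_of_independent c p (U V : S -> R) P : atlas c -> dom c p ->
  smooth p U -> smooth p V ->
  pd c e1 U p * pd c e2 V p - pd c e2 U p * pd c e1 V p <> 0 -> near p P ->
  exists d, atlas d /\ dom d p /\
    (forall q, dom d q -> P q /\ coord d e1 q = U q /\ coord d e2 q = V q) /\
    exists eps, 0 < eps /\ forall x y, cimg d x y <->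
      Rabs (x - U p) < eps /\ Rabs (y - V p) < eps.
Proof.
  (* up to exchanging the coordinates of c, the first partial of U does not vanish *)
  intros Ac0 Hc0 SU SV N0 HP.
  assert (W : exists c, atlas c /\ dom c p /\ pd c e1 U p <> 0 /\
    pd c e1 U p * pd c e2 V p - pd c e2 U p * pd c e1 V p <> 0).
  { destruct (Req_dec (pd c e1 U p) 0) as [E|N]; [|exists c; auto].
    destruct (swap_chart c Ac0) as (c' & Ac' & Dc' & Cc' & _).
    assert (Hc' : dom c' p) by (apply Dc', Hc0).
    assert (X : forall i f, smooth p f -> pd c' i f p = pd c (other i) f p).
    { intros i f Sf; rewrite (pd_chain c' c i f p Ac' Ac0 Hc' Hc0 Sf).
      assert (Y : forall k, pd c' i (coord c k) p = coord_field i (other k) p).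
      { intros k; rewrite <- (pd_coord c' i (other k) p Hc').
        apply (pd_ext c' i _ _ p Ac' Hc'), near_all; intros q; rewrite Cc'.
        destruct k; reflexivity. }
      unfold sum2; rewrite !Y; destruct i; unfold coord_field; simpl; ring. }
    exists c'; split; [exact Ac'|split; [exact Hc'|]].
    rewrite !X by assumption; cbn [other]; split; [|intros E'; apply N0; lra].
    intros E'; apply N0; rewrite E, E'; ring. }
  destruct W as (a & Aa & Ha & NU & N).
  destruct (replace_coordinate a p U P Aa Ha SU NU HP) as (b & Ab & Hb & Bb & _).
  assert (NV : pd b e2 V p <> 0).
  { intros E; apply N.
    assert (Y1 : forall i, pd a i (coord b e1) p = pd a i U p).
    { intros i; apply (pd_ext a i _ _ p Aa Ha); generalize (near_dom b p Ab Hb).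
      apply near_mono; intros q Hq; apply Bb, Hq. }
    rewrite !(fun i => pd_chain a b i V p Aa Ab Ha Hb SV); unfold sum2.
    rewrite E, !Y1; ring. }
  destruct (swap_chart b Ab) as (b' & Ab' & Db' & Cb' & _).
  assert (Hb' : dom b' p) by (apply Db', Hb).
  assert (NV' : pd b' e1 V p <> 0).
  { intros E; apply NV; rewrite (pd_chain b b' e2 V p Ab Ab' Hb Hb' SV).
    assert (Y : pd b e2 (coord b' e2) p = 0).
    { transitivity (pd b e2 (coord b e1) p); [|rewrite pd_coord by assumption; reflexivity].
      apply (pd_ext b e2 _ _ p Ab Hb), near_all; intros q; apply Cb'. }
    unfold sum2; rewrite E, Y; ring. }
  destruct (replace_coordinate b' p V (fun _ => True) Ab' Hb' SV NV' (near_all p _ (fun _ => I)))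
    as (e & Ae & He & Be & eps & Pe & Ie).
  destruct (swap_chart e Ae) as (d & Ad & Dd & Cd & Id).
  exists d; split; [exact Ad|split; [apply Dd, He|split]].
  - intros q Hq; apply Dd in Hq; destruct (Be q Hq) as (G1 & _ & G2 & G3).
    apply Db' in G1; destruct (Bb q G1) as (_ & G4 & G5 & _).
    rewrite !Cd; simpl; rewrite G2, G3, Cb'; simpl; auto.
  - exists eps; split; [exact Pe|]; intros x y; rewrite Id, Ie, Cb'; simpl.
    destruct (Bb p Hb) as (_ & _ & -> & _); tauto.
Qed.

End Charts.


(** * Primitives of closed forms, and the ordinary differential equation *)

Lemma is_derive_RInt_upper (D : R -> Prop) (h : R -> R) c t :
  (forall s, D s -> locally s D) ->
  (forall s x, D s -> Rmin c s <= x <= Rmax c s -> D x) ->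
  (forall s, D s -> continuous h s) -> D t ->
  is_derive (fun s => RInt h c s) t (h t).
Proof.
  intros HO HI HC Ht; apply (is_derive_RInt h (fun s => RInt h c s) c t); [|apply HC, Ht].
  generalize (HO t Ht); apply filter_imp; intros s Hs.
  apply (@RInt_correct R_CompleteNormedModule), (@ex_RInt_continuous R_CompleteNormedModule).
  intros x Hx; apply HC, (HI s); assumption.
Qed.

Lemma open_ball1 c r s : Rabs (s - c) < r -> locally s (fun x => Rabs (x - c) < r).
Proof.
  intros H; assert (P : 0 < r - Rabs (s - c)) by lra.
  exists (mkposreal _ P); intros x Hx; change (Rabs (x - s) < r - Rabs (s - c)) in Hx.
  replace (x - c) with (x - s + (s - c)) by ring.
  eapply Rle_lt_trans; [apply Rabs_triang|lra].
Qed.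

Lemma continuous_slice_x f x y : continuity_2d_pt f x y -> continuous (fun t => f t y) x.
Proof.
  intros H; apply continuity_pt_filterlim, continuity_pt_locally; intros e.
  exact (locally_2d_1d_const_y _ _ _ (H e)).
Qed.

Lemma continuous_slice_y f x y : continuity_2d_pt f x y -> continuous (fun t => f x t) y.
Proof.
  intros H; apply continuity_pt_filterlim, continuity_pt_locally; intros e.
  exact (locally_2d_1d_const_x _ _ _ (H e)).
Qed.

(** Integrate along the horizontal line through the centre and then vertically;
    closedness lets the horizontal derivative pass under the integral sign and
    telescope. *)
Lemma poincare (a b : R -> R -> R) x0 y0 r :
  (forall x y, Rabs (x - x0) < r -> Rabs (y - y0) < r ->
     sm a x y /\ sm b x y /\ dy a x y = dx b x y) ->
  exists v, forall x y, Rabs (x - x0) < r -> Rabs (y - y0) < r ->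
    dx v x y = a x y /\ dy v x y = b x y /\ sm v x y.
Proof.
  intros H.
  assert (HI : forall c s x, Rabs (s - c) < r -> Rmin c s <= x <= Rmax c s -> Rabs (x - c) < r).
  { intros c s x Hs Hx; assert (B := Rabs_between _ _ _ Hx); lra. }
  set (v := fun x y => RInt (fun s => a s y0) x0 x + RInt (fun t => b x t) y0 y).
  assert (Dv : forall x y, Rabs (x - x0) < r -> Rabs (y - y0) < r ->
    is_derive (fun z => v z y) x (a x y) /\ is_derive (fun z => v x z) y (b x y)).
  { intros x y Hx Hy.
    assert (H0 : Rabs (y0 - y0) < r).
    { unfold Rminus; rewrite Rplus_opp_r, Rabs_R0; assert (Z := Rabs_pos (x - x0)); lra. }
    split; unfold v.
    - assert (D1 : is_derive (fun z => RInt (fun s => a s y0) x0 z) x (a x y0)).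
      { apply (is_derive_RInt_upper (fun s => Rabs (s - x0) < r) (fun s => a s y0));
          [apply open_ball1|intros; eapply HI; eassumption| |exact Hx].
        intros s Hs; apply continuous_slice_x, sm_continuous, H; assumption. }
      assert (D2 : is_derive (fun z => RInt (fun t => b z t) y0 y) x
                     (RInt (fun t => Derive (fun u => b u t) x) y0 y)).
      { apply is_derive_RInt_param.
        - generalize (open_ball1 _ _ _ Hx); apply filter_imp; intros z Hz t Ht.
          destruct (H z t Hz (HI _ _ _ Hy Ht)) as (_ & Sb & _).
          destruct (sm_partials _ _ _ Sb) as (_ & E & _); exact E.
        - intros t Ht; destruct (H x t Hx (HI _ _ _ Hy Ht)) as (_ & Sb & _).
          exact (sm_continuous _ _ _ (sm_dx _ _ _ Sb)).
        - generalize (open_ball1 _ _ _ Hx); apply filter_imp; intros z Hz.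
          apply (@ex_RInt_continuous R_CompleteNormedModule); intros t Ht.
          apply continuous_slice_y, sm_continuous.
          destruct (H z t Hz (HI _ _ _ Hy Ht)) as (_ & Sb & _); exact Sb. }
      assert (E : RInt (fun t => Derive (fun u => b u t) x) y0 y = a x y - a x y0).
      { rewrite <- (RInt_Derive (fun t => a x t) y0 y).
        - apply RInt_ext; intros t Ht.
          destruct (H x t Hx (HI y0 y t Hy ltac:(lra))) as (_ & _ & E); symmetry; exact E.
        - intros t Ht; destruct (H x t Hx (HI _ _ _ Hy Ht)) as (Sa & _ & _).
          destruct (sm_partials _ _ _ Sa) as (_ & _ & E); exact E.
        - intros t Ht; destruct (H x t Hx (HI _ _ _ Hy Ht)) as (Sa & _ & _).
          exact (continuous_slice_y _ _ _ (sm_continuous _ _ _ (sm_dy _ _ _ Sa))). }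
      rewrite E in D2.
      replace (a x y) with (a x y0 + (a x y - a x y0)) by ring.
      exact (is_derive_plus _ _ _ _ _ D1 D2).
    - replace (b x y) with (0 + b x y) by ring.
      apply (is_derive_plus (fun _ => RInt (fun s => a s y0) x0 x)); [apply is_derive_cst|].
      apply (is_derive_RInt_upper (fun s => Rabs (s - y0) < r) (fun s => b x s));
        [apply open_ball1|intros; eapply HI; eassumption| |exact Hy].
      intros s Hs; apply continuous_slice_y, sm_continuous, H; assumption. }
  assert (Bx : forall x y, Rabs (x - x0) < r -> Rabs (y - y0) < r ->
    locally_2d (fun x y => Rabs (x - x0) < r /\ Rabs (y - y0) < r) x y).
  { intros x y Hx Hy; exact (implicit_box (fun _ _ => x0) 0 y0 r x y Hx Hy). }
  assert (Cv : forall x y, Rabs (x - x0) < r -> Rabs (y - y0) < r -> continuity_2d_pt v x y).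
  { intros x y Hx Hy; apply differentiable_continuity_pt.
    exists (dx v x y), (dy v x y); apply differentiable_of_partials.
    - generalize (Bx x y Hx Hy); apply locally_2d_mono; intros s t [Hs Ht].
      exists (a s t); exact (proj1 (Dv s t Hs Ht)).
    - exists (b x y); exact (proj2 (Dv x y Hx Hy)).
    - apply continuity_2d_pt_ext_loc with a; [|apply sm_continuous, H; assumption].
      generalize (Bx x y Hx Hy); apply locally_2d_mono; intros s t [Hs Ht].
      symmetry; exact (is_derive_unique _ _ _ (proj1 (Dv s t Hs Ht))). }
  exists v; intros x y Hx Hy; destruct (Dv x y Hx Hy) as [D1 D2]; split; [|split].
  - exact (is_derive_unique _ _ _ D1).
  - exact (is_derive_unique _ _ _ D2).
  - apply sm_of_partials with a b; try apply H; try assumption.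
    generalize (Bx x y Hx Hy); apply locally_2d_mono; intros s t [Hs Ht].
    destruct (Dv s t Hs Ht); auto.
Qed.

Lemma constant_of_derive_0 (h : R -> R) c r :
  (forall s, Rabs (s - c) < r -> is_derive h s 0) ->
  forall s, Rabs (s - c) < r -> h s = h c.
Proof.
  intros H s Hs; destruct (MVT_gen h c s (fun _ => 0)) as (z & _ & E); [| |lra].
  - intros x Hx; apply H; assert (B := Rabs_between c s x ltac:(lra)); lra.
  - intros x Hx; assert (B := Rabs_between c s x Hx).
    apply derivable_continuous_pt; exists 0; apply is_derive_Reals, (H x ltac:(lra)).
Qed.

Lemma increasing_of_derive (h h' : R -> R) c r :
  (forall s, Rabs (s - c) < r -> is_derive h s (h' s) /\ 0 < h' s) ->
  forall s t, Rabs (s - c) < r -> Rabs (t - c) < r -> s < t -> h s < h t.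
Proof.
  intros H s t Hs Ht L; apply Rabs_def2 in Hs; apply Rabs_def2 in Ht.
  assert (B : forall x, s <= x <= t -> Rabs (x - c) < r)
    by (intros x Hx; apply Rabs_def1; lra).
  destruct (MVT_gen h s t h') as (z & Hz & E); rewrite ?Rmin_left, ?Rmax_right in * by lra.
  - intros x Hx; apply H, B; lra.
  - intros x Hx; apply derivable_continuous_pt; exists (h' x); exact (proj1 (is_derive_Reals _ _ _) (proj1 (H x (B x Hx)))).
  - assert (X := proj2 (H z (B z Hz))); nra.
Qed.

(** The end points are the bounds of the image in the extended real line. *)
Lemma increasing_image (h : R -> R) c r : 0 < r ->
  (forall s, Rabs (s - c) < r -> continuity_pt h s) ->
  (forall s t, Rabs (s - c) < r -> Rabs (t - c) < r -> s < t -> h s < h t) ->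
  exists lo hi : Rbar, forall t, Defs.open_interval lo hi t <-> exists s, Rabs (s - c) < r /\ h s = t.
Proof.
  intros Pr HC HM.
  set (E := fun t => exists s, Rabs (s - c) < r /\ h s = t).
  destruct (Glb_Rbar_correct E) as [GL GM]; destruct (Lub_Rbar_correct E) as [LU LM].
  exists (Glb_Rbar E), (Lub_Rbar E); intros t; split.
  - intros [L U].
    assert (A : exists s1, Rabs (s1 - c) < r /\ h s1 < t).
    { destruct (Classical_Prop.classic (exists s1, Rabs (s1 - c) < r /\ h s1 < t)) as [A|N];
        [exact A|exfalso].
      apply (Rbar_lt_not_le _ _ L), GM; intros x (s & Hs & <-); simpl.
      destruct (Rle_or_lt t (h s)) as [X|X]; [exact X|exfalso; apply N; exists s; auto]. }
    assert (B : exists s2, Rabs (s2 - c) < r /\ t < h s2).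
    { destruct (Classical_Prop.classic (exists s2, Rabs (s2 - c) < r /\ t < h s2)) as [B|N];
        [exact B|exfalso].
      apply (Rbar_lt_not_le _ _ U), LM; intros x (s & Hs & <-); simpl.
      destruct (Rle_or_lt (h s) t) as [X|X]; [exact X|exfalso; apply N; exists s; auto]. }
    destruct A as (s1 & H1 & A), B as (s2 & H2 & B).
    assert (L12 : s1 < s2).
    { destruct (Rlt_or_le s1 s2) as [X|[X|X]]; [exact X| |subst; lra].
      assert (Y := HM _ _ H2 H1 X); lra. }
    assert (H1' := Rabs_def2 _ _ H1); assert (H2' := Rabs_def2 _ _ H2).
    destruct (intermediate_value h s1 s2 t L12) as (s & Hs & Es); [|lra|].
    + intros x Hx; apply HC, Rabs_def1; lra.
    + exists s; split; [apply Rabs_def1; lra|exact Es].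
  - intros (s & Hs & <-).
    assert (Hs' := Rabs_def2 _ _ Hs).
    set (s1 := (s + (c - r)) / 2); set (s2 := (s + (c + r)) / 2).
    assert (H1 : Rabs (s1 - c) < r) by (apply Rabs_def1; unfold s1; lra).
    assert (H2 : Rabs (s2 - c) < r) by (apply Rabs_def1; unfold s2; lra).
    assert (M1 := HM s1 s H1 Hs ltac:(unfold s1; lra)).
    assert (M2 := HM s s2 Hs H2 ltac:(unfold s2; lra)).
    split.
    + apply Rbar_le_lt_trans with (h s1); [apply GL; exists s1; auto|exact M1].
    + apply Rbar_lt_le_trans with (h s2); [exact M2|apply LU; exists s2; auto].
Qed.

Lemma open_interval_locally (lo hi : Rbar) t :
  Defs.open_interval lo hi t -> locally t (Defs.open_interval lo hi).
Proof.
  intros [L U]; apply filter_and.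
  - exact (open_Rbar_gt lo t L).
  - exact (open_Rbar_lt hi t U).
Qed.

Lemma open_interval_between (lo hi : Rbar) s t x : Defs.open_interval lo hi s -> Defs.open_interval lo hi t ->
  Rmin s t <= x <= Rmax s t -> Defs.open_interval lo hi x.
Proof.
  intros [L1 U1] [L2 U2] [A B]; split.
  - apply Rbar_lt_le_trans with (Rmin s t); [|exact A].
    unfold Rmin; destruct (Rle_dec s t); assumption.
  - apply Rbar_le_lt_trans with (Rmax s t); [exact B|].
    unfold Rmax; destruct (Rle_dec s t); assumption.
Qed.

Lemma is_derive_radicand a b t : is_derive (radicand a b) t
  (- (2 * b / 9) * exp (- (2 / 3) * t) - 2 * exp (2 * t)).
Proof. unfold radicand; auto_derive; [exact I|field]. Qed.

Lemma is_derive_quadrature a b (lo hi : Rbar) phi0 t :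
  (forall s, Defs.open_interval lo hi s -> 0 < radicand a b s) ->
  Defs.open_interval lo hi phi0 -> Defs.open_interval lo hi t ->
  is_derive (fun s => RInt (fun tau => / sqrt (radicand a b tau)) phi0 s) t
    (/ sqrt (radicand a b t)).
Proof.
  intros HR H0 Ht.
  apply (is_derive_RInt_upper (Defs.open_interval lo hi) (fun tau => / sqrt (radicand a b tau))).
  - apply open_interval_locally.
  - intros s x Hs; apply open_interval_between; assumption.
  - intros s Hs; assert (Ps := HR s Hs); assert (Qs := sqrt_lt_R0 _ Ps).
    apply continuity_pt_filterlim, derivable_continuous_pt.
    eexists; apply is_derive_Reals.
    apply (is_derive_comp (fun z => / sqrt z) (radicand a b)); [|apply is_derive_radicand].
    auto_derive; [split; [exact Ps|split; [lra|exact I]]|reflexivity].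
  - exact Ht.
Qed.

(** The energy [Phi1^2 + exp (2 Phi) + 3 exp (-(2/3) Phi)] is a first integral of
    the second order equation, and its level is the constant [a]; the coefficient
    3 is - b / 3 for b = -9.  Separating variables gives the quadrature. *)
Lemma quadrature_of_ode (Phi Phi1 : R -> R) c r : 0 < r ->
  (forall s, Rabs (s - c) < r -> is_derive Phi s (Phi1 s) /\ 0 < Phi1 s) ->
  (forall s, Rabs (s - c) < r ->
     is_derive Phi1 s (exp (- (2 / 3) * Phi s) - exp (2 * Phi s))) ->
  exists (a : R) (lo hi : Rbar), 0 < a /\
    (forall t, Defs.open_interval lo hi t <-> exists s, Rabs (s - c) < r /\ Phi s = t) /\
    (forall t, Defs.open_interval lo hi t -> 0 < radicand a (-9) t) /\
    (forall s, Rabs (s - c) < r ->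
       1 * RInt (fun tau => / sqrt (radicand a (-9) tau)) (Phi c) (Phi s) + c = s).
Proof.
  intros Pr H1 H2.
  set (En := fun s => Phi1 s * Phi1 s + exp (2 * Phi s) + 3 * exp (- (2 / 3) * Phi s)).
  assert (CE : forall s, Rabs (s - c) < r -> En s = En c).
  { apply constant_of_derive_0; intros s Hs; unfold En.
    destruct (H1 s Hs) as [D1 _]; assert (D2 := H2 s Hs).
    auto_derive.
    - repeat split; eexists; eassumption.
    - replace (Derive (fun x => Phi x) s) with (Phi1 s)
        by (symmetry; exact (is_derive_unique _ _ _ D1)).
      replace (Derive (fun x => Phi1 x) s) with (exp (- (2 / 3) * Phi s) - exp (2 * Phi s))
        by (symmetry; exact (is_derive_unique _ _ _ D2)).
      field. }
  destruct (increasing_image Phi c r Pr) as (lo & hi & HI).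
  { intros s Hs; apply derivable_continuous_pt; exists (Phi1 s).
    exact (proj1 (is_derive_Reals _ _ _) (proj1 (H1 s Hs))). }
  { exact (increasing_of_derive Phi Phi1 c r H1). }
  assert (Hc : Rabs (c - c) < r) by (unfold Rminus; rewrite Rplus_opp_r, Rabs_R0; exact Pr).
  assert (HR : forall s, Rabs (s - c) < r -> radicand (En c) (-9) (Phi s) = Phi1 s * Phi1 s).
  { intros s Hs; rewrite <- (CE s Hs); unfold radicand, En; field. }
  assert (HP : forall t, Defs.open_interval lo hi t -> 0 < radicand (En c) (-9) t).
  { intros t Ht; apply HI in Ht; destruct Ht as (s & Hs & <-); rewrite (HR s Hs).
    destruct (H1 s Hs); nra. }
  exists (En c), lo, hi; split; [|split; [exact HI|split; [exact HP|]]].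
  - unfold En; assert (X := exp_pos (2 * Phi c)); assert (Y := exp_pos (- (2 / 3) * Phi c)).
    assert (Z := Rle_0_sqr (Phi1 c)); unfold Rsqr in Z; lra.
  - intros s Hs.
    set (T := fun s => RInt (fun tau => / sqrt (radicand (En c) (-9) tau)) (Phi c) (Phi s)).
    assert (K : T s - s = T c - c).
    { apply (constant_of_derive_0 (fun s => T s - s) c r); [|exact Hs].
      intros x Hx; destruct (H1 x Hx) as [D Px].
      assert (Q := is_derive_quadrature (En c) (-9) lo hi (Phi c) (Phi x) HP
        (proj2 (HI _) (ex_intro _ c (conj Hc eq_refl)))
        (proj2 (HI _) (ex_intro _ x (conj Hx eq_refl)))).
      rewrite (HR x Hx), sqrt_square in Q by lra.
      assert (X := is_derive_comp _ Phi x _ _ Q D).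
      replace 0 with (Phi1 x * / Phi1 x - 1) by (field; lra).
      exact (is_derive_minus _ _ _ _ _ X (is_derive_id x)). }
    replace (T c) with 0 in K by (symmetry; exact (RInt_point _ _)).
    unfold T in K; lra.
Qed.


(** * Gradient, inner product and directional derivative in any chart *)

Section Invariance.
Context {S : surface} {g : bifield S} (Hg : is_metric g).
Implicit Types (c d : chart S) (f h : S -> R) (p q : S) (X Y : field S) (i j k : axis).

Lemma grad_lower c f i p : atlas c -> dom c p ->
  sum2 (fun j => g c i j p * grad g f c j p) = pd c i f p.
Proof.
  intros Ac Hc; assert (N := gdet_neq0 Hg c p Ac Hc).
  unfold grad, sum2, ginv; unfold gdet in *.
  rewrite (metric_sym Hg c e2 e1 p Ac Hc) in *.
  destruct i; rewrite ?(metric_sym Hg c e2 e1 p Ac Hc); field; exact N.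
Qed.

(** The transformation law at one point; unlike [is_vector_field] it can be
    stated for a gradient where the function is smooth. *)
Definition tensorial X p : Prop := forall c d k, atlas c -> atlas d -> dom c p -> dom d p ->
  X d k p = push c d (X c) k p.

Lemma vector_field_tensorial X p : is_vector_field X -> tensorial X p.
Proof.
  intros [H _] c d k Ac Ad Hc Hd; rewrite (H c d p k Ac Ad Hc Hd); unfold push, sum2; ring.
Qed.

Lemma scale_tensorial f X p : tensorial X p -> tensorial (scale f X) p.
Proof.
  intros H c d k Ac Ad Hc Hd; unfold scale; rewrite (H c d k Ac Ad Hc Hd).
  unfold push, sum2; ring.
Qed.

Lemma jacobian_kernel c d (x : axis -> R) p : atlas c -> atlas d -> dom c p -> dom d p ->
  (forall i, sum2 (fun k => pd c i (coord d k) p * x k) = 0) -> forall k, x k = 0.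
Proof.
  intros Ac Ad Hc Hd H k; assert (N := jac_neq0 Hg c d p Ac Ad Hc Hd); unfold jac in N.
  destruct (kernel2 _ _ _ _ _ _ N (H e1) (H e2)); destruct k; assumption.
Qed.

Lemma metric_kernel c (x : axis -> R) p : atlas c -> dom c p ->
  (forall i, sum2 (fun k => g c i k p * x k) = 0) -> forall k, x k = 0.
Proof.
  intros Ac Hc H k; assert (N := gdet_neq0 Hg c p Ac Hc); unfold gdet in N.
  destruct (kernel2 _ _ _ _ _ _ N (H e1) (H e2)); destruct k; assumption.
Qed.

(** The gradient is determined by its inner products with the coordinate fields,
    which are the partial derivatives, and those obey the chain rule. *)
Lemma grad_tensorial f p : smooth p f -> tensorial (grad g f) p.
Proof.
  intros Sf c d k Ac Ad Hc Hd; apply Rminus_diag_uniq; revert k.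
  apply (metric_kernel d _ p Ad Hd).
  apply (jacobian_kernel c d _ p Ac Ad Hc Hd); intros i.
  transitivity (sum2 (fun l => pd c i (coord d l) p * sum2 (fun k => g d l k p * grad g f d k p))
    - sum2 (fun j => g c i j p * grad g f c j p)).
  - unfold sum2; rewrite !(metric_pull Hg c d i) by assumption; unfold push, sum2; ring.
  - rewrite grad_lower by assumption; unfold sum2 at 1.
    rewrite !grad_lower, (pd_chain c d i f p Ac Ad Hc Hd Sf) by assumption; unfold sum2; ring.
Qed.

Lemma innerE d X Y p : atlas d -> dom d p -> tensorial X p -> tensorial Y p ->
  inner g X Y p = sum2 (fun i => sum2 (fun j => g d i j p * X d i p * Y d j p)).
Proof.
  intros Ad Hd HX HY; assert (Ac := chart_at_atlas p); assert (Hc := chart_at_dom p).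
  unfold inner; unfold sum2 at 3 4.
  rewrite !(HX (chart_at p) d), !(HY (chart_at p) d) by assumption.
  unfold sum2; rewrite !(metric_pull Hg (chart_at p) d) by assumption.
  unfold push, sum2; ring.
Qed.

Lemma actE d X f p : atlas d -> dom d p -> tensorial X p -> smooth p f ->
  act X f p = sum2 (fun i => X d i p * pd d i f p).
Proof.
  intros Ad Hd HX Sf; assert (Ac := chart_at_atlas p); assert (Hc := chart_at_dom p).
  unfold act, sum2; rewrite !(HX (chart_at p) d) by assumption.
  rewrite !(fun i => pd_chain (chart_at p) d i f p Ac Ad Hc Hd Sf).
  unfold push, sum2; ring.
Qed.

Lemma smooth_grad c f k p : atlas c -> dom c p -> smooth p f -> smooth p (grad g f c k).
Proof. intros Ac Hc Sf; unfold grad; smooth_tac. Qed.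

End Invariance.
#[export] Hint Resolve smooth_grad : smooth.



(** * Unit fields and closed forms *)

Section Curl.
Context {S : surface} {g : bifield S} (Hg : is_metric g).
Implicit Types (c d : chart S) (p q : S) (i j k : axis).

Definition flat c (Y : axis -> S -> R) i q : R := sum2 (fun j => g c i j q * Y j q).

(** The two sides differ by half of the differential of the squared length of the
    field, which is constant. *)
Lemma unit_field_curl c (Y : axis -> S -> R) j p : atlas c -> dom c p ->
  (forall k, smooth p (Y k)) ->
  near p (fun q => sum2 (fun i => sum2 (fun j => g c i j q * Y i q * Y j q)) = 1) ->
  sum2 (fun i => Y i p * (pd c i (flat c Y j) p - pd c j (flat c Y i) p)) =
  sum2 (fun k => g c j k p * covd g c Y Y k p).
Proof.
  intros Ac Hc SY U.
  set (T := fun i l => sum2 (fun k => g c j k p * christoffel g c k i l p)).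
  assert (ET : forall i l, T i l = / 2 * (pd c i (g c l j) p + pd c l (g c i j) p - pd c j (g c i l) p))
    by (intros; apply christoffel_lower; assumption).
  transitivity (sum2 (fun i => sum2 (fun k => Y i p * g c j k p * pd c i (Y k) p))
    + sum2 (fun i => sum2 (fun l => Y i p * Y l p * T i l))).
  2:{ unfold T, covd, sum2; ring. }
  clearbody T; unfold sum2; rewrite !ET.
  assert (E := pd_ext c j _ _ p Ac Hc U); rewrite pd_const in E; revert E.
  unfold flat, sum2; pd_simpl.
  rewrite !(pd_metric_sym Hg c _ e2 e1 p Ac Hc), !(metric_sym Hg c e2 e1 p Ac Hc).
  intros E; match type of E with ?l = 0 =>
    match goal with |- ?a = ?b => enough (a - b = - / 2 * l) by (rewrite E in *; lra) end end.
  destruct j; rewrite ?(pd_metric_sym Hg c _ e2 e1 p Ac Hc), ?(metric_sym Hg c e2 e1 p Ac Hc);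
    field.
Qed.

Lemma closed_form_primitive c p (theta : axis -> S -> R) : atlas c -> dom c p ->
  (forall q i, dom c q -> smooth q (theta i)) ->
  (forall q, dom c q -> pd c e1 (theta e2) q = pd c e2 (theta e1) q) ->
  exists U, smooth p U /\ near p (fun q => forall i, pd c i U q = theta i q).
Proof.
  intros Ac Hc Sm Cl.
  set (x0 := coord c e1 p); set (y0 := coord c e2 p).
  destruct (cimg_near c p Hc) as [r Hr]; fold x0 y0 in Hr.
  destruct (poincare (pull c (theta e1)) (pull c (theta e2)) x0 y0 r) as [v Hv].
  { intros x y Hx Hy; destruct (cinv_dom _ _ _ (Hr x y Hx Hy)) as (D & E1 & E2).
    assert (S1 := Sm _ e1 D c Ac D); assert (S2 := Sm _ e2 D c Ac D).
    assert (C := Cl _ D); rewrite !pdE in C; rewrite E1, E2 in *; auto. }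
  assert (P0 : forall a : R, Rabs (a - a) < r)
    by (intros a; unfold Rminus; rewrite Rplus_opp_r, Rabs_R0; apply cond_pos).
  set (U := fun q => v (coord c e1 q) (coord c e2 q)).
  assert (EU : forall x y, Rabs (x - x0) < r -> Rabs (y - y0) < r ->
             locally_2d (fun x y => v x y = pull c U x y) x y).
  { intros x y Hx Hy; generalize (implicit_box (fun _ _ => x0) 0 y0 r x y Hx Hy).
    apply locally_2d_mono; intros s t [Hs Ht].
    destruct (cinv_dom _ _ _ (Hr s t Hs Ht)) as (_ & E1 & E2).
    unfold pull, U; rewrite E1, E2; reflexivity. }
  exists U; split.
  - apply (smooth_intro c p U Ac Hc); apply sm_ext with v; [apply EU; apply P0|].
    apply Hv; apply P0.
  - apply (near_intro c p _ Ac Hc); exists r; intros x y Hx Hy Hxy.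
    destruct (cinv_dom _ _ _ (Hr x y Hx Hy)) as (D & E1 & E2).
    destruct (Hv x y Hx Hy) as (V1 & V2 & _).
    intros i; rewrite pdE, E1, E2, <- (partial_ext i _ _ _ _ (EU x y Hx Hy)).
    destruct i; assumption.
Qed.

End Curl.

Section ConformalChart.
Context {S : surface} {g : bifield S} (Hg : is_metric g).
Implicit Types (c d : chart S) (p q : S) (i j k : axis).

(** Differentiating the inverse of the quadrature gives phi'^2 = radicand a b phi;
    the derivative of this identity and Gauss's equation then give
    1 - K = - (b/9) exp (- (8/3) phi). *)
Lemma locally_written_chart p : locally_written g p ->
  exists c phi, atlas c /\ dom c p /\ forall q, dom c q ->
    smooth q phi /\ conformal_at (g := g) c phi q /\ pd c e2 phi q = 0 /\
    pd c e1 (gaussian_curvature g) q =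
      8 / 3 * (1 - gaussian_curvature g q) * pd c e1 phi q /\
    pd c e2 (gaussian_curvature g) q = 0.
Proof.
  intros (c & phi & ufun & lo & hi & a & b & c0 & phi0 & eps & H).
  destruct H as (Ac & Hc & HC & [HJ HI] & Pa & Nb & I0 & He & HR & HU).
  set (ph := fun q => phi (coord c e1 q)).
  assert (CF : forall q, dom c q -> conformal_at (g := g) c ph q).
  { intros q Hq i j; destruct (HC q Hq) as (E11 & E12 & E21 & E22).
    destruct i, j; unfold coord_field; rewrite ?E11, ?E12, ?E21, ?E22; unfold ph; ring. }
  assert (Sp : forall q, dom c q -> smooth q ph).
  { intros q Hq; apply smooth_ext with (fun r => / 2 * ln (g c e1 e1 r)).
    - generalize (near_dom c q Ac Hq); apply near_mono; intros r Hr.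
      rewrite (proj1 (HC r Hr)), ln_exp; unfold ph; field.
    - apply (smooth_mult q (fun _ => / 2)); [apply smooth_const|].
      apply smooth_ln; [exact (metric_11_pos Hg c q Ac Hq)|exact (metric_smooth Hg c e1 e1 q Ac Hq)]. }
  assert (II : forall q, dom c q -> Defs.open_interval lo hi (ph q)).
  { intros q Hq; apply HJ; exists (coord c e2 q); apply cimg_coord, Hq. }
  assert (D1 : forall q, dom c q -> is_derive phi (coord c e1 q) (pd c e1 ph q)).
  { intros q Hq; destruct (pd_is_derive c ph q Ac Hq (Sp q Hq)) as [D _].
    apply is_derive_ext_loc with (2 := D).
    generalize (locally_2d_1d_const_y _ _ _ (cimg_near c q Hq)); apply filter_imp.
    intros t Ht; unfold ph; rewrite (proj1 (proj2 (cinv_dom _ _ _ Ht))); reflexivity. }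
  assert (P2 : forall q, dom c q -> pd c e2 ph q = 0).
  { intros q Hq; unfold ph.
    rewrite (pd_comp1 c e2 phi _ (coord c e1) q Ac Hq (smooth_coord c e1 q Ac Hq) (D1 q Hq)).
    rewrite (pd_coord c e2 e1 q Hq); unfold coord_field; ring. }
  assert (P1 : forall q, dom c q -> pd c e1 ph q * pd c e1 ph q = radicand a b (ph q)).
  { intros q Hq; assert (R := HR _ (II q Hq)); assert (Q := sqrt_lt_R0 _ R).
    assert (Du : is_derive ufun (ph q) (eps * / sqrt (radicand a b (ph q)))).
    { apply is_derive_ext_loc with
        (fun t => eps * RInt (fun tau => / sqrt (radicand a b tau)) phi0 t + c0).
      - generalize (open_interval_locally _ _ _ (II q Hq)); apply filter_imp.
        intros t Ht; symmetry; apply HU, Ht.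
      - replace (eps * / sqrt (radicand a b (ph q)))
          with (eps * / sqrt (radicand a b (ph q)) + 0) by ring.
        apply (is_derive_plus (fun t => eps * RInt (fun tau => / sqrt (radicand a b tau)) phi0 t));
          [|apply is_derive_cst].
        apply is_derive_scal.
        exact (is_derive_quadrature a b lo hi phi0 (ph q) HR I0 (II q Hq)). }
    assert (Dc : is_derive (fun t => ufun (phi t)) (coord c e1 q)
               (pd c e1 ph q * (eps * / sqrt (radicand a b (ph q)))))
      by exact (is_derive_comp ufun phi _ _ _ Du (D1 q Hq)).
    assert (Di : is_derive (fun t => ufun (phi t)) (coord c e1 q) 1).
    { apply is_derive_ext_loc with (fun t => t); [|exact (is_derive_id (coord c e1 q))].
      generalize (locally_2d_1d_const_y _ _ _ (cimg_near c q Hq)); apply filter_imp.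
      intros t Ht; symmetry; apply HJ; exists (coord c e2 q); exact Ht. }
    assert (E : pd c e1 ph q * (eps * / sqrt (radicand a b (ph q))) = 1)
      by (rewrite <- (is_derive_unique _ _ _ Dc); exact (is_derive_unique _ _ _ Di)).
    assert (E' : pd c e1 ph q * eps = sqrt (radicand a b (ph q))).
    { transitivity (pd c e1 ph q * (eps * / sqrt (radicand a b (ph q)))
                    * sqrt (radicand a b (ph q))); [field; lra|rewrite E; ring]. }
    rewrite <- (sqrt_sqrt (radicand a b (ph q))), <- E' by lra.
    destruct He as [-> | ->]; ring. }
  assert (P11 : forall q, dom c q -> pd c e1 (pd c e1 ph) q =
     / 2 * (- (2 * b / 9) * exp (- (2 / 3) * ph q) - 2 * exp (2 * ph q))).
  { intros q Hq.
    assert (E : pd c e1 (fun r => pd c e1 ph r * pd c e1 ph r) q =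
                pd c e1 (fun r => radicand a b (ph r)) q).
    { apply (pd_ext c e1 _ _ q Ac Hq); generalize (near_dom c q Ac Hq); apply near_mono.
      intros r Hr; apply P1, Hr. }
    rewrite (pd_mult c e1 (pd c e1 ph) (pd c e1 ph)) in E by auto using smooth_pd.
    rewrite (pd_comp1 c e1 (radicand a b) _ ph q Ac Hq (Sp q Hq) (is_derive_radicand a b _)) in E.
    assert (N : pd c e1 ph q <> 0).
    { intros Z; assert (X := P1 q Hq); rewrite Z in X; assert (R := HR _ (II q Hq)); lra. }
    apply Rmult_eq_reg_l with (2 := N); lra. }
  assert (EK : forall q, dom c q ->
    gaussian_curvature g q = 1 + b / 9 * exp (- (8 / 3) * ph q)).
  { intros q Hq; rewrite (conformal_curvature Hg c ph q Ac Hq (Sp q Hq)).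
    - rewrite (P11 q Hq).
      replace (- (8 / 3) * ph q) with (- (2 * ph q) + - (2 / 3) * ph q) by field.
      rewrite exp_plus, exp_Ropp; assert (X := exp_pos (2 * ph q)); field; lra.
    - generalize (near_dom c q Ac Hq); apply near_mono; exact CF.
    - generalize (near_dom c q Ac Hq); apply near_mono; exact P2. }
  assert (PK : forall i q, dom c q -> pd c i (gaussian_curvature g) q =
    8 / 3 * (1 - gaussian_curvature g q) * pd c i ph q).
  { intros i q Hq; rewrite (EK q Hq).
    rewrite (pd_ext c i _ (fun r => 1 + b / 9 * exp (- (8 / 3) * ph r)) q Ac Hq).
    - rewrite (pd_comp1 c i (fun t => 1 + b / 9 * exp (- (8 / 3) * t))
        (b / 9 * (- (8 / 3) * exp (- (8 / 3) * ph q))) ph q Ac Hq (Sp q Hq)).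
      + field.
      + auto_derive; [exact I|field].
    - generalize (near_dom c q Ac Hq); apply near_mono; exact EK. }
  exists c, ph; split; [exact Ac|split; [exact Hc|]]; intros q Hq.
  split; [exact (Sp q Hq)|split; [exact (CF q Hq)|split; [exact (P2 q Hq)|split]]].
  - apply PK, Hq.
  - rewrite (PK e2 q Hq), (P2 q Hq); ring.
Qed.

End ConformalChart.



(** * The frame X1, X2 *)

Section Frame.
Context {S : surface} {g : bifield S} (Hg : is_metric g).
Context {X2 : field S} (HX2 : is_vector_field X2).
Implicit Types (c d : chart S) (f h : S -> R) (p q : S) (X Y : field S) (i j k : axis).
Let K := gaussian_curvature g.
Let X1 := scale (fun p => / vnorm g (grad g K) p) (grad g K).
Hypothesis HK : forall p, ~ vanishes_at (grad g K) p /\ 1 - K p > 0.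
Hypothesis HO : forall p, orthonormal_at g X1 X2 p.

Let N : S -> R := vnorm g (grad g K).
Let G := grad g K.

Let SK p : smooth p K.
Proof. apply (smooth_curvature Hg). Qed.
Let TG p : tensorial G p.
Proof. apply (grad_tensorial Hg), SK. Qed.
Let T2 p : tensorial X2 p.
Proof. apply vector_field_tensorial, HX2. Qed.

Lemma vnorm_grad_sq c p : atlas c -> dom c p ->
  0 < N p /\ N p * N p = sum2 (fun i => G c i p * pd c i K p).
Proof.
  intros Ac Hc.
  assert (P : 0 < inner g G G p).
  { unfold inner; apply (metric_pos Hg _ _ (fun i => G (chart_at p) i p)).
    - apply chart_at_atlas.
    - apply chart_at_dom.
    - destruct (Classical_Prop.classic (exists i, G (chart_at p) i p <> 0)) as [E|E]; [exact E|].
      destruct (HK p) as [V _]; destruct V; intros i.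
      destruct (Req_dec (G (chart_at p) i p) 0) as [Z|Z]; [exact Z|destruct E; exists i; exact Z]. }
  split; [exact (sqrt_lt_R0 _ P)|].
  unfold N, vnorm; rewrite sqrt_sqrt by (fold G; lra).
  fold G; rewrite (innerE Hg c G G p Ac Hc (TG p) (TG p)).
  unfold sum2; rewrite <- !(grad_lower Hg c K _ p Ac Hc); fold G; unfold sum2; ring.
Qed.

Lemma vnorm_grad_pos p : 0 < N p.
Proof.
  apply (vnorm_grad_sq (chart_at p) p); [apply chart_at_atlas|apply chart_at_dom].
Qed.

Lemma smooth_vnorm_grad p : smooth p N.
Proof.
  assert (A := chart_at_atlas p); assert (D := chart_at_dom p); set (c := chart_at p) in *.
  destruct (vnorm_grad_sq c p A D) as [P E].
  apply smooth_ext with (fun q => sqrt (sum2 (fun i => G c i q * pd c i K q))).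
  - generalize (near_dom c p A D); apply near_mono; intros q Hq.
    destruct (vnorm_grad_sq c q A Hq) as [P' E']; rewrite <- E'.
    apply sqrt_square; lra.
  - apply (smooth_sqrt p (fun q => sum2 (fun i => G c i q * pd c i K q))).
    + rewrite <- E; nra.
    + smooth_tac; try apply SK; unfold G; auto with smooth.
Qed.

Lemma act_X1_K p : act X1 K p = N p.
Proof.
  assert (A := chart_at_atlas p); assert (D := chart_at_dom p).
  destruct (vnorm_grad_sq (chart_at p) p A D) as [P E].
  unfold act, X1, scale, sum2; fold N; fold G; unfold sum2 in E.
  apply Rmult_eq_reg_l with (N p); [|lra]; rewrite E; field; lra.
Qed.

Lemma X2_orthogonal c p : atlas c -> dom c p -> sum2 (fun i => X2 c i p * pd c i K p) = 0.
Proof.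
  intros Ac Hc; destruct (HO p) as (_ & _ & E).
  rewrite (innerE Hg c X1 X2 p Ac Hc) in E; [|apply scale_tensorial, TG|apply T2].
  assert (P := vnorm_grad_pos p).
  apply Rmult_eq_reg_l with (/ N p); [|apply Rinv_neq_0_compat; lra].
  rewrite Rmult_0_r, <- E; unfold X1, scale; fold N; fold G.
  unfold sum2; rewrite <- !(grad_lower Hg c K _ p Ac Hc); fold G; unfold sum2.
  rewrite (metric_sym Hg c e2 e1 p Ac Hc); ring.
Qed.

Lemma X2_unit c p : atlas c -> dom c p ->
  sum2 (fun i => sum2 (fun j => g c i j p * X2 c i p * X2 c j p)) = 1.
Proof.
  intros Ac Hc; destruct (HO p) as (_ & E & _).
  rewrite (innerE Hg c X2 X2 p Ac Hc (T2 p) (T2 p)) in E; exact E.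
Qed.

Lemma smooth_X2 c k p : atlas c -> dom c p -> smooth p (X2 c k).
Proof.
  intros Ac Hc; destruct HX2 as [_ H]; exact (smooth_of_smooth_in c _ p Ac Hc (H c k Ac)).
Qed.

Lemma act_X2 c p : atlas c -> dom c p ->
  act X2 (act X1 K) p = sum2 (fun i => X2 c i p * pd c i N p).
Proof.
  intros Ac Hc; rewrite <- (actE c X2 N p Ac Hc (T2 p) (smooth_vnorm_grad p)).
  assert (A := chart_at_atlas p); assert (D := chart_at_dom p).
  unfold act at 1 3, sum2.
  rewrite !(fun i => pd_ext (chart_at p) i (act X1 K) N p A D (near_all _ _ act_X1_K)).
  reflexivity.
Qed.

Lemma X1_rhs c k p : atlas c -> dom c p ->
  scale (fun p => - (3 * act X1 K p) / (8 * (1 - K p))) X1 c k p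
  = - (3 / (8 * (1 - K p))) * G c k p.
Proof.
  intros Ac Hc; unfold scale at 1; rewrite act_X1_K; unfold X1, scale; fold N; fold G.
  assert (P := vnorm_grad_pos p); destruct (HK p) as [_ P']; field; lra.
Qed.


Lemma X2_neq0 c p : atlas c -> dom c p -> ~ (X2 c e1 p = 0 /\ X2 c e2 p = 0).
Proof.
  intros Ac Hc [E1 E2]; assert (U := X2_unit c p Ac Hc); unfold sum2 in U.
  rewrite E1, E2 in U; lra.
Qed.

(** * From the normal form to the two equations *)

(** X2 has no u component and squared length 1, so its v component squared is
    exp (- 2 phi).  In the given chart both sides of the
    second equation are [- phi_u exp (- 2 phi)] times the coordinate field of u,
    and [covd_law] carries the equation to the other charts. *)
Lemma equations_of_normal_form p : locally_written g p ->
  act X2 (act X1 K) p = 0 /\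
  forall c i, atlas c -> dom c p -> nabla g X2 X2 c i p =
    scale (fun p => - (3 * act X1 K p) / (8 * (1 - K p))) X1 c i p.
Proof.
  intros L; destruct (locally_written_chart Hg p L) as (c & phi & Ac & Hc & H); fold K in H.
  assert (ND := near_dom c p Ac Hc).
  destruct (H p Hc) as (Sp & CF & P2 & K1 & K2).
  assert (Pe := exp_pos (2 * phi p)).
  assert (Gc : forall q, dom c q -> G c e1 q * exp (2 * phi q) = pd c e1 K q /\
                                    G c e2 q = 0).
  { intros q Hq; destruct (H q Hq) as (_ & C & _ & _ & K2').
    assert (L1 := grad_lower Hg c K e1 q Ac Hq); assert (L2 := grad_lower Hg c K e2 q Ac Hq).
    fold G in L1, L2; unfold sum2 in L1, L2; rewrite !C in L1, L2; unfold coord_field in *.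
    rewrite K2' in L2; assert (Pq := exp_pos (2 * phi q)); split; [lra|].
    apply Rmult_eq_reg_l with (exp (2 * phi q)); lra. }
  assert (NN : forall q, dom c q -> N q * N q * exp (2 * phi q) = pd c e1 K q * pd c e1 K q).
  { intros q Hq; destruct (vnorm_grad_sq c q Ac Hq) as [_ E]; destruct (Gc q Hq) as [G1 G2].
    rewrite E; unfold sum2; rewrite G2, <- G1; ring. }
  assert (K1n : forall q, dom c q -> pd c e1 K q <> 0).
  { intros q Hq Z; assert (E := NN q Hq); rewrite Z in E; assert (Pq := exp_pos (2 * phi q)).
    assert (PN := vnorm_grad_pos q).
    assert (X := Rmult_lt_0_compat _ _ (Rmult_lt_0_compat _ _ PN PN) Pq); lra. }
  assert (Y1 : forall q, dom c q -> X2 c e1 q = 0).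
  { intros q Hq; assert (E := X2_orthogonal c q Ac Hq); unfold sum2 in E.
    destruct (H q Hq) as (_ & _ & _ & _ & K2'); rewrite K2' in E.
    apply Rmult_eq_reg_r with (2 := K1n q Hq); lra. }
  assert (Y2 : forall q, dom c q -> exp (2 * phi q) * (X2 c e2 q * X2 c e2 q) = 1).
  { intros q Hq; assert (E := X2_unit c q Ac Hq); destruct (H q Hq) as (_ & C & _).
    unfold sum2 in E; rewrite !C, (Y1 q Hq) in E; unfold coord_field in E; lra. }
  assert (De : forall i, pd c i (fun q => exp (2 * phi q)) p = 2 * exp (2 * phi p) * pd c i phi p).
  { intros i; apply (pd_comp1 c i (fun t => exp (2 * t)) _ phi p Ac Hc Sp).
    auto_derive; [exact I|ring]. }
  assert (Se : smooth p (fun q => exp (2 * phi q))) by smooth_tac.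
  assert (SN := smooth_vnorm_grad p); assert (SKp := SK p).
  assert (SY := smooth_X2 c e2 p Ac Hc).
  split.
  - rewrite (act_X2 c p Ac Hc); unfold sum2; rewrite (Y1 p Hc).
    assert (E : pd c e2 (fun q => N q * N q * exp (2 * phi q)) p =
                pd c e2 (fun q => pd c e1 K q * pd c e1 K q) p).
    { apply (pd_ext c e2 _ _ p Ac Hc); revert ND; apply near_mono; exact NN. }
    assert (K12 : pd c e2 (pd c e1 K) p = 0).
    { rewrite (pd_comm c e2 e1 K p Ac Hc SKp), <- (pd_const c e1 0 p).
      apply (pd_ext c e1 _ _ p Ac Hc); revert ND; apply near_mono; intros q Hq.
      apply (H q Hq). }
    rewrite (pd_mult c e2 (fun q => N q * N q)), (pd_mult c e2 N N),
      (pd_mult c e2 (pd c e1 K) (pd c e1 K)), (De e2), P2, K12 in E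
      by auto using smooth_mult, smooth_pd.
    assert (PN := vnorm_grad_pos p).
    assert (Z : pd c e2 N p = 0).
    { apply Rmult_eq_reg_l with (N p * exp (2 * phi p)); [lra|].
      apply Rgt_not_eq, Rmult_lt_0_compat; assumption. }
    rewrite Z; ring.
  - assert (Q := H p Hc); destruct Q as (_ & _ & _ & Q1 & _).
    destruct (HK p) as [_ P1K]; fold K in P1K.
    assert (Main : forall k, covd g c (X2 c) (X2 c) k p = - (3 / (8 * (1 - K p))) * G c k p).
    { assert (Cc : forall k i j, christoffel g c k i j p =
          pd c i phi p * coord_field j k p + pd c j phi p * coord_field i k p
          - pd c k phi p * coord_field i j p).
      { intros k i j; apply conformal_christoffel; try assumption.
        revert ND; apply near_mono; intros q Hq; apply (H q Hq). }
      destruct (Gc p Hc) as [G1 G2].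
      intros [|]; unfold covd, sum2; rewrite !Cc, (Y1 p Hc), P2; unfold coord_field.
      - assert (Z : pd c e2 (X2 c e1) p = 0).
        { rewrite <- (pd_const c e2 0 p).
          apply (pd_ext c e2 _ _ p Ac Hc); revert ND; apply near_mono; exact Y1. }
        rewrite Z.
        assert (E : G c e1 p = 8 / 3 * (1 - K p) * pd c e1 phi p * (X2 c e2 p * X2 c e2 p)).
        { apply Rmult_eq_reg_r with (exp (2 * phi p)); [|lra].
          rewrite G1, Q1, <- (Rmult_1_r (8 / 3 * (1 - K p) * pd c e1 phi p)) at 1.
          rewrite <- (Y2 p Hc); ring. }
        rewrite E; field; lra.
      - rewrite G2.
        assert (E : pd c e2 (fun q => exp (2 * phi q) * (X2 c e2 q * X2 c e2 q)) p = 0).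
        { rewrite <- (pd_const c e2 1 p).
          apply (pd_ext c e2 _ _ p Ac Hc); revert ND; apply near_mono; exact Y2. }
        rewrite (pd_mult c e2 (fun q => exp (2 * phi q)) (fun q => X2 c e2 q * X2 c e2 q)),
          (pd_mult c e2 (X2 c e2) (X2 c e2)), (De e2), P2 in E by auto using smooth_mult.
        assert (Z : X2 c e2 p * pd c e2 (X2 c e2) p = 0).
        { apply Rmult_eq_reg_l with (exp (2 * phi p)); lra. }
        lra. }
    intros d k Ad Hd; rewrite (X1_rhs d k p Ad Hd).
    unfold nabla; rewrite (covd_law Hg c d (X2 c) (X2 c)); try assumption.
    + rewrite (TG p c d k Ac Ad Hc Hd); unfold push, sum2; rewrite !Main; ring.
    + intros i; apply smooth_X2; assumption.
    + intros a; exact (T2 p c d a Ac Ad Hc Hd).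
    + intros a; generalize (near_and _ _ _ ND (near_dom d p Ad Hd)); apply near_mono.
      intros q [Hq Hq']; exact (T2 q c d a Ac Ad Hq Hq').
Qed.

(** * From the two equations to the normal form *)

Hypothesis HA : forall p, act X2 (act X1 K) p = 0.
Hypothesis HB : vf_eq (nabla g X2 X2)
  (scale (fun p => - (3 * act X1 K p) / (8 * (1 - K p))) X1).

(** The normalisation 1 - K = exp (- (8/3) phi) amounts to b = -9: another
    admissible b corresponds to adding a constant to phi, that is, to rescaling u
    and v. *)
Let phi p : R := - (3 / 8) * ln (1 - K p).
Let mu p : R := 3 / (8 * (1 - K p)).

(** The differentials of the coordinates to be constructed: the forms dual to
    [X1] and [X2], divided by the conformal factor exp phi. *)
Let theta1 c i p : R := pd c i K p / (N p * exp (phi p)).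
Let theta2 c i p : R := flat (g := g) c (X2 c) i p / exp (phi p).

Let K_lt_1 p : 0 < 1 - K p.
Proof. destruct (HK p) as [_ X]; exact X. Qed.

Let smooth_phi p : smooth p phi.
Proof.
  unfold phi; apply (smooth_mult p (fun _ => - (3 / 8))); [apply smooth_const|].
  apply (smooth_ln p (fun q => 1 - K q)); [apply K_lt_1|].
  apply (smooth_minus p (fun _ => 1)); [apply smooth_const|apply SK].
Qed.

Let pd_phi c i p : atlas c -> dom c p -> pd c i phi p = mu p * pd c i K p.
Proof.
  intros Ac Hc; assert (P := K_lt_1 p).
  apply (pd_comp1 c i (fun t => - (3 / 8) * ln (1 - t)) (mu p) K p Ac Hc (SK p)).
  unfold mu; auto_derive; [lra|field; lra].
Qed.

Let smooth_flat c i p : atlas c -> dom c p -> smooth p (flat (g := g) c (X2 c) i).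
Proof.
  intros Ac Hc; unfold flat; apply smooth_sum2; intros j.
  apply smooth_mult; [exact (metric_smooth Hg c i j p Ac Hc)|exact (smooth_X2 c j p Ac Hc)].
Qed.

Lemma theta1_smooth c i p : atlas c -> dom c p -> smooth p (theta1 c i).
Proof.
  intros Ac Hc; assert (PN := vnorm_grad_pos p); assert (Pe := exp_pos (phi p)).
  apply (smooth_div p (pd c i K) (fun q => N q * exp (phi q))).
  - apply Rgt_not_eq, Rmult_lt_0_compat; assumption.
  - apply smooth_pd; auto.
  - apply (smooth_mult p N (fun q => exp (phi q))); [apply smooth_vnorm_grad|].
    apply smooth_exp, smooth_phi.
Qed.

Lemma theta2_smooth c i p : atlas c -> dom c p -> smooth p (theta2 c i).
Proof.
  intros Ac Hc; assert (Pe := exp_pos (phi p)).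
  apply (smooth_div p (flat c (X2 c) i) (fun q => exp (phi q))).
  - lra.
  - apply smooth_flat; assumption.
  - apply smooth_exp, smooth_phi.
Qed.

Let pd_exp_phi c i p : atlas c -> dom c p ->
  pd c i (fun q => exp (phi q)) p = exp (phi p) * (mu p * pd c i K p).
Proof.
  intros Ac Hc; rewrite <- (pd_phi c i p Ac Hc).
  apply (pd_comp1 c i exp _ phi p Ac Hc (smooth_phi p)).
  auto_derive; [exact I|ring].
Qed.

Lemma pd_quotient c i (f h : S -> R) p : atlas c -> dom c p -> h p <> 0 ->
  smooth p f -> smooth p h ->
  pd c i (fun q => f q / h q) p = (pd c i f p * h p - f p * pd c i h p) / (h p * h p).
Proof.
  intros Ac Hc Hp Sf Sh; unfold Rdiv at 1.
  rewrite (pd_mult c i f (fun q => / h q)), (pd_inv c i h) by auto using smooth_inv.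
  field; exact Hp.
Qed.

(** Both the differential of |grad K| and that of K annihilate X2. *)
Lemma theta1_closed c p : atlas c -> dom c p ->
  pd c e1 (theta1 c e2) p = pd c e2 (theta1 c e1) p.
Proof.
  intros Ac Hc; assert (PN := vnorm_grad_pos p); assert (Pe := exp_pos (phi p)).
  assert (SN := smooth_vnorm_grad p).
  assert (Se : smooth p (fun q => exp (phi q))) by apply smooth_exp, smooth_phi.
  assert (E : pd c e1 N p * pd c e2 K p = pd c e2 N p * pd c e1 K p).
  { destruct (Req_dec (pd c e1 N p * pd c e2 K p - pd c e2 N p * pd c e1 K p) 0) as [Z|Z]; [lra|].
    destruct (X2_neq0 c p Ac Hc).
    assert (A := HA p); rewrite (act_X2 c p Ac Hc) in A.
    assert (B := X2_orthogonal c p Ac Hc); unfold sum2 in A, B.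
    apply (kernel2 (pd c e1 N p) (pd c e2 N p) (pd c e1 K p) (pd c e2 K p)); lra. }
  unfold theta1.
  rewrite !(fun i j => pd_quotient c i (pd c j K) (fun q => N q * exp (phi q)) p Ac Hc
      ltac:(apply Rgt_not_eq, Rmult_lt_0_compat; assumption)
      (smooth_pd c j K p Ac Hc (SK p)) (smooth_mult p N (fun q => exp (phi q)) SN Se)).
  rewrite !(fun i => pd_mult c i N (fun q => exp (phi q)) p Ac Hc SN Se), !pd_exp_phi by assumption.
  rewrite (pd_comm c e1 e2 K p Ac Hc (SK p)).
  apply Rminus_diag_uniq.
  transitivity (- (pd c e1 N p * pd c e2 K p - pd c e2 N p * pd c e1 K p)
    / (N p * N p * exp (phi p))); [|rewrite E]; field; lra.
Qed.

(** The equation for the acceleration of X2 says that the contraction of X2 with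
    the differential of its dual form is a multiple of dK, which the differential
    of the conformal factor cancels. *)
Lemma theta2_closed c p : atlas c -> dom c p ->
  pd c e1 (theta2 c e2) p = pd c e2 (theta2 c e1) p.
Proof.
  intros Ac Hc; assert (Pe := exp_pos (phi p)).
  assert (Se : smooth p (fun q => exp (phi q))) by apply smooth_exp, smooth_phi.
  assert (C : forall j, sum2 (fun i => X2 c i p *
      (pd c i (flat (g := g) c (X2 c) j) p - pd c j (flat (g := g) c (X2 c) i) p)) = - mu p * pd c j K p).
  { intros j; rewrite (unit_field_curl Hg c (X2 c) j p Ac Hc).
    - rewrite <- (grad_lower Hg c K j p Ac Hc); unfold sum2.
      change (covd g c (X2 c) (X2 c)) with (nabla g X2 X2 c).
      rewrite !HB, !X1_rhs by assumption; fold G; unfold mu; ring.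
    - intros k; apply smooth_X2; assumption.
    - generalize (near_dom c p Ac Hc); apply near_mono; intros q Hq.
      apply X2_unit; assumption. }
  assert (C1 := C e1); assert (C2 := C e2); clear C.
  assert (U := X2_unit c p Ac Hc).
  assert (U' : X2 c e1 p * flat (g := g) c (X2 c) e1 p + X2 c e2 p * flat (g := g) c (X2 c) e2 p = 1)
    by (rewrite <- U; unfold flat, sum2; ring).
  unfold theta2.
  rewrite !(fun i j => pd_quotient c i (flat c (X2 c) j) (fun q => exp (phi q)) p Ac Hc
      ltac:(lra) (smooth_flat c j p Ac Hc) Se).
  rewrite !pd_exp_phi by assumption; unfold sum2 in C1, C2.
  set (w1 := flat (g := g) c (X2 c) e1 p) in *; set (w2 := flat (g := g) c (X2 c) e2 p) in *.
  set (k := pd c e1 (flat (g := g) c (X2 c) e2) p - pd c e2 (flat (g := g) c (X2 c) e1) p).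
  assert (M1 : mu p * pd c e1 K p = X2 c e2 p * k) by (unfold k; lra).
  assert (M2 : mu p * pd c e2 K p = - (X2 c e1 p * k)) by (unfold k; lra).
  rewrite M1, M2; apply Rminus_diag_uniq.
  transitivity (k * (1 - (X2 c e1 p * w1 + X2 c e2 p * w2)) / exp (phi p)).
  - unfold k; field; lra.
  - rewrite U'; field; lra.
Qed.

(** The difference of the two sides annihilates both X2 and grad K, which span
    the tangent plane. *)
Lemma metric_orthogonal_split c i j p : atlas c -> dom c p ->
  g c i j p = exp (2 * phi p) * (theta1 c i p * theta1 c j p + theta2 c i p * theta2 c j p).
Proof.
  intros Ac Hc; assert (PN := vnorm_grad_pos p); assert (Pe := exp_pos (phi p)).
  set (w := fun i => flat (g := g) c (X2 c) i p).
  set (h := fun i j => g c i j p - pd c i K p * pd c j K p / (N p * N p) - w i * w j).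
  destruct (vnorm_grad_sq c p Ac Hc) as [_ EN].
  assert (EK := X2_orthogonal c p Ac Hc); assert (EU := X2_unit c p Ac Hc).
  assert (GL := fun i => grad_lower Hg c K i p Ac Hc); fold G in GL.
  assert (Sy := metric_sym Hg c e2 e1 p Ac Hc).
  assert (Ew : sum2 (fun j => w j * X2 c j p) = 1).
  { rewrite <- EU; unfold w, flat, sum2; ring. }
  assert (EG : sum2 (fun j => w j * G c j p) = 0).
  { rewrite <- EK; unfold sum2; rewrite <- !GL; unfold w, flat, sum2; rewrite Sy; ring. }
  assert (HY : forall i, X2 c e1 p * h i e1 + X2 c e2 p * h i e2 = 0).
  { intros l.
    transitivity (w l - pd c l K p / (N p * N p) * sum2 (fun j => X2 c j p * pd c j K p)
      - w l * sum2 (fun j => w j * X2 c j p)).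
    - unfold h, w, flat, sum2; field; lra.
    - rewrite EK, Ew; ring. }
  assert (HG : forall i, G c e1 p * h i e1 + G c e2 p * h i e2 = 0).
  { intros l.
    transitivity (sum2 (fun j => g c l j p * G c j p)
      - pd c l K p / (N p * N p) * sum2 (fun j => G c j p * pd c j K p)
      - w l * sum2 (fun j => w j * G c j p)).
    - unfold h, sum2; field; lra.
    - rewrite EG, <- EN, GL; field; lra. }
  assert (D : X2 c e1 p * G c e2 p - X2 c e2 p * G c e1 p <> 0).
  { intros Z.
    (* the Gram determinant of X2 and grad K is |grad K|^2 *)
    assert (Gram : gdet g c p * ((X2 c e1 p * G c e2 p - X2 c e2 p * G c e1 p)
        * (X2 c e1 p * G c e2 p - X2 c e2 p * G c e1 p))
      = sum2 (fun j => w j * X2 c j p) * sum2 (fun i => G c i p * sum2 (fun j => g c i j p * G c j p))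
      - sum2 (fun j => w j * G c j p) * sum2 (fun j => w j * G c j p)).
    { unfold gdet, w, flat, sum2; rewrite Sy; ring. }
    rewrite Z, Ew, EG in Gram; unfold sum2 in Gram at 1; rewrite !GL in Gram.
    unfold sum2 in EN; assert (X := Rmult_lt_0_compat _ _ PN PN); lra. }
  assert (H0 : h i j = 0).
  { destruct (kernel2 _ _ _ _ _ _ D (HY i) (HG i)); destruct j; assumption. }
  unfold h in H0; unfold theta1, theta2; fold (w i) (w j).
  replace (exp (2 * phi p)) with (exp (phi p) * exp (phi p)) by (rewrite <- exp_plus; f_equal; ring).
  transitivity (pd c i K p * pd c j K p / (N p * N p) + w i * w j); [lra|field; lra].
Qed.

Lemma theta_independent c p : atlas c -> dom c p ->
  theta1 c e1 p * theta2 c e2 p - theta1 c e2 p * theta2 c e1 p <> 0.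
Proof.
  intros Ac Hc Z; apply (gdet_neq0 Hg c p Ac Hc); unfold gdet.
  rewrite !metric_orthogonal_split by assumption.
  transitivity (exp (2 * phi p) * exp (2 * phi p) *
    ((theta1 c e1 p * theta2 c e2 p - theta1 c e2 p * theta2 c e1 p) *
     (theta1 c e1 p * theta2 c e2 p - theta1 c e2 p * theta2 c e1 p))); [ring|rewrite Z; ring].
Qed.

(** The rows of the Jacobian are the values of [theta1] and [theta2], so components
    in [d] are coefficients with respect to these two forms; those of dphi are
    mu |grad K| exp phi and 0. *)
Lemma adapted_chart c d q : atlas c -> atlas d -> dom c q -> dom d q ->
  (forall i, pd c i (coord d e1) q = theta1 c i q) ->
  (forall i, pd c i (coord d e2) q = theta2 c i q) ->
  conformal_at (g := g) d phi q /\ 0 < pd d e1 phi q /\ pd d e2 phi q = 0.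
Proof.
  intros Ac Ad Hc Hd J1 J2.
  assert (CF : conformal_at (g := g) d phi q).
  { intros k l; apply Rminus_diag_uniq; revert l.
    apply (jacobian_kernel Hg c d _ q Ac Ad Hc Hd); intros j; revert k.
    apply (jacobian_kernel Hg c d _ q Ac Ad Hc Hd); intros i.
    transitivity (g c i j q
      - exp (2 * phi q) * (theta1 c i q * theta1 c j q + theta2 c i q * theta2 c j q)).
    - rewrite (metric_pull Hg c d i j) by assumption; unfold sum2, coord_field.
      rewrite <- !J1, <- !J2; ring.
    - rewrite <- metric_orthogonal_split by assumption; ring. }
  split; [exact CF|].
  assert (PN := vnorm_grad_pos q); assert (Pe := exp_pos (phi q)); assert (P := K_lt_1 q).
  assert (X : forall k, pd d k phi q - mu q * N q * exp (phi q) * coord_field e1 k q = 0).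
  { apply (jacobian_kernel Hg c d _ q Ac Ad Hc Hd); intros i.
    transitivity (pd c i phi q - mu q * N q * exp (phi q) * theta1 c i q).
    - rewrite (pd_chain c d i phi q Ac Ad Hc Hd (smooth_phi q)), <- J1.
      unfold sum2, coord_field; ring.
    - rewrite pd_phi by assumption; unfold theta1; field; lra. }
  assert (X1' := X e1); assert (X2' := X e2); unfold coord_field in X1', X2'; split; [|lra].
  assert (Pm : 0 < mu q) by (apply Rdiv_lt_0_compat; lra).
  assert (Z := Rmult_lt_0_compat _ _ (Rmult_lt_0_compat _ _ Pm PN) Pe); lra.
Qed.

Lemma normal_form_of_equations p : locally_written g p.
Proof.
  assert (Ac := chart_at_atlas p); assert (Hc := chart_at_dom p); set (c := chart_at p) in *.
  destruct (closed_form_primitive c p (theta1 c) Ac Hc) as (U & SU & NU).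
  { intros q i Hq; apply theta1_smooth; assumption. }
  { intros q Hq; apply theta1_closed; assumption. }
  destruct (closed_form_primitive c p (theta2 c) Ac Hc) as (V & SV & NV).
  { intros q i Hq; apply theta2_smooth; assumption. }
  { intros q Hq; apply theta2_closed; assumption. }
  destruct (coordinates_of_independent c p U V
      (fun q => dom c q /\ (forall i, pd c i U q = theta1 c i q) /\
                (forall i, pd c i V q = theta2 c i q)) Ac Hc SU SV)
    as (d & Ad & Hd & Bd & r & Pr & Ir).
  { rewrite !(near_here _ _ NU), !(near_here _ _ NV); apply theta_independent; assumption. }
  { exact (near_and _ _ _ (near_dom c p Ac Hc) (near_and _ _ _ NU NV)). }
  assert (AC : forall q, dom d q ->
      conformal_at (g := g) d phi q /\ 0 < pd d e1 phi q /\ pd d e2 phi q = 0).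
  { intros q Hq; destruct (Bd q Hq) as ((Dq & U1 & V1) & _ & _).
    apply (adapted_chart c d q Ac Ad Dq Hq).
    - intros i; rewrite <- U1; apply (pd_ext c i _ _ q Ac Dq).
      generalize (near_dom d q Ad Hq); apply near_mono; intros s Hs; apply Bd, Hs.
    - intros i; rewrite <- V1; apply (pd_ext c i _ _ q Ac Dq).
      generalize (near_dom d q Ad Hq); apply near_mono; intros s Hs; apply Bd, Hs. }
  assert (CK : forall q, dom d q -> pd d e1 (pd d e1 phi) q =
             exp (- (2 / 3) * phi q) - exp (2 * phi q)).
  { intros q Hq; assert (ND := near_dom d q Ad Hq).
    assert (E := conformal_curvature Hg d phi q Ad Hq (smooth_phi q)
      (near_mono q _ _ (fun s Hs => proj1 (AC s Hs)) ND)
      (near_mono q _ _ (fun s Hs => proj2 (proj2 (AC s Hs))) ND)).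
    fold K in E; assert (P := K_lt_1 q).
    assert (E1 : exp (- (8 / 3) * phi q) = 1 - K q).
    { replace (- (8 / 3) * phi q) with (ln (1 - K q)) by (unfold phi; field).
      apply exp_ln, P. }
    replace (- (2 / 3) * phi q) with (2 * phi q + - (8 / 3) * phi q) by field.
    rewrite exp_plus, E1, E, exp_Ropp; assert (Z := exp_pos (2 * phi q)); field; lra. }
  set (u0 := U p) in *; set (v0 := V p) in *.
  assert (Pv : Rabs (v0 - v0) < r) by (unfold Rminus; rewrite Rplus_opp_r, Rabs_R0; exact Pr).
  assert (Pu : Rabs (u0 - u0) < r) by (unfold Rminus; rewrite Rplus_opp_r, Rabs_R0; exact Pr).
  assert (DD : forall s t, Rabs (s - u0) < r -> Rabs (t - v0) < r ->
     dom d (cinv d s t) /\ coord d e1 (cinv d s t) = s /\ coord d e2 (cinv d s t) = t).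
  { intros s t Hs Ht; apply cinv_dom, Ir; auto. }
  (* the image of d is a square, so phi is constant along its vertical segments *)
  set (Phi := fun s => phi (cinv d s v0)).
  assert (EP : forall q, dom d q -> phi q = Phi (coord d e1 q)).
  { intros q Hq; assert (B : cimg d (coord d e1 q) (coord d e2 q)) by (apply cimg_coord, Hq).
    apply Ir in B; destruct B as [B1 B2]; unfold Phi.
    rewrite <- (cinvK Hq) at 1.
    apply (constant_of_derive_0 (fun t => phi (cinv d (coord d e1 q) t)) v0 r); [|exact B2].
    intros t Ht; destruct (DD _ t B1 Ht) as (D & E1 & E2).
    destruct (pd_is_derive d phi _ Ad D (smooth_phi _)) as [_ X].
    rewrite E1, E2, (proj2 (proj2 (AC _ D))) in X; exact X. }
  destruct (quadrature_of_ode Phi (fun s => pd d e1 phi (cinv d s v0)) u0 r Pr)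
    as (a & lo & hi & Pa & HI & HR & HQ).
  { intros s Hs; destruct (DD s v0 Hs Pv) as (D & E1 & E2).
    split; [|apply AC, D].
    destruct (pd_is_derive d phi _ Ad D (smooth_phi _)) as [X _].
    rewrite E1, E2 in X; exact X. }
  { intros s Hs; destruct (DD s v0 Hs Pv) as (D & E1 & E2).
    destruct (pd_is_derive d (pd d e1 phi) _ Ad D (smooth_pd d e1 phi _ Ad D (smooth_phi _))) as [X _].
    rewrite E1, E2, (CK _ D) in X; exact X. }
  exists d, Phi, (fun t => 1 * RInt (fun tau => / sqrt (radicand a (-9) tau)) (Phi u0) t + u0),
    lo, hi, a, (-9), u0, (Phi u0), 1.
  split; [exact Ad|split; [exact Hd|split; [|split; [split|]]]].
  - intros q Hq; rewrite <- (EP q Hq); destruct (AC q Hq) as (C & _).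
    rewrite !C; unfold coord_field; repeat split; ring.
  - intros u (v & Huv); apply Ir in Huv; destruct Huv as [Hu _]; split.
    + apply HI; exists u; auto.
    + apply HQ, Hu.
  - intros t Ht; apply HI in Ht; destruct Ht as (s & Hs & <-); rewrite (HQ s Hs).
    split; [exists v0; apply Ir; auto|reflexivity].
  - split; [exact Pa|split; [lra|split; [|split; [left; reflexivity|split; [exact HR|reflexivity]]]]].
    apply HI; exists u0; auto.
Qed.

End Frame.

Theorem proposition3p4
  (S : surface) (O : chart S -> Prop) (g : bifield S) (X2 : field S)
  (HO : is_orientation O) (Hg : is_metric g) (HX2 : is_vector_field X2) :
  let K := gaussian_curvature g in
  let X1 := scale (fun p => / vnorm g (grad g K) p) (grad g K) in
  (forall p : S, ~ vanishes_at (grad g K) p /\ 1 - K p > 0) ->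
  (forall p : S, orthonormal_at g X1 X2 p /\ positively_oriented_at O X1 X2 p) ->
  ((forall p : S, act X2 (act X1 K) p = 0) /\
   vf_eq (nabla g X2 X2)
         (scale (fun p => - (3 * act X1 K p) / (8 * (1 - K p))) X1))
  <->
  (forall p : S, locally_written g p).
Proof.
  intros K X1 HK Hframe.
  assert (Horth : forall p : S, orthonormal_at g X1 X2 p) by (intros p; apply Hframe).
  split.
  - intros [HA HB] p; exact (normal_form_of_equations Hg HX2 HK Horth HA HB p).
  - intros HL; split.
    + intros p; exact (proj1 (equations_of_normal_form Hg HX2 HK Horth p (HL p))).
    + intros c p i Ac Hc.
      exact (proj2 (equations_of_normal_form Hg HX2 HK Horth p (HL p)) c i Ac Hc).
Qed.
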